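(* Let $\mathfrak g=\mathfrak{hei}(0|m)\rtimes\mathfrak o(m)$. If $m=2n$, where $n\ge2$, $n\ne3$, then $\mathfrak g$ is a maximal subalgebra of $\mathfrak{sl}(\Lambda(n))$. If $m=2n$ and $n=3$, then $\mathfrak g\subset\mathfrak{as}\subset\mathfrak{sl}(\Lambda(3))$, and $\mathfrak{as}$ is maximal in $\mathfrak{sl}(\Lambda(3))$. If $m=2n-1$, $n>2$, then $\mathfrak g$ is a maximal subalgebra of $\mathfrak{sq}(\Lambda(n))$.
   Context: Over $\mathbb C$. For $m=2n$, $\Lambda(n)=\Lambda(\xi_1,\dots,\xi_n)$ is the Grassmann superalgebra and the Heisenberg Lie superalgebra $\mathfrak{hei}(0|2n)$ acts on it as $\mathrm{Span}(1,\xi_i,\partial_{\xi_i})$. For $m=2n-1$, $\Lambda(n)=\Lambda(\xi_1,\dots,\xi_{n-1},\theta)$ and $\mathfrak{hei}(0|2n-1)$ acts as $\mathrm{Span}(1,\xi_i,\partial_{\xi_i},\theta+\partial_\theta)$. $\mathfrak g=\mathfrak{hei}(0|m)\rtimes\mathfrak o(m)$ is the normalizer of $\mathfrak{hei}(0|m)$ in $\mathfrak{gl}(\Lambda(n))$ (for $m=2n$), equal to the span of the operators $1,\xi_i,\partial_{\xi_i},\xi_i\partial_{\xi_j},\partial_{\xi_i}\partial_{\xi_j},\xi_i\xi_j$; for $m=2n-1$ it is the span of these operators with $i,j\le n-1$ together with $\theta+\partial_\theta$, $\xi_i(\theta+\partial_\theta)$, $\partial_{\xi_i}(\theta+\partial_\theta)$.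 $\mathfrak{sl}(V)$: operators with zero supertrace. For odd $J$ with $J^2=-\mathrm{id}$, $\mathfrak q(V)=C(J)$ is the supercentralizer of $J$; in a basis with $J=\begin{pmatrix} 0 & 1 \\ -1 & 0 \end{pmatrix}$ it consists of $\begin{pmatrix} A & B \\ B & A \end{pmatrix}$, with queer trace $\mathrm{tr}\,B$, and $\mathfrak{sq}(V)$ is the subalgebra of elements of zero queer trace. For $m=2n-1$, $\mathfrak q(\Lambda(n))=C(J)$ for $J=\theta-\partial_\theta$, which supercommutes with $\mathfrak{hei}(0|2n-1)$. $\mathfrak{as}$ is the nontrivial one-dimensional central extension of $\mathfrak{spe}(4)$: its elements are $x+d\cdot z$ with $x=\begin{pmatrix} A & B \\ C & -A^t \end{pmatrix}$ ($4\times4$ blocks, $\mathrm{tr}A=0$, $B=B^t$, $C=-C^t$), $d\in\mathbb C$, $z$ central, with bracket $[x+dz,x'+d'z]=[x,x']+\mathrm{tr}(CC')z$. It acts on $\Lambda(3)$ (of superdimension $4|4$), $z$ acting as identity, as $(\mathfrak{hei}(0|6)\oplus W)\rtimes\mathfrak o(6)$ (sum as $\mathfrak o(6)$-modules), where $W$ is the $10$-dimensional irreducible $\mathfrak o(6)\cong\mathfrak{sl}(4)$-module of odd operators with highest weight $(2,0,0)$, one of the two irreducible components of the image in $\mathfrak{gl}(\Lambda(3))$ of the antisymmetrized cubic products $\Lambda^3$ of the six generators $\xi_i,\partial_{\xi_i}$. Maximal means proper and not contained in a strictly larger proper Lie subsuperalgebra.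
   Formalization: The cocycle tr(CC') in the bracket of as violates the Jacobi identity (A=diag(1,-1,0,0), C=C'=E_13-E_31); it is replaced by tr(C C'~), where C'~ is the Hodge dual of C' (C~_ij=C_kl for even permutations (ijkl)), which gives the intended nontrivial central extension of spe(4). *)

(* Defs.v *)
From HB Require Import structures.
From mathcomp Require Import all_boot all_order all_fingroup all_algebra.

Set Implicit Arguments.
Unset Strict Implicit.
Unset Printing Implicit Defensive.

Import GRing.Theory.
Local Open Scope ring_scope.

(* The bilinear extension of [x, y] = xy - (-1)^{|x||y|} yx, where
   [hp false x] and [hp true x] are the even and odd components of x. *)
Definition sbracket (F : fieldType) (T : lmodType F) (mul : T -> T -> T)
    (hp : bool -> T -> T) (x y : T) : T :=
  \sum_(p : bool) \sum_(q : bool)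
    (mul (hp p x) (hp q y) - (-1) ^+ (p && q) *: mul (hp q y) (hp p x)).

Notation svec F I := {ffun I -> F^o}.
Notation gl F I := 'End(svec F I).

Section Superspace.

(* The superspace with a homogeneous basis indexed by I; [par i] is true when
   the i-th basis vector is odd. *)
Variables (F : fieldType) (I : finType) (par : pred I).

Local Notation svec := (svec F I).
Local Notation gl := (gl F I).

Definition bvec (i : I) : svec := [ffun j => (j == i)%:R].

Definition entry (f : gl) (i j : I) : F := f (bvec j) i.

Definition op_fun (k : I -> I -> F) (v : svec) : svec :=
  [ffun i => \sum_j k i j * v j].

Lemma op_fun_linear k : linear (op_fun k).
Proof.
move=> a u v; apply/ffunP=> i; rewrite !ffunE /= scaler_sumr -big_split /=.
by apply: eq_bigr => j _; rewrite !ffunE mulrDr /GRing.scale /= mulrCA.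
Qed.

HB.instance Definition _ k :=
  @GRing.isLinear.Build F svec svec _ (op_fun k) (op_fun_linear k).

Definition op (k : I -> I -> F) : gl := linfun (op_fun k).

Lemma entry_op k i j : entry (op k) i j = k i j.
Proof.
rewrite /entry /op lfunE /= ffunE (bigD1 j) //= big1 ?ffunE ?eqxx ?mulr1 ?addr0 //.
by move=> l lj; rewrite ffunE (negPf lj) mulr0.
Qed.

Lemma svec_sum (v : svec) : v = \sum_i v i *: bvec i.
Proof.
apply/ffunP=> j; rewrite sum_ffunE (bigD1 j) //= big1 ?addr0 => [|l lj].
  by rewrite !ffunE eqxx /GRing.scale /= mulr1.
by rewrite !ffunE eq_sym (negPf lj) /GRing.scale /= mulr0.
Qed.

Lemma entryP (f g : gl) : (forall i j, entry f i j = entry g i j) -> f = g.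
Proof.
move=> fg; apply/lfunP=> v; rewrite (svec_sum v) !linear_sum /=.
apply: eq_bigr => j _; rewrite !linearZ /=; congr (_ *: _).
by apply/ffunP=> i; apply: fg.
Qed.

Lemma entry_linear a (f g : gl) i j :
  entry (a *: f + g) i j = a * entry f i j + entry g i j.
Proof. by rewrite /entry add_lfunE scale_lfunE !ffunE. Qed.

Definition hpart (p : bool) (f : gl) : gl :=
  op (fun i j => if par i (+) par j == p then entry f i j else 0).

Lemma hpartD p a f g : hpart p (a *: f + g) = a *: hpart p f + hpart p g.
Proof.
apply/entryP=> i j; rewrite entry_linear !entry_op entry_linear.
by case: ifP => // _; rewrite mulr0 addr0.
Qed.

Lemma hpart_sum f : hpart false f + hpart true f = f.
Proof.
apply/entryP=> i j; rewrite -[hpart false f]scale1r entry_linear mul1r !entry_op.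
by case: (_ (+) _); rewrite ?addr0 ?add0r.
Qed.

Definition br (f g : gl) : gl := sbracket (fun a b : gl => (a \o b)%VF) hpart f g.

Lemma br_linearl h a f g : br (a *: f + g) h = a *: br f h + br g h.
Proof.
rewrite /br /sbracket scaler_sumr -big_split; apply: eq_bigr => p _ /=.
rewrite scaler_sumr -big_split; apply: eq_bigr => q _ /=.
rewrite hpartD comp_lfunDl comp_lfunDr -!comp_lfunZl -!comp_lfunZr.
by rewrite scalerBr scalerDr opprD addrACA !scalerA [a * _]mulrC.
Qed.

Definition is_subsuperalgebra (L : {vspace gl}) : Prop :=
  (forall p f, f \in L -> hpart p f \in L) /\
  (forall f g, f \in L -> g \in L -> br f g \in L).

Definition maximal_subsuperalgebra (L M : {vspace gl}) : Prop :=
  [/\ is_subsuperalgebra L, (L <= M)%VS, L != M &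
      forall N : {vspace gl}, is_subsuperalgebra N ->
        (L <= N)%VS -> (N <= M)%VS -> N = L \/ N = M].

Definition supertrace (f : gl) : F^o := \sum_i (-1) ^+ par i * entry f i i.

Lemma supertrace_linear : linear supertrace.
Proof.
move=> a f g; rewrite /supertrace scaler_sumr -big_split /=; apply: eq_bigr => i _.
by rewrite entry_linear mulrDr /GRing.scale /= mulrCA.
Qed.
HB.instance Definition _ := GRing.isLinear.Build F gl F^o _ supertrace supertrace_linear.

Definition sl : {vspace gl} := lker (linfun supertrace).

Lemma mem_sl f : (f \in sl) = (supertrace f == 0).
Proof. by rewrite memv_ker lfunE. Qed.

Section Queer.

Variable J : gl.

Definition brJ (f : gl) : gl := br f J.

Lemma brJ_linear : linear brJ.
Proof. by move=> a f g; apply: br_linearl. Qed.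
HB.instance Definition _ := GRing.isLinear.Build F gl gl _ brJ brJ_linear.

Definition queer : {vspace gl} := lker (linfun brJ).

Lemma mem_queer f : (f \in queer) = (br f J == 0).
Proof. by rewrite memv_ker lfunE. Qed.

(* If J is odd with J^2 = -1, and v_i are the even basis vectors, then J is
   (0, 1; -1, 0) in the basis consisting of the v_i and of the odd vectors
   w_i := - J v_i.  In this basis f in q(V) is (A, B; B, A) with B_ii the
   coefficient of f w_i on v_i. *)
Definition queertrace (f : gl) : F^o := \sum_(i | ~~ par i) (f (- J (bvec i))) i.

Lemma queertrace_linear : linear queertrace.
Proof.
move=> a f g; rewrite /queertrace scaler_sumr -big_split /=; apply: eq_bigr => i _.
by rewrite add_lfunE scale_lfunE !ffunE.
Qed.
HB.instance Definition _ := GRing.isLinear.Build F gl F^o _ queertrace queertrace_linear.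

Definition sq : {vspace gl} := (queer :&: lker (linfun queertrace))%VS.

Lemma mem_sq f : (f \in sq) = (br f J == 0) && (queertrace f == 0).
Proof. by rewrite memv_cap mem_queer memv_ker lfunE. Qed.

End Queer.
End Superspace.

(* The basis vector indexed by A = {i_1 < ... < i_k} is the monomial
   xi_{i_1} ... xi_{i_k}. *)
Definition gpar (n : nat) : pred {set 'I_n} := fun A => odd #|A|.
Arguments gpar : clear implicits.

Notation Lambda F n := (svec F {set 'I_n}).
Notation glL F n := (gl F {set 'I_n}).

Section Grassmann.

Variables (F : fieldType) (n : nat).

Local Notation Lambda := (Lambda F n).
Local Notation glL := (glL F n).

(* The number of transpositions needed to sort the product of the monomials
   indexed by A and B. *)
Definition ninv (A B : {set 'I_n}) : nat :=
  #|[set p : 'I_n * 'I_n | [&& p.1 \in A, p.2 \in B & (p.2 < p.1)%N]]|.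

Definition gmul (u v : Lambda) : Lambda :=
  [ffun D : {set 'I_n} => \sum_(A : {set 'I_n} | A \subset D)
     (-1) ^+ ninv A (D :\: A) * u A * v (D :\: A)].

Lemma gmul_linear u : linear (gmul u).
Proof.
move=> a v w; apply/ffunP=> D; rewrite !ffunE /= scaler_sumr -big_split /=.
apply: eq_bigr => A _; rewrite !ffunE mulrDr /GRing.scale /=.
by rewrite mulrCA.
Qed.
HB.instance Definition _ u :=
  @GRing.isLinear.Build F (svec F {set 'I_n}) (svec F {set 'I_n}) _
    (gmul u) (gmul_linear u).

Definition gen (i : 'I_n) : Lambda := bvec F [set i].

Definition xi (i : 'I_n) : glL := linfun (gmul (gen i)).

Definition below (i : 'I_n) (A : {set 'I_n}) : nat := #|[set j in A | (j < i)%N]|.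

(* The left superderivation with respect to xi_i; see [pd_one] and [pd_xi]. *)
Definition pd (i : 'I_n) : glL :=
  op (fun B A : {set 'I_n} => if (i \in A) && (B == A :\ i)
                 then (-1) ^+ below i A else 0).

Lemma xiE (i : 'I_n) (A : {set 'I_n}) :
  xi i (bvec F A) =
    if i \in A then 0 else (-1) ^+ below i A *: bvec F (i |: A).
Proof.
rewrite /xi lfunE; apply/ffunP=> D; rewrite ffunE.
have E (B : {set 'I_n}) : B \subset D -> (-1) ^+ ninv B (D :\: B) * gen i B * bvec F A (D :\: B)
    = ((B == [set i]) && (D :\: B == A))%:R * (-1) ^+ ninv B (D :\: B).
  by move=> _; rewrite !ffunE -mulrA -natrM mulnb mulrC.
rewrite (eq_bigr _ E); case: ifP => iA; rewrite [in RHS]ffunE.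
  apply: big1 => B BD; case: andP => [[/eqP-> /eqP DA]|_]; last by rewrite mul0r.
  by move: iA; rewrite -DA !inE eqxx.
rewrite ffunE; case: eqP => [->|nD] /=; last first.
  rewrite scaler0; apply: big1 => B BD; case: andP => [[/eqP BE /eqP DA]|_];
    last by rewrite mul0r.
  case: nD; rewrite -DA; subst B; apply/setP=> j; rewrite !inE.
  by case: eqP => //= ->; rewrite -sub1set.
have AiA : (i |: A) :\: [set i] = A.
  by apply/setP=> j; rewrite !inE; case: eqP => //= ->.
rewrite (bigD1 [set i]) ?sub1set ?setU11 //= big1 => [|B /andP[_ /negPf->]];
  last by rewrite mul0r.
rewrite addr0 AiA !eqxx mul1r /GRing.scale /= mulr1; congr (_ ^+ _).
rewrite /ninv /below -(card_imset [set j in A | (j < i)%N] (f := pair i));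
  last by move=> x y [].
congr #|pred_of_set _|; apply/setP=> -[j k]; rewrite !inE /=.
apply/idP/imsetP => [/and3P[/eqP-> kA ki]|[l]]; first by exists k; rewrite ?inE ?kA.
by rewrite inE => /andP[lA li] [-> ->]; rewrite eqxx lA.
Qed.

Lemma pdE (i : 'I_n) (A : {set 'I_n}) :
  pd i (bvec F A) =
    if i \in A then (-1) ^+ below i A *: bvec F (A :\ i) else 0.
Proof.
apply/ffunP=> B; rewrite -[LHS]/(entry _ B A) entry_op.
case: (i \in A) => /=; last by rewrite ffunE.
by rewrite !ffunE /GRing.scale /=; case: (B == _); rewrite ?mulr1 ?mulr0.
Qed.

Lemma belowU (i j : 'I_n) (A : {set 'I_n}) : j \notin A ->
  below i (j |: A) = ((j < i) + below i A)%N.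
Proof.
move=> jA; rewrite /below; case: ltnP => ji /=.
  rewrite -[RHS]/(true + _)%N -(_ : j \notin [set k in A | (k < i)%N] = true); last first.
    by rewrite inE (negPf jA).
  rewrite -cardsU1; congr #|pred_of_set _|; apply/setP=> k; rewrite !inE.
  by case: eqP => //= ->; rewrite ji.
congr #|pred_of_set _|; apply/setP=> k; rewrite !inE.
by case: eqP => //= ->; rewrite ltnNge ji (negPf jA).
Qed.

Lemma pd_one (i : 'I_n) : pd i (bvec F set0) = 0.
Proof. by rewrite pdE inE. Qed.

Lemma pd_xi (i j : 'I_n) :
  (pd i \o xi j)%VF + (xi j \o pd i)%VF = (i == j)%:R *: \1%VF :> glL.
Proof.
apply/lfunP=> v; rewrite (svec_sum v) !linear_sum; apply: eq_bigr => A _ /=.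
rewrite !linearZ /=; congr (_ *: _).
rewrite add_lfunE !comp_lfunE scale_lfunE id_lfunE xiE pdE.
have [<-|ij] := eqVneq i j.
  rewrite scale1r; case: ifP => iA; rewrite !(linear0, linearZ) /= ?add0r ?addr0.
    have iA' : i \notin A :\ i by rewrite !inE eqxx.
    rewrite xiE (negPf iA') scalerA setD1K // -{1}(setD1K iA) belowU // ltnn.
    by rewrite -expr2 sqrr_sign scale1r.
  rewrite pdE setU11 belowU ?iA // ltnn scalerA -expr2 sqrr_sign scale1r.
  by rewrite setU1K ?iA.
rewrite scale0r.
have [iA|iA] := ifPn; have [jA|jA] := ifPn;
  rewrite ?linear0 ?linearZ /= ?xiE ?pdE ?inE ?(eq_sym j) ?(negPf ij) ?jA
          ?(negPf jA) ?iA ?(negPf iA) ?scaler0 ?addr0 //=.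
set A' := A :\ i; have AE : A = i |: A' by rewrite setD1K.
have iA' : i \notin A' by rewrite !inE eqxx.
have b1 : below i A = below i A' by rewrite AE belowU // ltnn.
have b2 : below j A = ((i < j) + below j A')%N by rewrite {1}AE belowU.
have -> : (j |: A) :\ i = j |: A'.
  by apply/setP=> k; rewrite !inE; have [->|] := eqVneq k i; rewrite //= (negPf ij).
rewrite belowU // b1 b2 !scalerA -!exprD -scalerDl; apply/eqP.
rewrite scaler_eq0; apply/orP; left.
rewrite -signr_odd -[X in _ + X]signr_odd !oddD !oddb.
have -> : (i < j)%N = ~~ (j < i)%N by rewrite ltn_neqAle ij -leqNgt.
by case: (j < i)%N; case: (odd _); case: (odd _); rewrite /= ?expr0 ?expr1 ?subrr ?addNr.
Qed.

Definition clgen (s : 'I_n + 'I_n) : glL :=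
  match s with inl i => xi i | inr i => pd i end.

(* The image in gl(Lambda(n)) of the k-th exterior power of
   Span(xi_i, pd_i) under antisymmetrized composition. *)
Definition altprod (k : nat) (x : 'I_k -> glL) : glL :=
  \sum_(s : 'S_k) (-1) ^+ s *: \big[@comp_lfun F _ _ _ / \1%VF]_(i < k) x (s i).

Definition altpow (k : nat) : {vspace glL} :=
  <<[seq altprod (fun i => clgen (t i)) | t : {ffun 'I_k -> 'I_n + 'I_n}]>>%VS.

Definition hei_even : {vspace glL} :=
  <<\1%VF :: [seq xi i | i : 'I_n] ++ [seq pd i | i : 'I_n]>>%VS.

(* hei(0|2n) >< o(2n). *)
Definition g_even : {vspace glL} :=
  (hei_even +
   <<[seq (xi i \o pd j)%VF | i <- enum 'I_n, j <- enum 'I_n]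
      ++ [seq (pd i \o pd j)%VF | i <- enum 'I_n, j <- enum 'I_n]
      ++ [seq (xi i \o xi j)%VF | i <- enum 'I_n, j <- enum 'I_n]>>)%VS.

End Grassmann.

Section GrassmannOdd.

(* Lambda(n + 1) = Lambda(xi_1, ..., xi_n, theta), so that m = 2(n + 1) - 1;
   theta is the last generator. *)
Variables (F : fieldType) (n : nat).
Local Notation glL := (glL F n.+1).
Local Notation x i := (xi F (lift ord_max i)).
Local Notation d i := (pd F (lift ord_max i)).

Definition theta : glL := xi F ord_max.
Definition pd_theta : glL := pd F ord_max.
Local Notation t := (theta + pd_theta).

(* hei(0|2n + 1) >< o(2n + 1). *)
Definition g_odd : {vspace glL} :=
  <<\1%VF
    :: [seq x i | i : 'I_n] ++ [seq d i | i : 'I_n]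
    ++ [seq (x i \o d j)%VF | i <- enum 'I_n, j <- enum 'I_n]
    ++ [seq (d i \o d j)%VF | i <- enum 'I_n, j <- enum 'I_n]
    ++ [seq (x i \o x j)%VF | i <- enum 'I_n, j <- enum 'I_n]
    ++ t :: [seq (x i \o t)%VF | i : 'I_n] ++ [seq (d i \o t)%VF | i : 'I_n]>>%VS.

Definition J_theta : glL := theta - pd_theta.

End GrassmannOdd.

Section CentralExtension.

Variable F : fieldType.

(* The pair (x, d) stands for x + d z. *)
Local Notation asT := ('M[F]_(4 + 4) * F^o)%type.

Definition in_as (a : asT) : Prop :=
  exists A B C : 'M[F]_4, [/\ \tr A = 0, B^T = B, C^T = - C &
    a.1 = block_mx A B C (- A^T)].

Definition mxhpart (p : bool) (x : 'M[F]_(4 + 4)) : 'M[F]_(4 + 4) :=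
  if p then block_mx 0 (ursubmx x) (dlsubmx x) 0
  else block_mx (ulsubmx x) 0 0 (drsubmx x).

Definition as_hpart (p : bool) (a : asT) : asT :=
  (mxhpart p a.1, if p then 0 else a.2).

(* On skew-symmetric matrices: C~_ij = C_kl for the even permutation
   (1, 2, 3, 4) -> (i, j, k, l).  The form tr (C C'~) is, up to a scalar, the
   polarized Pfaffian.  Unlike tr (C C'), it is invariant under sl(4) acting
   by C -> - A^t C - C A, as the Jacobi identity for as requires. *)
Definition hodge (C : 'M[F]_4) : 'M[F]_4 :=
  \matrix_(i, j) \sum_(s : 'S_4 | [&& ~~ odd_perm s, s 0 == i & s 1 == j])
    C (s 2) (s 3).

Definition as_br (a b : asT) : asT :=
  (sbracket (fun x y : 'M[F]_(4 + 4) => x *m y) mxhpart a.1 b.1,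
   \tr (dlsubmx a.1 *m hodge (dlsubmx b.1))).

Definition as_z : asT := (0, 1).
Definition as_A (A : 'M[F]_4) : asT := (block_mx A 0 0 (- A^T), 0).
Definition as_B (B : 'M[F]_4) : asT := (block_mx 0 B 0 0, 0).
Definition as_C (C : 'M[F]_4) : asT := (block_mx 0 0 C 0, 0).

Local Notation glL := (glL F 3).
Local Notation par := (gpar 3).
Local Notation br := (br par).
Local Notation o6 := (altpow F 3 2).

(* An irreducible 10-dimensional o(6)-component of the image of the third
   exterior power.  Its parity is automatically odd. *)
Definition is_cubic_component (W : {vspace glL}) : Prop :=
  [/\ (W <= altpow F 3 3)%VS, \dim W = 10%N,
      (forall f w, f \in o6 -> w \in W -> br f w \in W) &
      forall U : {vspace glL}, (U <= W)%VS ->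
        (forall f u, f \in o6 -> u \in U -> br f u \in U) ->
        U = 0%VS \/ U = W].

(* L is the image of as under a faithful action of as on Lambda(3), with z
   acting as the identity, that identifies as with
   (hei(0|6) + W) >< o(6).  Here sl(4) = {as_A A | tr A = 0} acts on
   {as_B B | B^T = B} by B -> A B + B A^t, i.e. as on the symmetric square of
   its standard representation, so that W has highest weight (2,0,0) for the
   isomorphism of o(6) with sl(4) given by the action. *)
Definition is_as_image (L : {vspace glL}) : Prop :=
  exists (rho : {linear asT -> glL}) (W : {vspace glL}),
    [/\ forall f, f \in L <-> exists2 a, in_as a & f = rho a,
        forall a, in_as a -> rho a = 0 -> a = 0,
        forall p a, in_as a -> rho (as_hpart p a) = hpart par p (rho a),
        forall a b, in_as a -> in_as b -> rho (as_br a b) = br (rho a) (rho b)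
      & rho as_z = \1%VF] /\
    [/\ is_cubic_component W,
        forall f, f \in o6 <-> exists2 A, \tr A = 0 & f = rho (as_A A),
        forall f, f \in W <-> exists2 B, B^T = B & f = rho (as_B B)
      & forall f, f \in hei_even F 3 <->
          exists C d, C^T = - C /\ f = rho (as_C C + d *: as_z)].

End CentralExtension.

(* Main.v *)
From HB Require Import structures.
From mathcomp Require Import all_boot all_order all_fingroup all_algebra.
From mathcomp Require Import ring zify.
Require Import Defs.

(** Write e_1, ..., e_m for the generators xi_i + d_i and xi_i - d_i (with d_i
    the derivation by xi_i): they anticommute and square to 1 or -1, so the
    products e_A, for A a set of indices, form a basis of gl(Lambda(n)) when
    m = 2n.  In this basis everything is explicit.  The superbracket of e_A
    and e_B is 2 e_A e_B, a nonzero multiple of e_(A + B) with + the symmetric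
    difference, when the cardinal of A :&: B is odd, and it is 0 otherwise
    [br_mono].  The algebra hei + o(m) is the span of the e_A with |A| <= 2
    [g_even_mspan].  The supertrace vanishes on brackets, hence on every e_A
    with A not full, so sl is the span of those e_A [mspan_proper_sl].  If J is
    the last generator, the supercentralizer of J is spanned by the e_A that do
    not involve J, and the queer trace kills all of them but the full one
    [mspan_proper_sq], so that the odd case is the same statement about the
    2n - 1 remaining generators.

    Let N be a superalgebra that contains strictly all e_A with |A| <= 2.
    Bracketing with e_k removes the index k; this brings an element of N of
    degree at least 3 down to one of degree exactly 3 [contract], and its
    component of degree 3 is in N as well.  The square of the bracket with
    e_i e_j multiplies e_A by a nonzero constant when A separates i from j and
    by 0 otherwise, so these operators isolate, inside an element of N, a part
    supported on a single pair {A, complement of A} [isolate].  When m is not 6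
    a set of size 3 and its complement have different sizes, hence some e_A
    with |A| = 3 is in N; the e_i e_j move it to all others [transport], and
    brackets with elements of degree 3 generate all e_A with A not full
    [generate, clifford_maximal].

    For m = 6 the elements supported on {A, complement of A} form a plane, and
    the cubic part splits in two halves that meet each plane in a line.  The
    algebra as contains one half W.  A superalgebra that contains more than as
    either has an element of degree at least 4, and then all monomials of
    degree 4 and, by contraction, all those of degree 3, or meets one of the
    planes in more than a line, and so contains a monomial of degree 3
    [stable_cubics, clifford_maximal6].

    The action of as on Lambda(3) is the spin representation: in a suitable
    basis x + d z acts by the block matrix (A + d, mu (B + 2 C~); C / mu,
    - A^t + d), where 2 mu^2 = 1.  This respects the brackets because
    2 (C~ C' + C'~ C) = tr (C C'~) [hodge_polar] and because C -> C~ turns the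
    action of sl(4) on skew forms into its action on skew bivectors
    [hodge_equivariant].  The matrices with A = B = 0 are the span of the
    xi_i and d_i [xi_block, pd_block], those with B = C = 0 are then o(6), and
    those with A = C = 0 form W, which contains d_1 d_2 d_3 and is generated by
    it under o(6) [pd3E, sym_unit_altpow]. *)

Set Implicit Arguments.
Unset Strict Implicit.
Unset Printing Implicit Defensive.

Import GRing.Theory Num.Theory.
Local Open Scope ring_scope.

Local Notation "f *c g" := (comp_lfun f g) (at level 40, left associativity).

(** * Composition, parity and the superbracket of operators *)

Section CompositionLaw.
Variables (F : fieldType) (I : finType).
Local Notation gl := (gl F I).

HB.instance Definition _ := Monoid.isLaw.Build gl \1%VF
  (@comp_lfun F (svec F I) (svec F I) (svec F I))
  (@comp_lfunA F _ _ _ _) (@comp_lfun1l F _ _) (@comp_lfun1r F _ _).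
HB.instance Definition _ := Monoid.isMulLaw.Build gl 0
  (@comp_lfun F (svec F I) (svec F I) (svec F I))
  (@comp_lfun0l F _ _ _) (@comp_lfun0r F _ _ _).
(** A copy of the addition, so that the distributivity of composition over it
    can be declared: on the addition itself this slot belongs to the
    multiplication of rings. *)
Definition add_lfun (f g : gl) : gl := f + g.
HB.instance Definition _ := Monoid.isComLaw.Build gl 0 add_lfun
  (@addrA gl) (@addrC gl) (@add0r gl).
HB.instance Definition _ := Monoid.isAddLaw.Build gl
  (@comp_lfun F (svec F I) (svec F I) (svec F I)) add_lfun
  (fun h f g => @comp_lfunDl F _ _ _ h f g)
  (fun f g h => @comp_lfunDr F _ _ _ f g h).

Lemma prod_comp_distr (J S : finType) (f : J -> S -> gl) :
  \big[@comp_lfun F _ _ _ / \1%VF]_j \sum_s f j s =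
  \sum_(t : {ffun J -> S}) \big[@comp_lfun F _ _ _ / \1%VF]_j f j (t j).
Proof. exact: (@bigA_distr_bigA _ _ _ _ add_lfun). Qed.

Lemma entry0 i j : entry (0 : gl) i j = 0.
Proof. by rewrite /entry zero_lfunE ffunE. Qed.

Lemma entryZ a (f : gl) i j : entry (a *: f) i j = a * entry f i j.
Proof. by rewrite -[a *: f]addr0 entry_linear entry0 addr0. Qed.

Lemma entryN (f : gl) i j : entry (- f) i j = - entry f i j.
Proof. by rewrite -scaleN1r entryZ mulN1r. Qed.

Lemma entry_id i j : entry (\1%VF : gl) i j = (i == j)%:R.
Proof. by rewrite /entry id_lfunE ffunE. Qed.

Lemma entry_comp (f g : gl) i j :
  entry (f *c g) i j = \sum_k entry f i k * entry g k j.
Proof.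
rewrite /entry comp_lfunE {1}[g _]svec_sum linear_sum sum_ffunE /=.
by apply: eq_bigr => k _; rewrite linearZ ffunE /GRing.scale /= mulrC.
Qed.

End CompositionLaw.

Section Homogeneous.
Variables (F : fieldType) (I : finType) (par : pred I).
Local Notation gl := (gl F I).

(** Stated as a fixed point of the projection, parity is directly usable as a
    rewrite rule; [homogP] gives the condition on entries. *)
Definition homog (p : bool) (f : gl) := hpart par p f = f.

Lemma homogP p f :
  homog p f <-> (forall i j, par i (+) par j != p -> entry f i j = 0).
Proof.
split=> [<- i j ijp|fp]; first by rewrite entry_op (negPf ijp).
by apply/entryP=> i j; rewrite entry_op; case: eqP => // /eqP/fp.
Qed.

Lemma homog_comp p q f g : homog p f -> homog q g -> homog (p (+) q) (f *c g).
Proof.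
move=> /homogP fp /homogP gq; apply/homogP=> i j ij; rewrite entry_comp.
apply: big1 => k _; have [e|/fp->] := eqVneq (par i (+) par k) p; last by rewrite mul0r.
rewrite gq ?mulr0 //; apply: contra ij => /eqP <-.
by rewrite -e; case: (par i); case: (par j); case: (par k).
Qed.

Lemma homog_id : homog false \1%VF.
Proof.
by apply/homogP=> i j; rewrite entry_id; have [->|//] := eqVneq i j; rewrite addbb.
Qed.

Lemma hpart0 p : hpart par p (0 : gl) = 0.
Proof. by apply/entryP=> i j; rewrite entry_op entry0 if_same. Qed.

Lemma hpartZ p a (f : gl) : hpart par p (a *: f) = a *: hpart par p f.
Proof. by rewrite -[a *: f]addr0 hpartD hpart0 addr0. Qed.

Lemma hpart_add p (f g : gl) : hpart par p (f + g) = hpart par p f + hpart par p g.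
Proof. by rewrite -{1}[f]scale1r hpartD scale1r. Qed.

Lemma homogZ p a f : homog p f -> homog p (a *: f).
Proof. by rewrite /homog hpartZ => ->. Qed.

Lemma homog_add p f g : homog p f -> homog p g -> homog p (f + g).
Proof. by rewrite /homog hpart_add => -> ->. Qed.

Lemma hpart_homog p q (f : gl) : homog q f -> hpart par p f = if p == q then f else 0.
Proof.
move=> fq; case: eqVneq => [->//|pq]; move/homogP: fq => fq.
apply/entryP=> i j; rewrite entry_op entry0; case: eqP => // e.
by apply: fq; rewrite e.
Qed.

Lemma hpart_idem p (f : gl) : homog p (hpart par p f).
Proof. by apply/homogP=> i j ij; rewrite entry_op (negPf ij). Qed.

(** Only one of the four terms of the bracket survives on homogeneous
    operators. *)
Lemma br_homog p q f g : homog p f -> homog q g ->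
  br par f g = f *c g - (-1) ^+ (p && q) *: (g *c f).
Proof.
move=> fp gq; rewrite /br /sbracket !big_bool !(hpart_homog _ fp) !(hpart_homog _ gq).
case: p fp => fp; case: q gq => gq;
  rewrite /= ?(comp_lfun0l, comp_lfun0r, scaler0, oppr0, subr0, subrr, add0r, addr0) //.
Qed.

Lemma br_linearr h a (f g : gl) : br par h (a *: f + g) = a *: br par h f + br par h g.
Proof.
rewrite /br /sbracket scaler_sumr -big_split; apply: eq_bigr => p _ /=.
rewrite scaler_sumr -big_split; apply: eq_bigr => q _ /=.
rewrite hpartD comp_lfunDl comp_lfunDr -!comp_lfunZl -!comp_lfunZr.
by rewrite scalerBr scalerDr opprD addrACA !scalerA [a * _]mulrC.
Qed.

Lemma br0r (f : gl) : br par f 0 = 0.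
Proof.
have /eqP := br_linearr f 1 0 0.
by rewrite scale1r addr0 scale1r -subr_eq subrr eq_sym => /eqP.
Qed.

Lemma brDr (h f g : gl) : br par h (f + g) = br par h f + br par h g.
Proof. by rewrite -{1}[f]scale1r br_linearr scale1r. Qed.

Lemma brZr (h : gl) a f : br par h (a *: f) = a *: br par h f.
Proof. by rewrite -[a *: f]addr0 br_linearr br0r addr0. Qed.

Lemma br0l (f : gl) : br par 0 f = 0.
Proof.
have /eqP := br_linearl par f 1 0 0.
by rewrite scale1r addr0 scale1r -subr_eq subrr eq_sym => /eqP.
Qed.

Lemma brDl (h f g : gl) : br par (f + g) h = br par f h + br par g h.
Proof. by rewrite -{1}[f]scale1r br_linearl scale1r. Qed.

Lemma brZl (h : gl) a f : br par (a *: f) h = a *: br par f h.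
Proof. by rewrite -[a *: f]addr0 br_linearl br0l addr0. Qed.

Lemma br_sumr (J : Type) (r : seq J) (P : pred J) (f : J -> gl) h :
  br par h (\sum_(l <- r | P l) f l) = \sum_(l <- r | P l) br par h (f l).
Proof. by elim/big_rec2: _ => [|l x y _ <-]; rewrite ?br0r // brDr. Qed.

Lemma br_suml (J : Type) (r : seq J) (P : pred J) (f : J -> gl) h :
  br par (\sum_(l <- r | P l) f l) h = \sum_(l <- r | P l) br par (f l) h.
Proof. by elim/big_rec2: _ => [|l x y _ <-]; rewrite ?br0l // brDl. Qed.

Lemma supertrace_homog p (f : gl) : homog p f -> p -> supertrace par f = 0.
Proof.
move=> /homogP fp pt; rewrite /supertrace; apply: big1 => i _.
by rewrite fp ?mulr0 // addbb; case: p pt {fp}.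
Qed.

(** On entries this is the symmetry of tr (f g); the sign is par i + par j,
    which is the common parity of f and g as soon as the entry of f at (i, j)
    is nonzero. *)
Lemma supertrace_comp p q (f g : gl) : homog p f -> homog q g ->
  supertrace par (f *c g) = (-1) ^+ (p && q) * supertrace par (g *c f).
Proof.
move=> fp gq; have [pq|npq] := boolP (p == q); last first.
  have n1 : p (+) q = true by case: (p) npq; case: (q).
  rewrite (supertrace_homog (homog_comp fp gq)) ?n1 //.
  by rewrite (supertrace_homog (homog_comp gq fp)) ?mulr0 // addbC n1.
move/eqP: pq => pq; subst q; rewrite andbb.
move/homogP: fp => fp; move/homogP: gq => gp.
rewrite /supertrace; under eq_bigr do rewrite entry_comp mulr_sumr.
rewrite exchange_big /= mulr_sumr; apply: eq_bigr => j _.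
rewrite entry_comp !mulr_sumr; apply: eq_bigr => i _.
have [<-|/fp->] := eqVneq (par i (+) par j) p; last by rewrite !(mul0r, mulr0).
rewrite [entry g _ _ * _]mulrC [RHS]mulrA; congr (_ * _).
by case: (par i); case: (par j); rewrite /= ?expr0 ?expr1 ?mulrNN ?mulr1 ?mul1r.
Qed.

(** This is what forces the supertrace of almost every monomial to vanish. *)
Lemma supertrace_br (f g : gl) : supertrace par (br par f g) = 0.
Proof.
rewrite /br /sbracket linear_sum; apply: big1 => p _; rewrite linear_sum.
apply: big1 => q _; rewrite linearB linearZ /=.
rewrite (supertrace_comp (hpart_idem p f) (hpart_idem q g)); exact: subrr.
Qed.

End Homogeneous.

(** * Products of the members of a Clifford family *)

(** The index set of a product of monomials: a repeated generator squares to a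
    scalar. *)
Definition symd (T : finType) (A B : {set T}) : {set T} :=
  [set x | (x \in A) (+) (x \in B)].

Lemma symdK (T : finType) (D A : {set T}) : symd D (symd D A) = A.
Proof. by apply/setP=> x; rewrite !inE addbA addbb. Qed.

Lemma symdA (T : finType) (A B C : {set T}) : symd A (symd B C) = symd (symd A B) C.
Proof. by apply/setP=> x; rewrite !inE addbA. Qed.

Lemma symd_set0 (T : finType) (A : {set T}) : symd set0 A = A.
Proof. by apply/setP=> x; rewrite !inE. Qed.

Lemma symd_inj (T : finType) (D : {set T}) : injective (symd D).
Proof. exact: can_inj (symdK D). Qed.

Lemma card_symd (T : finType) (D A : {set T}) :
  (#|symd D A| + (#|D :&: A|).*2 = #|D| + #|A|)%N.
Proof.
have -> : symd D A = (D :\: A) :|: (A :\: D).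
  by apply/setP=> x; rewrite !inE; case: (x \in D); case: (x \in A).
rewrite cardsU [X in (_ - X)%N](_ : _ = 0%N) ?subn0; last first.
  apply/eqP; rewrite cards_eq0; apply/eqP/setP=> x; rewrite !inE.
  by case: (x \in D); case: (x \in A).
by rewrite -(cardsID A D) -(cardsID D A) [A :&: D]setIC -addnn addnACA ![(#|D :&: A| + _)%N]addnC.
Qed.

Section Clifford.
Variables (F : numFieldType) (I : finType) (par : pred I) (K : finType).
Local Notation gl := (gl F I).
Local Notation br := (br par).
Local Notation comp := (@comp_lfun F (svec F I) (svec F I) (svec F I)).

(** The squares are arbitrary nonzero scalars, which avoids square roots of -1
    when the generators are combined from xi_i and its derivation. *)
Definition clifford_family (e : K -> gl) (q : K -> F) : Prop :=
  [/\ forall k, q k != 0, forall k, homog par true (e k),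
      forall k, e k *c e k = q k *: \1%VF
    & forall k l, k != l -> e k *c e l = - (e l *c e k)].

Definition monomial (e : K -> gl) (A : {set K}) : gl := \big[comp / \1%VF]_(k in A) e k.

(** Products of monomials are only tracked up to a nonzero scalar: the signs
    never matter for membership in a subspace. *)
Definition propto (f g : gl) := exists2 c : F, c != 0 & f = c *: g.

Lemma propto_refl f : propto f f.
Proof. by exists 1; rewrite ?oner_eq0 ?scale1r. Qed.

Lemma propto_sym f g : propto f g -> propto g f.
Proof. by case=> c c0 ->; exists c^-1; rewrite ?invr_eq0 // scalerA mulVf ?scale1r. Qed.

Lemma propto_trans f g h : propto f g -> propto g h -> propto f h.
Proof.
by case=> a a0 -> [b b0 ->]; exists (a * b); rewrite ?mulf_neq0 // scalerA.
Qed.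

Lemma proptoZ a f : a != 0 -> propto (a *: f) f.
Proof. by exists a. Qed.

Lemma propto_comp f f' g g' : propto f f' -> propto g g' -> propto (f *c g) (f' *c g').
Proof.
move=> [a a0 ->] [b b0 ->]; exists (a * b); rewrite ?mulf_neq0 //.
by rewrite -comp_lfunZl -comp_lfunZr scalerA.
Qed.

Lemma proptoN f : propto (- f) f.
Proof. by rewrite -scaleN1r; apply: proptoZ; rewrite oppr_eq0 oner_eq0. Qed.

Variables (e : K -> gl) (q : K -> F).
Hypothesis eq_cliff : clifford_family e q.

Let q0 k : q k != 0. Proof. by case: eq_cliff. Qed.
Let e1 k : homog par true (e k). Proof. by case: eq_cliff. Qed.
Let ee k : e k *c e k = q k *: \1%VF. Proof. by case: eq_cliff. Qed.
Let eC k l : k != l -> e k *c e l = - (e l *c e k). Proof. by case: eq_cliff => _ _ _; apply. Qed.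

Local Notation mono := (monomial e).
Local Notation P r A := (\big[comp / \1%VF]_(k <- r | k \in (A : {set K})) e k).

(** Along the enumeration, e_k is moved past the other generators until it
    reaches its place; there it is absorbed if k is already in the product,
    and inserted otherwise. *)
Lemma gen_partial k r (A : {set K}) : uniq r -> k \in r ->
  propto (e k *c P r A) (P r (symd [set k] A)).
Proof.
elim: r => //= j r IHr /andP[jr ur]; rewrite in_cons !big_cons.
have [-> _|kj /= kr] := eqVneq k j.
  have -> : P r (symd [set j] A) = P r A.
    rewrite big_seq_cond [RHS]big_seq_cond; apply: eq_bigl => x; rewrite !inE.
    by have [->|//] := eqVneq x j; rewrite (negPf jr).
  rewrite !inE eqxx; case: (j \in A) => /=; last exact: propto_refl.
  by rewrite comp_lfunA ee -comp_lfunZl comp_lfun1l; apply: proptoZ.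
rewrite !inE eq_sym (negPf kj) /=; case: (j \in A); last exact: IHr.
rewrite comp_lfunA eC // comp_lfunNl -comp_lfunA; apply: (propto_trans (proptoN _)).
exact: propto_comp (propto_refl _) (IHr ur kr).
Qed.

Lemma gen_mono k A : propto (e k *c mono A) (mono (symd [set k] A)).
Proof. exact: gen_partial (index_enum_uniq K) (mem_index_enum k). Qed.

Lemma mono0 : mono set0 = \1%VF.
Proof. by rewrite /monomial big_set0. Qed.

Lemma mono1 k : mono [set k] = e k.
Proof. by rewrite /monomial big_set1. Qed.

Lemma mono_comp A B : propto (mono A *c mono B) (mono (symd A B)).
Proof.
suff H r : uniq r -> propto (P r A *c mono B) (mono (symd [set x in A | x \in r] B)).
  have := H _ (index_enum_uniq K).
  rewrite (_ : [set x in A | _] = A) //.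
  by apply/setP=> x; rewrite inE mem_index_enum andbT.
elim: r => [_|j r IHr /= /andP[jr ur]].
  rewrite big_nil comp_lfun1l (_ : [set x in A | _] = set0) ?symd_set0; first exact: propto_refl.
  by apply/setP=> x; rewrite !inE andbF.
rewrite big_cons; have [jA|jA] := boolP (j \in A).
  rewrite -comp_lfunA; apply: propto_trans (propto_comp (propto_refl _) (IHr ur)) _.
  apply: propto_trans (gen_mono _ _) _; rewrite symdA.
  rewrite (_ : symd [set j] _ = [set x in A | x \in j :: r]); first exact: propto_refl.
  apply/setP=> x; rewrite !inE; have [->|//] := eqVneq x j.
  by rewrite jA (negPf jr).
rewrite (_ : [set x in A | _] = [set x in A | x \in r]); first exact: IHr.
apply/setP=> x; rewrite !inE; have [->|//] := eqVneq x j.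
by rewrite (negPf jA).
Qed.

Lemma commute_partial r s (A B : {set K}) :
  P r A *c P s B = (-1) ^+ (\sum_(x <- r | x \in A) \sum_(y <- s | y \in B) (y != x))
                   *: (P s B *c P r A).
Proof.
have H k : e k *c P s B = (-1) ^+ (\sum_(y <- s | y \in B) (y != k)) *: (P s B *c e k).
  elim: s => [|j s IHs]; first by rewrite !big_nil comp_lfun1l comp_lfun1r expr0 scale1r.
  rewrite !big_cons; case: ifP => // jB; rewrite -comp_lfunA exprD -scalerA.
  have -> : e k *c (e j *c P s B) = (-1) ^+ (j != k) *: (e j *c (e k *c P s B)).
    rewrite !comp_lfunA; have [->|kj] := eqVneq j k; first by rewrite scale1r.
    by rewrite eC 1?eq_sym // comp_lfunNl expr1 scaleN1r.
  by rewrite IHs -comp_lfunZr.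
elim: r => [|j r IHr]; first by rewrite !big_nil comp_lfun1l comp_lfun1r expr0 scale1r.
rewrite !big_cons; case: ifP => // jA.
rewrite -comp_lfunA IHr -comp_lfunZr [e j *c (_ *c _)]comp_lfunA H -comp_lfunZl scalerA.
by rewrite mulrC -exprD -!comp_lfunA.
Qed.

(** Each pair of distinct generators contributes a sign; the pairs with equal
    generators, counted by A :&: B, do not. *)
Lemma mono_commute (A B : {set K}) :
  mono A *c mono B = (-1) ^+ (#|A| * #|B| + #|A :&: B|) *: (mono B *c mono A).
Proof.
rewrite /Defs.br commute_partial; congr (_ *: _).
rewrite -signr_odd -[RHS]signr_odd; congr (_ ^+ nat_of_bool _).
have -> : (#|A| * #|B| = \sum_(x in A) \sum_(y in B) 1)%N.
  by under eq_bigr do rewrite sum1_card; rewrite sum_nat_const.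
have -> : (\sum_(x in A) \sum_(y in B) 1 =
           \sum_(x in A) \sum_(y in B) (y != x) + #|A :&: B|)%N.
  have -> : (#|A :&: B| = \sum_(x in A) \sum_(y in B) (y == x))%N.
    rewrite -sum1_card big_mkcond [RHS]big_mkcond; apply: eq_bigr => x _.
    rewrite inE; case: (x \in A) => //=; have [xB|xB] := boolP (x \in B).
      by rewrite (bigD1 x) //= eqxx big1 // => y /andP[_ /negPf->].
    by rewrite big1 // => y yB; have [E|//] := eqVneq y x; rewrite -E yB in xB.
  rewrite -big_split; apply: eq_bigr => x _ /=; rewrite -big_split.
  by apply: eq_bigr => y _ /=; case: eqVneq.
by rewrite -addnA addnn oddD odd_double addbF.
Qed.

Lemma mono_homog (A : {set K}) : homog par (odd #|A|) (mono A).
Proof.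
rewrite -sum1_card (big_morph odd oddD (erefl _)) /monomial.
elim: (index_enum K) => [|k r IHr]; rewrite ?big_nil ?big_cons; first exact: homog_id.
case: ifP => // _; exact: homog_comp.
Qed.

(** The parity sign of the superbracket cancels (-1)^(|A| |D|), so that only
    the parity of D :&: A is left. *)
Lemma br_mono (D A : {set K}) : br (mono D) (mono A) =
  if odd #|D :&: A| then 2%:R *: (mono D *c mono A) else 0.
Proof.
rewrite (br_homog (mono_homog D) (mono_homog A)) [mono A *c _]mono_commute setIC.
rewrite scalerA -oddM mulnC signr_odd exprD mulrA -expr2 sqrr_sign mul1r -signr_odd.
by case: odd; rewrite ?scaleN1r ?opprK ?scale1r ?subrr // -mulr2n scaler_nat.
Qed.

Lemma br_mono_propto (D A : {set K}) : odd #|D :&: A| -> propto (br (mono D) (mono A)) (mono (symd D A)).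
Proof.
move=> o; rewrite br_mono o; apply: propto_trans (mono_comp D A).
by apply: proptoZ; rewrite pnatr_eq0.
Qed.

(** The constant is the same for all A, so the square of the bracket with an
    even monomial acts on an arbitrary combination as a multiple of a
    coordinate projection. *)
Lemma br_br_mono (D : {set K}) : ~~ odd #|D| -> exists2 c : F, c != 0 &
  forall A, br (mono D) (br (mono D) (mono A)) = if odd #|D :&: A| then c *: mono A else 0.
Proof.
move=> oD; have [c c0 E] := mono_comp D D.
have D0 : symd D D = set0 by apply/setP=> x; rewrite !inE addbb.
exists (4%:R * c) => [|A]; first by rewrite mulf_neq0 ?pnatr_eq0.
rewrite [br _ (mono A)]br_mono; case: ifP => oA; last exact: br0r.
rewrite brZr (br_homog (mono_homog D) (homog_comp (mono_homog D) (mono_homog A))).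
rewrite (negPf oD) /= expr0 scale1r.
have -> : mono D *c mono A *c mono D = - (mono D *c (mono D *c mono A)).
  rewrite -comp_lfunA [mono A *c _]mono_commute -signr_odd oddD oddM setIC oA (negPf oD).
  by rewrite andbF scaleN1r comp_lfunNr.
rewrite opprK comp_lfunA E D0 mono0 -comp_lfunZl comp_lfun1l -mulr2n -scaler_nat !scalerA.
by rewrite mulrA -natrM.
Qed.

(** Contracting with each generator lowers the degree of a relation, so a
    relation of least degree only involves the identity. *)
(** A relation is contracted with each generator; this lowers its degree, and
    a relation of degree 0 is a multiple of the identity. *)
Lemma mono_free (c : {set K} -> F) : (0 < #|I|)%N ->
  \sum_A c A *: mono A = 0 -> forall A, c A = 0.
Proof.
move=> I0; suff H n : forall c : {set K} -> F, (forall A : {set K}, (n < #|A|)%N -> c A = 0) ->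
    \sum_A c A *: mono A = 0 -> forall A, c A = 0.
  apply: (H #|K|) => A; rewrite ltnNge max_card //.
have base (c' : {set K} -> F) : (forall A : {set K}, A != set0 -> c' A = 0) ->
    \sum_A c' A *: mono A = 0 -> forall A, c' A = 0.
  move=> cA; rewrite (bigD1 set0) //= big1 => [|A /cA->]; last by rewrite scale0r.
  rewrite addr0 mono0 => /eqP; rewrite scaler_eq0 => /orP[/eqP c0 A|].
    by have [->|/cA] := eqVneq A set0.
  case/card_gt0P: I0 => i _ /eqP/(congr1 (fun f => entry f i i)).
  by rewrite entry_id entry0 eqxx => /eqP; rewrite oner_eq0.
elim: n => [|n IHn] {}c cn c0; apply: (base _ _ c0) => A A0.
  by apply: cn; rewrite card_gt0.
case/set0Pn: A0 => k kA.
have sg (B : {set K}) : exists s : F, (s != 0) /\ (k \notin B -> br (e k) (mono (k |: B)) = s *: mono B).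
  have [kB|kB] := boolP (k \in B); first by exists 1; rewrite oner_eq0.
  have o : odd #|[set k] :&: (k |: B)|.
    by rewrite (setIidPl _) ?cards1 // sub1set setU11.
  have [s s0 E] := br_mono_propto o; exists s; split=> // _; rewrite -mono1 E.
  by congr (_ *: mono _); apply/setP=> x; rewrite !inE; case: eqVneq => //= ->; rewrite (negPf kB).
have [s sP] := fin_all_exists sg.
(* The coefficients of the contraction of the relation with e_k. *)
pose c' (B : {set K}) := if k \in B then 0 else c (k |: B) * s B.
suff /(_ (A :\ k)): forall B : {set K}, c' B = 0.
  rewrite /c' !inE eqxx setD1K //= => /eqP; rewrite mulf_eq0 => /orP[/eqP//|].
  by rewrite (negPf (sP _).1).
apply: IHn => [B nB|].
  rewrite /c'; case: ifP => // /negbT kB; rewrite cn ?mul0r //.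
  by rewrite cardsU1 kB.
have := congr1 (br (e k)) c0; rewrite br0r br_sumr => {2}<-.
rewrite (bigID [pred B : {set K} | k \in B]) /= big1 ?add0r => [|B kB]; last first.
  by rewrite /c' kB scale0r.
rewrite [RHS](bigID [pred B : {set K} | k \in B]) /= [X in _ = _ + X]big1 ?addr0; last first.
  move=> B kB; rewrite brZr -mono1 br_mono (_ : _ :&: _ = set0) ?cards0 ?scaler0 //.
  by apply/setP=> x; rewrite !inE; case: eqVneq => //= ->; apply: negbTE.
rewrite [RHS](reindex_onto (fun B => k |: B) (fun B => B :\ k)) /= => [|B kB]; last exact: setD1K.
apply: eq_big => [B|B kB].
  rewrite setU11 /=; have [kB|kB] := boolP (k \in B).
    by apply/esym/eqP=> E; move: kB; rewrite -E !inE eqxx.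
  by rewrite setU1K ?eqxx.
by rewrite brZr (sP B).2 // /c' (negPf kB) scalerA.
Qed.

End Clifford.

(** * Coordinates with respect to the monomials *)

Lemma odd_card_pair (T : finType) (i j : T) (C : {set T}) : i != j ->
  odd #|[set i; j] :&: C| = (i \in C) (+) (j \in C).
Proof.
move=> ij; have -> : #|[set i; j] :&: C| = (\sum_(x in [set i; j]) (x \in C))%N.
  rewrite -sum1_card big_mkcond [RHS]big_mkcond; apply: eq_bigr => x _.
  by rewrite inE; case: (x \in _) => //; case: (x \in C).
by rewrite big_setU1 ?inE //= big_set1 oddD !oddb.
Qed.

Section Coefficients.
Variables (F : numFieldType) (I : finType) (K : finType).
Local Notation gl := (gl F I).
Variable e : K -> gl.
Local Notation mono := (monomial e).

Definition mono_sum (c : svec F {set K}) : gl := \sum_A c A *: mono A.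

Lemma mono_sum_linear : linear mono_sum.
Proof.
move=> a c d; rewrite /mono_sum scaler_sumr -big_split; apply: eq_bigr => A _.
by rewrite !ffunE scalerDl scalerA.
Qed.
HB.instance Definition _ := GRing.isLinear.Build F (svec F {set K}) gl _
  mono_sum mono_sum_linear.

(** The inverse of [mono_sum], which is an isomorphism for a Clifford family
    of the right size by [mono_free] and a dimension count. *)
Definition coor (f : gl) (A : {set K}) : F := ((linfun mono_sum)^-1)%VF f A.

Lemma coorD f g A : coor (f + g) A = coor f A + coor g A.
Proof. by rewrite /coor linearD ffunE. Qed.

Lemma coorZ a f A : coor (a *: f) A = a * coor f A.
Proof. by rewrite /coor linearZ ffunE. Qed.

Lemma coor0 A : coor 0 A = 0.
Proof. by rewrite /coor linear0 ffunE. Qed.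

Lemma coorB f g A : coor (f - g) A = coor f A - coor g A.
Proof. by rewrite -scaleN1r coorD coorZ mulN1r. Qed.

Lemma coor_bigsum (J : Type) (r : seq J) (P : pred J) (f : J -> gl) A :
  coor (\sum_(l <- r | P l) f l) A = \sum_(l <- r | P l) coor (f l) A.
Proof. by elim/big_rec2: _ => [|l x y _ <-]; rewrite ?coor0 // coorD. Qed.

Definition mspan (P : pred {set K}) : {vspace gl} := <<[seq mono A | A <- enum P]>>%VS.

Lemma mono_mspan (P : pred {set K}) A : P A -> mono A \in mspan P.
Proof. by move=> PA; apply/memv_span/map_f; rewrite mem_enum. Qed.

Lemma mspan_sub (P : pred {set K}) (U : {vspace gl}) :
  (forall A, P A -> mono A \in U) -> (mspan P <= U)%VS.
Proof.
Proof. by move=> H; apply/span_subvP=> f /mapP[A]; rewrite mem_enum => /H AU ->. Qed.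

End Coefficients.

Section Basis.
Variables (F : numFieldType) (I : finType) (par : pred I) (K : finType).
Local Notation gl := (gl F I).
Local Notation br := (br par).
Variables (e : K -> gl) (q : K -> F).
Local Notation mono := (monomial e).
Local Notation coor := (coor e).
Local Notation mspan := (mspan e).

Hypothesis eq_cliff : clifford_family par e q.
Hypothesis card_eq : (2 ^ #|K| = #|I| * #|I|)%N.

Let I0 : (0 < #|I|)%N.
Proof. by rewrite lt0n; apply: contra_eq_neq card_eq => ->; rewrite muln0 -lt0n expn_gt0. Qed.

Let ker0 : lker (linfun (mono_sum e)) == 0%VS.
Proof.
apply/eqP/vspaceP=> c; rewrite memv_ker memv0 lfunE /=; apply/eqP/eqP=> [H|->].
  by apply/ffunP=> A; rewrite (mono_free eq_cliff I0 H) ffunE.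
exact: linear0.
Qed.

Lemma coorK f : \sum_A coor f A *: mono A = f.
Proof.
have -> : \sum_A coor f A *: mono A = linfun (mono_sum e) ((linfun (mono_sum e))^-1%VF f).
  by rewrite lfunE.
apply: limg_lfunVK; suff -> : limg (linfun (mono_sum e)) = fullv by rewrite memvf.
apply/eqP; rewrite eqEdim subvf limg_dim_eq; last by rewrite (eqP ker0) capv0.
have dS (J : finType) : \dim {:svec F J} = #|J| by rewrite dimvf; exact: muln1.
have -> : \dim {:gl} = (\dim {:svec F I} * \dim {:svec F I})%N by rewrite !dimvf.
rewrite !dS -card_eq /=.
by rewrite -[X in (_ <= X)%N]cardsT -powersetT card_powerset cardsT leqnn.
Qed.

Lemma coor_sum (c : {set K} -> F) A : coor (\sum_B c B *: mono B) A = c A.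
Proof.
have -> : \sum_B c B *: mono B = linfun (mono_sum e) [ffun B => c B].
  by rewrite lfunE; apply: eq_bigr => B _; rewrite ffunE.
by rewrite /coor lker0_lfunK // ffunE.
Qed.

Lemma coor_mono A B : coor (mono A) B = (B == A)%:R.
Proof.
rewrite -[RHS](coor_sum (fun B => (B == A)%:R)); congr (coor _ _).
rewrite (bigD1 A) //= eqxx scale1r big1 ?addr0 // => C /negPf->.
by rewrite scale0r.
Qed.

Lemma coorP f g : (forall A, coor f A = coor g A) -> f = g.
Proof. by move=> fg; rewrite -[f]coorK -[g]coorK; apply: eq_bigr => A _; rewrite fg. Qed.

Lemma coor_neq0 f : f != 0 -> exists A, coor f A != 0.
Proof.
move=> f0; apply/existsP; apply: contraNT f0 => /existsPn H; apply/eqP/coorP=> A.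
by rewrite coor0; apply/eqP/negPn/H.
Qed.

Lemma mspanP (P : pred {set K}) f :
  reflect (forall A, coor f A != 0 -> P A) (f \in mspan P).
Proof.
apply: (iffP idP) => [fP A|H]; last first.
  rewrite -[f]coorK; apply: memv_suml => A _.
  have [->|/H PA] := eqVneq (coor f A) 0; first by rewrite scale0r mem0v.
  exact/memvZ/mono_mspan.
apply: contraR => nPA; rewrite -[f]coorK.
move/coord_span: fP => ->; rewrite coorK coor_bigsum big1 // => i _.
rewrite coorZ; have: [tuple of [seq mono A | A <- enum P]]`_i \in [seq mono A | A <- enum P].
  by rewrite mem_nth // size_map -cardE.
case/mapP=> B; rewrite mem_enum => PB ->; rewrite coor_mono.
by have [E|_] := eqVneq A B; [case/negP: nPA; rewrite E; apply: PB|rewrite mulr0].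
Qed.

Lemma dim_mspan (P : pred {set K}) : \dim (mspan P) = #|P|.
Proof.
have fr : free [seq mono A | A <- enum P].
  rewrite -[X in free X]in_tupleE; apply/freeP=> k k0 i.
  set s := [seq _ | _ <- _] in k k0 i *.
  have si : size s = #|P| by rewrite size_map -cardE.
  have iP : (i < size (enum P))%N by rewrite -(size_map mono); apply: ltn_ord.
  have := congr1 (fun f => coor f (nth set0 (enum P) i)) k0.
  rewrite coor0 coor_bigsum (bigD1 i) //= big1 ?addr0 => [|j ji].
    by rewrite coorZ (nth_map set0) // coor_mono eqxx mulr1.
  have jP : (j < size (enum P))%N by rewrite -(size_map mono); apply: ltn_ord.
  rewrite coorZ (nth_map set0) // coor_mono nth_uniq ?enum_uniq // eq_sym.
  by rewrite -[(_ == _)%N]/(j == i) (negPf ji) mulr0.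
by rewrite (eqP fr) size_map -cardE.
Qed.

Lemma coor_hpart p f A : coor (hpart par p f) A = if odd #|A| == p then coor f A else 0.
Proof.
have -> : hpart par p f = \sum_(A : {set K}) (if odd #|A| == p then coor f A else 0) *: mono A.
  rewrite -{1}[f]coorK (_ : hpart par p (\sum_A _) = \sum_A hpart par p (coor f A *: mono A)).
    apply: eq_bigr => B _; rewrite hpartZ (hpart_homog _ (mono_homog eq_cliff B)) eq_sym.
    by case: ifP => _ //; rewrite scaler0 scale0r.
  by elim/big_rec2: _ => [|B x y _ <-]; rewrite ?hpart0 // hpart_add.
by rewrite coor_sum.
Qed.

(** The factor s (A) is the structure constant of the bracket of the monomials
    of index D and A; since A -> symd D A is injective, distinct monomials do
    not interfere. *)
Lemma coor_br (D : {set K}) : exists2 s : {set K} -> F,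
  (forall A, (s A != 0) = odd #|D :&: A|) &
  forall f B, coor (br (mono D) f) B = s (symd D B) * coor f (symd D B).
Proof.
have H A : exists s : F, (s != 0) = odd #|D :&: A| /\
    br (mono D) (mono A) = s *: mono (symd D A).
  have [oA|oA] := boolP (odd #|D :&: A|).
    by have [s s0 E] := br_mono_propto eq_cliff oA; exists s; rewrite s0.
  by exists 0; rewrite eqxx (br_mono eq_cliff) (negPf oA) scale0r.
have [s sP] := fin_all_exists H; exists s => [A|f B]; first by case: (sP A).
rewrite -{1}[f]coorK br_sumr coor_bigsum (bigD1 (symd D B)) //= big1 => [|A AB].
  by rewrite brZr (sP _).2 symdK !coorZ coor_mono eqxx mulr1 addr0 mulrC.
rewrite brZr (sP _).2 !coorZ coor_mono (_ : (B == _) = false) ?mulr0 //.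
by apply: contra_neqF AB => /eqP->; rewrite symdK.
Qed.

Lemma coor_br_br (D : {set K}) : ~~ odd #|D| -> exists2 c : F, c != 0 &
  forall f B, coor (br (mono D) (br (mono D) f)) B = if odd #|D :&: B| then c * coor f B else 0.
Proof.
move=> oD; have [c c0 cP] := br_br_mono eq_cliff oD; exists c => // f B.
have -> : br (mono D) (br (mono D) f) =
    \sum_A coor f A *: br (mono D) (br (mono D) (mono A)).
  rewrite -{1}[f]coorK (br_sumr _ _ _ (fun A => coor f A *: mono A)).
  rewrite (br_sumr _ _ _ (fun A => br (mono D) (coor f A *: mono A))).
  by apply: eq_bigr => A _; rewrite !brZr.
rewrite coor_bigsum (bigD1 B) //= big1 => [|A AB]; rewrite coorZ cP; case: ifP => _.
- by rewrite coorZ coor_mono eqxx mulr1 addr0 mulrC.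
- by rewrite coor0 mulr0 addr0.
- by rewrite coorZ coor_mono eq_sym (negPf AB) !mulr0.
- by rewrite coor0 mulr0.
Qed.

(** * Subspaces stable under the infinitesimal rotations *)

Section Swaps.
Variable M : {set K}.

(** The monomials of degree 2 span the orthogonal Lie algebra; the one of
    index {i, j} exchanges i and j in the index of a monomial that contains
    just one of them. *)
Definition swap_stable (U : {vspace gl}) := forall i j f,
  i \in M -> j \in M -> i != j -> f \in U -> br (mono [set i; j]) f \in U.

(** If the support contains A and B with B different from A and from M :\: A,
    some i and j in M are separated by exactly one of them.  The square of the
    bracket with e_i e_j, divided by its nonzero eigenvalue, then cuts f into
    two parts of smaller support that remain in U, and one of them is not in
    W.  With W = 0 this produces a nonzero element of U; the general W serves
    to compare two stable subspaces. *)
Lemma isolate (U W : {vspace gl}) f : swap_stable U -> (W <= U)%VS ->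
    f \in U -> f \notin W -> f \in mspan (fun A => A \subset M) ->
  exists f' A, [/\ f' \in U, f' \notin W, coor f' A != 0 &
    forall B, coor f' B != 0 -> coor f B != 0 /\ ((B == A) || (B == M :\: A))].
Proof.
move=> Us WU; have [n] := ubnP #|[set A | coor f A != 0]|.
elim: n f => // n IHn f; rewrite ltnS => fn fU fW /mspanP fM.
have f0 : f != 0 by apply: contraNneq fW => ->; rewrite mem0v.
have [A fA] := coor_neq0 f0.
have [/forallP H|/forallPn[B]] := boolP [forall B, (coor f B != 0) ==> (B == A) || (B == M :\: A)].
  exists f, A; split=> // B fB; split=> //; exact: (implyP (H B)).
rewrite negb_imply negb_or => /and3P[fB BA BMA].
have sDM : symd A B \subset M.
  apply/subsetP=> x; rewrite inE.
  by have [/(subsetP (fM _ fA))|_ /= /(subsetP (fM _ fB))] := boolP (x \in A).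
(* A pair {i, j} separates exactly one of A and B when it has exactly one
   element in symd A B, which is neither empty nor all of M. *)
have [i iD] : exists i, i \in symd A B.
  apply/set0Pn; apply: contraNneq BA => D0; apply/eqP/setP=> x.
  by move/setP/(_ x): D0; rewrite !inE; case: (x \in A); case: (x \in B).
have [j jM jD] : exists2 j, j \in M & j \notin symd A B.
  apply/subsetPn; apply: contraNN BMA => MD; apply/eqP/setP=> x; rewrite !inE.
  have := subsetP (fM _ fA) x.
  have EM : symd A B = M by apply/eqP; rewrite eqEsubset sDM MD.
  rewrite -EM inE.
  by case: (x \in A); case: (x \in B) => //= /(_ isT).
have ij : i != j by apply: contraNneq jD => <-.
have iM := subsetP sDM _ iD.
have eD : ~~ odd #|[set i; j]| by rewrite cards2 ij.
have [c c0 cP] := coor_br_br eD.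
pose g := c^-1 *: br (mono [set i; j]) (br (mono [set i; j]) f).
have gU : g \in U by apply/memvZ/Us/Us.
have gE C : coor g C = if (i \in C) (+) (j \in C) then coor f C else 0.
  by rewrite coorZ cP odd_card_pair //; case: ifP; rewrite ?mulr0 // mulKf.
have hE C : coor (f - g) C = if (i \in C) (+) (j \in C) then 0 else coor f C.
  by rewrite coorB gE; case: ifP; rewrite ?subrr ?subr0.
have sep : (i \in A) (+) (j \in A) = ~~ ((i \in B) (+) (j \in B)).
  move: iD jD; rewrite !inE.
  by case: (i \in A); case: (j \in A); case: (i \in B); case: (j \in B).
have finish h : h \in U -> h \notin W -> (forall C, coor h C != 0 -> coor f C != 0) ->
    (coor h A = 0 \/ coor h B = 0) ->
  exists f' A, [/\ f' \in U, f' \notin W, coor f' A != 0 &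
    forall B, coor f' B != 0 -> coor f B != 0 /\ ((B == A) || (B == M :\: A))].
  move=> hU hW hf hAB; have [||f' [A' [f'U f'W f'A f'P]]] := IHn h _ hU hW.
  - apply: leq_trans fn; apply: proper_card; apply/properP; split.
      by apply/subsetP=> C; rewrite !inE; apply: hf.
    by case: hAB => hz; [exists A|exists B]; rewrite inE // hz eqxx.
  - by apply/mspanP=> C /hf/fM.
  by exists f', A'; split=> // C /f'P[/hf].
(* g is the part of f supported on the sets that separate i from j. *)
have [gW|gW] := boolP (g \in W).
  apply: (finish (f - g)).
  - exact: rpredB.
  - by apply: contra fW => fgW; rewrite -[f](subrK g) rpredD.
  - by move=> C; rewrite hE; case: ifP; rewrite ?eqxx.
  - by rewrite !hE sep; case: (_ (+) _); [right|left].
apply: (finish g) => // [C|]; first by rewrite gE; case: ifP; rewrite ?eqxx.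
by rewrite !gE sep; case: (_ (+) _); [left|right].
Qed.

(** For i in A :\: B and j in B :\: A, the bracket with e_i e_j replaces i by
    j in A and j by i in M :\: A, and it is injective on these two monomials.
    The flag b covers at once the supports {A} and {A, M :\: A}. *)
Lemma transport (b : bool) (U : {vspace gl}) (A B : {set K}) f : swap_stable U ->
    A \subset M -> B \subset M -> #|A| = #|B| -> f \in U -> f != 0 ->
    (forall C, coor f C != 0 -> (C == A) || b && (C == M :\: A)) ->
  exists f', [/\ f' \in U, f' != 0 &
    forall C, coor f' C != 0 -> (C == B) || b && (C == M :\: B)].
Proof.
move=> Us; have [n] := ubnP #|A :\: B|.
elim: n A f => // n IHn A f; rewrite ltnS => An AM BM AB fU f0 fA.
have [AB0|/set0Pn[i]] := eqVneq (A :\: B) set0.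
  have EAB : A = B.
    by apply/eqP; rewrite eqEcard AB leqnn -setD_eq0 AB0 eqxx.
  by exists f; split=> //; rewrite -EAB.
rewrite inE => /andP[iB iA].
have [j jB jA] : exists2 j, j \in B & j \notin A.
  apply/subsetPn; apply: contraNN iB => BA.
  by have /eqP-> : B == A by rewrite eqEcard BA AB leqnn.
have iM := subsetP AM _ iA; have jM := subsetP BM _ jB.
have ij : i != j by apply: contraNneq jA => <-.
have [s s0 sP] := coor_br [set i; j].
have eD : ~~ odd #|[set i; j]| by rewrite cards2 ij.
have EA : symd [set i; j] A = j |: (A :\ i).
  apply/setP=> x; rewrite !inE; have [->|xi] := eqVneq x i; first by rewrite (negPf ij) iA.
  by have [->|//] := eqVneq x j; rewrite (negPf jA).
have EM C : (symd [set i; j] C == M :\: A) = (C == M :\: symd [set i; j] A).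
  have E : symd [set i; j] (M :\: A) = M :\: symd [set i; j] A.
    apply/setP=> x; rewrite !inE.
    by have [->|_] := eqVneq x i; [|have [->|_] := eqVneq x j];
      rewrite /= ?iM ?jM ?andbT //; case: (x \in A); case: (x \in M).
  by rewrite -E -(inj_eq (symd_inj (D := [set i; j]))) symdK.
apply: (IHn (symd [set i; j] A) (br (mono [set i; j]) f)) => //.
- apply: leq_trans An; rewrite EA; apply: proper_card; apply/properP; split.
    apply/subsetP=> x; rewrite !inE; have [->|_] := eqVneq x j; first by rewrite jB.
    by case/and3P=> -> _ ->.
  by exists i; rewrite !inE ?iA ?iB // (negPf ij) eqxx.
- rewrite EA; apply/subsetP=> x; rewrite !inE => /orP[/eqP->//|/andP[_]].
  exact: (subsetP AM).
- by rewrite EA cardsU1 !inE (negPf jA) andbF -AB (cardsD1 i A) iA.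
- exact: Us.
- have [C fC] := coor_neq0 f0; apply/eqP=> /(congr1 (fun f => coor f (symd [set i; j] C))).
  rewrite sP symdK coor0 => /eqP; rewrite mulf_eq0 (negPf fC) orbF; apply/negP.
  rewrite s0 odd_card_pair //; case/orP: (fA _ fC) => [/eqP->|/andP[_ /eqP->]].
    by rewrite iA (negPf jA).
  by rewrite !inE iA jA jM.
move=> C; rewrite sP mulf_eq0 negb_or => /andP[_ /fA].
by rewrite EM -(inj_eq (symd_inj (D := [set i; j]))) symdK.
Qed.

Lemma transport_mono (U : {vspace gl}) (A B : {set K}) : swap_stable U ->
    A \subset M -> B \subset M -> #|A| = #|B| -> mono A \in U -> mono B \in U.
Proof.
move=> Us AM BM AB AU.
have A0 : mono A != 0.
  apply/eqP=> /(congr1 (fun f => coor f A)); rewrite coor_mono coor0 eqxx => /eqP.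
  by rewrite oner_eq0.
have [|f [fU f0 fB]] := transport (b := false) Us AM BM AB AU A0.
  by move=> C; rewrite coor_mono; case: (C == A); rewrite ?eqxx.
have {}fB C : coor f C != 0 -> C = B by move/fB; rewrite orbF => /eqP.
have fE : f = coor f B *: mono B.
  apply: coorP => C; rewrite coorZ coor_mono; have [->|CB] := eqVneq C B.
    by rewrite mulr1.
  by rewrite mulr0; apply/eqP; apply: contraNT CB => /fB->.
have c0 : coor f B != 0 by have [C fC] := coor_neq0 f0; rewrite -(fB _ fC).
by rewrite -[mono B]scale1r -(mulVf c0) -scalerA -fE memvZ.
Qed.

(** The hypothesis on |M| excludes that A and its complement in M have the
    same size, so that [isolate] ends with a single monomial. *)
Lemma isolate_mono (U : {vspace gl}) f k : swap_stable U -> #|M| <> k.*2 ->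
    f \in U -> f != 0 -> f \in mspan (fun A : {set K} => (A \subset M) && (#|A| == k)) ->
  forall B : {set K}, B \subset M -> #|B| = k -> mono B \in U.
Proof.
move=> Us Mk fU f0 /mspanP fk B BM Bk.
have fM : f \in mspan (fun A => A \subset M) by apply/mspanP=> A /fk/andP[].
have nf0 : f \notin 0%VS by rewrite memv0.
have [f' [A [f'U _ f'A f'P]]] := isolate Us (sub0v U) fU nf0 fM.
have [fA _] := f'P _ f'A; have /andP[AM /eqP Ak] := fk _ fA.
apply: (transport_mono Us AM BM); first by rewrite Ak Bk.
have fE : f' = coor f' A *: mono A.
  apply: coorP => C; rewrite coorZ coor_mono; have [->|CA] := eqVneq C A.
    by rewrite mulr1.
  rewrite mulr0; apply/eqP; apply: contraNT CA => fC.
  have [/fk/andP[_ Ck]] := f'P _ fC; case/orP=> // /eqP CE.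
  by case: Mk; rewrite -(cardsID A M) (setIidPr AM) Ak -CE (eqP Ck) addnn.
by rewrite -[mono A]scale1r -(mulVf f'A) -scalerA -fE memvZ.
Qed.

(** Isolating an element of U outside W, and moving a nonzero element of W to
    the same pair {A, M :\: A}, gives two independent vectors of a plane that
    contains the monomial of index A. *)
Lemma stable_cubics (U W : {vspace gl}) : swap_stable U -> swap_stable W ->
    (W <= U)%VS -> W != 0%VS -> U != W ->
    (U <= mspan (fun A : {set K} => (A \subset M) && (#|A| == 3%N)))%VS ->
  forall B : {set K}, B \subset M -> #|B| = 3%N -> mono B \in U.
Proof.
move=> Us Ws WU W0 UW /subvP U3 B BM B3.
have [f fU fW] : exists2 f, f \in U & f \notin W.
  by apply/subvPn; apply: contra UW => UW; rewrite eqEsubv UW.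
have fM : f \in mspan (fun A => A \subset M) by apply/mspanP=> A /(mspanP _ _ (U3 _ fU))/andP[].
have [g [A [gU gW gA gP]]] := isolate Us WU fU fW fM.
have /andP[AM /eqP A3] := mspanP _ _ (U3 _ gU) _ gA.
have [w [wW w0]] : exists w, w \in W /\ w != 0.
  by exists (vpick W); rewrite memv_pick vpick0.
have wM : w \in mspan (fun A => A \subset M).
  by apply/mspanP=> C /(mspanP _ _ (U3 _ (subvP WU _ wW)))/andP[].
have nw0 : w \notin 0%VS by rewrite memv0.
have [w1 [C [w1W w1n w1C w1P]]] := isolate Ws (sub0v W) wW nw0 wM.
have w10 : w1 != 0 by rewrite memv0 in w1n.
have /andP[CM /eqP C3] := mspanP _ _ (U3 _ (subvP WU _ w1W)) _ w1C.
have [|D|v [vW v0 vP]] := transport (b := true) (B := A) Ws CM AM _ w1W w10.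
- by rewrite C3 A3.
- by case/w1P.
apply: (transport_mono Us AM BM); first by rewrite A3 B3.
have [E|AMA] := eqVneq A (M :\: A).
  have A0 : A = set0.
    by apply/setP=> x; move/setP: E => /(_ x); rewrite !inE; case: (x \in A).
 
  by rewrite A0 cards0 in A3.
have two h C' : (forall D, coor h D != 0 -> (D == A) || (D == M :\: A)) ->
    C' \notin [:: A; M :\: A] -> coor h C' = 0.
  by move=> hP; rewrite !inE => C'n; apply/eqP; apply: contraNT C'n => /hP.
pose a := coor g A; pose b := coor g (M :\: A).
pose a' := coor v A; pose b' := coor v (M :\: A).
have gP' D : coor g D != 0 -> (D == A) || (D == M :\: A) by case/gP.
(* Eliminating the coordinate of index M :\: A between g and v. *)
have main : b' *: g - b *: v = (a * b' - a' * b) *: mono A.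
  apply: coorP => D; rewrite coorB !coorZ coor_mono.
  have [->|DA] := eqVneq D A; first by rewrite mulr1 /a /a' mulrC [b * _]mulrC.
  have [->|DMA] := eqVneq D (M :\: A); first by rewrite mulr0 mulrC subrr.
  by rewrite !(two _ D) ?inE ?(negPf DA) ?(negPf DMA) // !mulr0 subrr.
have [d0|d0] := eqVneq (a * b' - a' * b) 0; last first.
  rewrite -[mono A]scale1r -(mulVf d0) -scalerA -main memvZ // rpredB // memvZ //.
  exact: (subvP WU).
case/negP: gW; have a0 : a != 0 := gA.
have a'0 : a' != 0.
  have [D vD] := coor_neq0 v0; case/orP: (vP _ vD) => /eqP ED; rewrite ?ED // in vD.
  apply: contraNneq vD => a'0; move/eqP: d0; rewrite a'0 mul0r subr0 mulf_eq0.
  by rewrite (negPf a0) /=.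
suff -> : g = (a / a') *: v by rewrite memvZ.
apply: coorP => D; rewrite coorZ.
have [->|DA] := eqVneq D A; first by rewrite divfK.
have [->|DMA] := eqVneq D (M :\: A); last first.
  by rewrite !(two _ D) ?inE ?(negPf DA) ?(negPf DMA) // mulr0.
apply: (mulfI a'0); rewrite -/b -/b' [RHS]mulrA [a' * (a / a')]mulrC divfK //.
by apply/eqP; rewrite eq_sym -subr_eq0 d0.
Qed.

End Swaps.
End Basis.

(** * Maximality inside a Clifford algebra *)

Lemma exists_subset (T : finType) (M : {set T}) k : (k <= #|M|)%N ->
  exists2 A : {set T}, A \subset M & #|A| = k.
Proof.
move=> kM; have : (0 < #|[set A : {set T} | A \subset M & #|A| == k]|)%N.
  by rewrite cards_draws bin_gt0.
by case/card_gt0P=> A; rewrite inE => /andP[AM /eqP]; exists A.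
Qed.

Section Maximality.
Variables (F : numFieldType) (I : finType) (par : pred I) (K : finType).
Local Notation gl := (gl F I).
Local Notation br := (br par).
Variables (e : K -> gl) (q : K -> F).
Local Notation mono := (monomial e).
Local Notation coor := (coor e).
Local Notation mspan := (mspan e).

Hypothesis eq_cliff : clifford_family par e q.
Hypothesis card_eq : (2 ^ #|K| = #|I| * #|I|)%N.

Let coorK := coorK eq_cliff card_eq.
Let coor_mono := coor_mono eq_cliff card_eq.
Let coor_br := coor_br eq_cliff card_eq.
Let mspanP := mspanP eq_cliff card_eq.

Definition layer_proj k f : gl := \sum_(A : {set K} | #|A| == k) coor f A *: mono A.

Lemma coor_layer_proj k f A :
  coor (layer_proj k f) A = if #|A| == k then coor f A else 0.
Proof.
rewrite -(coor_sum eq_cliff card_eq (fun A => if #|A| == k then coor f A else 0)).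
rewrite /layer_proj big_mkcond; congr (coor _ _).
by apply: eq_bigr => B _; case: ifP; rewrite ?scale0r.
Qed.

Variable M : {set K}.

Definition deg_le2 : pred {set K} := [pred A : {set K} | (A \subset M) && (#|A| <= 2)%N].
Definition deg_eq3 : pred {set K} := [pred A : {set K} | (A \subset M) && (#|A| == 3%N)].
Definition proper_in : pred {set K} := [pred A : {set K} | A \proper M].

Lemma br_mspan (P Q : pred {set K}) (U : {vspace gl}) f g : f \in mspan P -> g \in mspan Q ->
  (forall A B, P A -> Q B -> odd #|A :&: B| -> mono (symd A B) \in U) -> br f g \in U.
Proof.
move=> /mspanP fP /mspanP gQ H.
rewrite -[f]coorK -[g]coorK (br_suml _ _ _ (fun A => coor f A *: mono A)).
apply: memv_suml => A _; rewrite brZl.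
have [->|fA] := eqVneq (coor f A) 0; first by rewrite scale0r mem0v.
apply: rpredZ; rewrite (br_sumr _ _ _ (fun A => coor g A *: mono A)).
apply: memv_suml => B _; rewrite brZr.
have [->|gB] := eqVneq (coor g B) 0; first by rewrite scale0r mem0v.
apply: rpredZ; have [oAB|oAB] := boolP (odd #|A :&: B|).
  by have [s _ ->] := br_mono_propto eq_cliff oAB; apply: rpredZ; apply: H oAB; [apply: fP|apply: gQ].
by rewrite (br_mono eq_cliff) (negPf oAB) mem0v.
Qed.

Lemma hpart_mspan (P : pred {set K}) p f : f \in mspan P -> hpart par p f \in mspan P.
Proof.
move/mspanP=> fP; apply/mspanP=> A; rewrite (coor_hpart eq_cliff card_eq).
by case: ifP => _; [apply: fP|rewrite eqxx].
Qed.

Lemma deg_le2_subsuperalgebra : is_subsuperalgebra par (mspan deg_le2).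
Proof.
split=> [p f|f g fL gL]; first exact: hpart_mspan.
apply: (br_mspan fL gL) => A B /andP[AM A2] /andP[BM B2] oAB; apply: mono_mspan.
rewrite /deg_le2 /=; apply/andP; split.
  apply/subsetP=> x; rewrite inE.
  by have [/(subsetP AM)|_ /(subsetP BM)] := boolP (x \in A).
by have := card_symd A B; move: oAB A2 B2; case: #|A :&: B| => //; lia.
Qed.

Lemma propto_mem f g (U : {vspace gl}) : propto f g -> f \in U -> g \in U.
Proof. by case/propto_sym=> c _ -> fU; apply: memvZ. Qed.

Lemma coor_br1 k : exists2 s : {set K} -> F, (forall A, (s A != 0) = (k \in A)) &
  forall f B, coor (br (mono [set k]) f) B = s (symd [set k] B) * coor f (symd [set k] B).
Proof.
have [s s0 sP] := coor_br [set k]; exists s => // A; rewrite s0.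
have [kA|kA] := boolP (k \in A); first by rewrite (setIidPl _) ?cards1 ?sub1set.
rewrite (_ : _ :&: _ = set0) ?cards0 //; apply/setP=> x; rewrite !inE.
by case: eqVneq => // ->; apply: negbTE.
Qed.

Lemma symd1 k (A : {set K}) : k \in A -> symd [set k] A = A :\ k.
Proof. by move=> kA; apply/setP=> x; rewrite !inE; case: eqVneq => // ->; rewrite kA. Qed.

Section Overalgebra.
Variable N : {vspace gl}.
Hypothesis Nalg : is_subsuperalgebra par N.
Hypothesis lowN : (mspan deg_le2 <= N)%VS.

Lemma deg_le2_mem (A : {set K}) : A \subset M -> (#|A| <= 2)%N -> mono A \in N.
Proof. by move=> AM A2; apply: (subvP lowN); apply: mono_mspan; rewrite /deg_le2 /= AM. Qed.

Lemma over_swap_stable : swap_stable par e M N.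
Proof.
move=> i j f iM jM ij fN; apply: Nalg.2 => //; apply: deg_le2_mem.
  by rewrite subUset !sub1set iM.
by rewrite cards2 ij.
Qed.

(** Bracketing with the generator of index k replaces each index A that
    contains k by A :\ k and kills the others: starting from an index B of
    maximal size, removing elements of B one by one keeps the coordinate of
    the remaining set nonzero and lowers the degree of everything else. *)
Lemma contract f (B : {set K}) r : f \in N -> coor f B != 0 -> (r <= #|B|)%N ->
    (forall C, coor f C != 0 -> (C \subset M) && (#|C| <= #|B|)%N) ->
  exists f' B', [/\ f' \in N, coor f' B' != 0, #|B'| = r &
    forall C, coor f' C != 0 -> (C \subset M) && (#|C| <= r)%N].
Proof.
have [n] := ubnP (#|B| - r)%N; elim: n f B => // n IHn f B; rewrite ltnS => Bn fN fB rB fC.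
have [Br|rB'] := eqVneq #|B| r; first by exists f, B; split; rewrite -?Br.
have {}rB : (r < #|B|)%N by rewrite ltn_neqAle eq_sym rB'.
have [k kB] : exists k, k \in B by apply/set0Pn; rewrite -card_gt0; apply: leq_ltn_trans rB.
have [s s0 sP] := coor_br1 k.
have /andP[BM _] := fC _ fB; have kM := subsetP BM _ kB.
have cB := cardsD1 k B; rewrite kB in cB.
apply: (IHn (br (mono [set k]) f) (B :\ k)).
- by apply: leq_trans Bn; lia.
- by apply: Nalg.2 => //; apply: deg_le2_mem; rewrite ?sub1set ?cards1.
- by rewrite sP -symd1 // symdK mulf_neq0 // s0.
- by lia.
move=> C; rewrite sP mulf_eq0 negb_or s0 => /andP[kC /fC /andP[CM CB]].
have EC : C = symd [set k] C :\ k by rewrite -symd1 // symdK.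
have cC := cardsD1 k (symd [set k] C); rewrite kC -EC in cC.
rewrite {1}EC (subset_trans (subsetDl _ _) CM) /=; lia.
Qed.

Lemma contract_to f r (B : {set K}) : f \in N -> f \in mspan [pred A : {set K} | A \subset M] ->
    coor f B != 0 -> (r <= #|B|)%N ->
  exists f' B', [/\ f' \in N, coor f' B' != 0, #|B'| = r &
    forall C, coor f' C != 0 -> (C \subset M) && (#|C| <= r)%N].
Proof.
move=> fN /mspanP fM fB rB.
case: (@arg_maxnP _ B (fun A => coor f A != 0) (fun A : {set K} => #|A|) fB) => D fD Dmax.
apply: (contract fN fD); first exact: leq_trans rB (Dmax _ fB).
by move=> C fC; apply/andP; split; [apply: fM|apply: Dmax].
Qed.

(** A set A of at least 3 elements that misses j in M is the symmetric
    difference of {j} and A without two elements, which is smaller, and of {j}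
    with these two elements, which has size 3; both have only j in common. *)
Lemma generate : (forall D : {set K}, D \subset M -> #|D| = 3%N -> mono D \in N) ->
  (mspan proper_in <= N)%VS.
Proof.
move=> H3; apply: mspan_sub => A; have [n] := ubnP #|A|.
elim: n A => // n IHn A; rewrite ltnS => An; rewrite /proper_in /= => /properP[AM [j jM jA]].
have [A2|A3] := leqP #|A| 2; first exact: deg_le2_mem.
have [Q QA Q2] := exists_subset (ltnW A3).
(* Q has two elements, so that B has one element less than A. *)
pose B := j |: (A :\: Q); pose D := j |: Q.
have jQ : j \notin Q by apply: contra jA; apply: (subsetP QA).
have BM : B \subset M.
  by rewrite subUset sub1set jM (subset_trans (subsetDl _ _) AM).
have cB : (#|B| = #|A|.-1)%N.
  have := cardsID Q A; rewrite (setIidPr QA) Q2 cardsU1 !inE (negPf jA) andbF; lia.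
have DB : D :&: B = [set j].
  apply/setP=> x; rewrite !inE; have [->|_] //= := eqVneq x j.
  by case: (x \in Q).
have E : symd D B = A.
  apply/setP=> x; rewrite !inE; have [->|_] /= := eqVneq x j; first by rewrite (negPf jA).
  by have [/(subsetP QA)->|] := boolP (x \in Q).
have oDB : odd #|D :&: B| by rewrite DB cards1.
rewrite -E; apply: propto_mem (br_mono_propto eq_cliff oDB) _; apply: Nalg.2.
  apply: H3; last by rewrite cardsU1 jQ Q2.
  by rewrite subUset sub1set jM (subset_trans QA AM).
apply: IHn; first by rewrite cB; lia.
rewrite /proper_in /= properEcard BM; apply: leq_trans (subset_leq_card AM); lia.
Qed.

(** Components of degree at most 2 may be subtracted freely. *)
Lemma layer_mem k f : f \in N ->
    (forall C, coor f C != 0 -> #|C| != k -> deg_le2 C) -> layer_proj k f \in N.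
Proof.
move=> fN fC; rewrite -[layer_proj k f](subKr f) rpredB //; apply: (subvP lowN).
apply/mspanP=> A; rewrite coorB coor_layer_proj; case: ifP => [|/negbT Ak].
  by rewrite subrr eqxx.
by rewrite subr0 => /fC; apply.
Qed.

End Overalgebra.

Lemma deg_le2_sub_proper : (2 < #|M|)%N -> (mspan deg_le2 <= mspan proper_in)%VS.
Proof.
move=> M2; apply: mspan_sub => A /andP[AM A2]; apply: mono_mspan.
by rewrite /proper_in /= properEcard AM (leq_ltn_trans A2).
Qed.

Lemma proper_in_subset f : f \in mspan proper_in -> f \in mspan [pred A : {set K} | A \subset M].
Proof. by move/mspanP=> fP; apply/mspanP=> A /fP/proper_sub. Qed.

(** After contraction to degree 3, the condition |M| <> 6 lets a single
    monomial be isolated. *)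
Theorem clifford_maximal : (3 < #|M|)%N -> #|M| <> 6%N ->
  maximal_subsuperalgebra par (mspan deg_le2) (mspan proper_in).
Proof.
move=> M4 M6; split.
- exact: deg_le2_subsuperalgebra.
- by apply: deg_le2_sub_proper; lia.
- have [A AM A3] := exists_subset (ltnW M4); apply/eqP=> E.
  have : mono A \in mspan proper_in by apply: mono_mspan; rewrite /proper_in /= properEcard AM A3.
  rewrite -E => /mspanP/(_ A); rewrite coor_mono eqxx oner_eq0 => /(_ isT).
  by rewrite /deg_le2 /= A3 andbF.
move=> N Nalg LN NM; have [|NL] := boolP (N <= mspan deg_le2)%VS.
  by move=> NL; left; apply/eqP; rewrite eqEsubv NL.
right; apply/eqP; rewrite eqEsubv NM /=; apply: (generate Nalg LN).
have [f fN fL] := subvPn NL; have /proper_in_subset fM := subvP NM _ fN.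
have [B fB B3] : exists2 B, coor f B != 0 & (3 <= #|B|)%N.
  have [/existsP[B /andP[]]|/existsPn H] := boolP [exists B, (coor f B != 0) && (2 < #|B|)%N].
    by exists B.
  case/negP: fL; apply/mspanP=> A fA; move: (H A); rewrite fA /= -leqNgt /deg_le2 /= => ->.
  by rewrite andbT; apply: mspanP fM A fA.
have [f' [B' [f'N f'B B'3 f'P]]] := contract_to Nalg LN fN fM fB B3.
apply: (isolate_mono eq_cliff card_eq (f := layer_proj 3 f')).
- exact: over_swap_stable.
- exact: M6.
- apply: layer_mem => // C /f'P/andP[CM C3] Cn3.
  by rewrite /deg_le2 /= CM -ltnS ltn_neqAle Cn3.
- apply/eqP=> /(congr1 (fun f => coor f B')); rewrite coor_layer_proj B'3 eqxx coor0.
  by move/eqP; rewrite (negPf f'B).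
- apply/mspanP=> C; rewrite coor_layer_proj; case: ifP => [C3 /f'P/andP[-> _]//|].
  by rewrite eqxx.
Qed.

(** An even monomial e_i e_j has a nonzero bracket only with indices that
    contain exactly one of i and j, and it keeps their size. *)
Lemma deg_eq3_swap_stable (U : {vspace gl}) :
  swap_stable par e M U -> swap_stable par e M (U :&: mspan deg_eq3).
Proof.
move=> Us i j f iM jM ij; rewrite !memv_cap => /andP[fU /mspanP fP].
rewrite (Us i j f) //=; have [s s0 sP] := coor_br [set i; j].
apply/mspanP=> C; rewrite sP mulf_eq0 negb_or s0 => /andP[o /fP/andP[SM /eqP S3]].
have := card_symd [set i; j] (symd [set i; j] C); rewrite symdK cards2 ij S3 => cC.
have := subset_leq_card (subsetIl [set i; j] (symd [set i; j] C)); rewrite cards2 ij.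
move: o cC; case: #|_ :&: _| => [//|[|[|//]]] // _ cC _; rewrite /deg_eq3 /=.
apply/andP; split; last by apply/eqP; lia.
apply/subsetP=> x xC; move/subsetP/(_ x): SM; rewrite !inE xC.
have [->//|_] := eqVneq x i; have [->//|_] := eqVneq x j; exact.
Qed.

(** In degree 3, a set and its complement in M cannot be separated; the
    subspace W takes the place of 0 in the comparison [stable_cubics].  In
    degree 4 the complement has size 2, and monomials can be isolated as
    before. *)
Theorem clifford_maximal6 (L W : {vspace gl}) : #|M| = 6%N ->
    is_subsuperalgebra par L -> L = (mspan deg_le2 + W)%VS -> W != 0%VS ->
    (W <= mspan deg_eq3)%VS -> swap_stable par e M W ->
  maximal_subsuperalgebra par L (mspan proper_in).
Proof.
move=> M6 Lalg LE W0 W3 Ws.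
have LP f : f \in L -> f \in mspan [pred A : {set K} | (A \subset M) && (#|A| <= 3)%N].
  rewrite LE; apply: subvP; rewrite subv_add; apply/andP; split.
    by apply: mspan_sub => A /andP[AM A2]; apply: mono_mspan; rewrite /= AM ltnW.
  apply: subv_trans W3 _; apply: mspan_sub => A /andP[AM A3]; apply: mono_mspan.
  by rewrite /= AM (eqP A3).
split=> //.
- apply/subvP=> f /LP/mspanP fP; apply/mspanP=> A /fP/andP[AM A3].
  by rewrite /proper_in /= properEcard AM M6 ltnS (leq_trans A3).
- have [|A AM A4] := @exists_subset _ M 4; first by rewrite M6.
  apply/eqP=> E.
  have : mono A \in mspan proper_in by apply: mono_mspan; rewrite /proper_in /= properEcard AM A4 M6.
  rewrite -E => /LP/mspanP/(_ A); rewrite coor_mono eqxx oner_eq0 => /(_ isT).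
  by rewrite /= A4 andbF.
move=> N Nalg LN NM; have [|NL] := boolP (N <= L)%VS.
  by move=> NL; left; apply/eqP; rewrite eqEsubv NL.
right; apply/eqP; rewrite eqEsubv NM /=.
have lowN : (mspan deg_le2 <= N)%VS by apply: subv_trans LN; rewrite LE addvSl.
have WN : (W <= N)%VS by apply: subv_trans LN; rewrite LE addvSr.
have Ns := over_swap_stable Nalg lowN.
apply: (generate Nalg lowN).
have [f fN fL] := subvPn NL; have /proper_in_subset fM := subvP NM _ fN.
(* Either f has a component of degree at least 4, or all of it is in degree
   at most 3 and its cubic part is not in W. *)
have [/existsP[B /andP[fB B4]]|/existsPn H] :=
    boolP [exists B, (coor f B != 0) && (3 < #|B|)%N].
  have [f' [B' [f'N f'B B'4 f'P]]] := contract_to Nalg lowN fN fM fB B4.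
  have mono4 (C : {set K}) : C \subset M -> #|C| = 4%N -> mono C \in N.
    apply: (isolate_mono eq_cliff card_eq (f := layer_proj 4 (hpart par false f'))) => //.
    - by rewrite M6.
    - apply: layer_mem => //; first exact: Nalg.1.
      move=> D; rewrite (coor_hpart eq_cliff card_eq); case: ifP; last by rewrite eqxx.
      move=> oD /f'P/andP[DM D4] Dn4; rewrite /deg_le2 /= DM /=.
      by move: oD D4 Dn4; case: #|D| => [|[|[|[|[|?]]]]].
    - apply/eqP=> /(congr1 (fun f => coor f B')).
      rewrite coor_layer_proj (coor_hpart eq_cliff card_eq) B'4 coor0 /=.
      by move/eqP; rewrite (negPf f'B).
    - apply/mspanP=> D; rewrite coor_layer_proj (coor_hpart eq_cliff card_eq).
      case: ifP => [D4|]; last by rewrite eqxx.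
      by case: ifP => [_ /f'P/andP[-> _]//|]; rewrite eqxx.
  move=> D DM D3; have [k kM kD] : exists2 k, k \in M & k \notin D.
    by apply/subsetPn/negP=> /subset_leq_card; rewrite D3 M6.
  have o : odd #|[set k] :&: (k |: D)|.
    by rewrite (setIidPl _) ?cards1 // sub1set setU11.
  have E : symd [set k] (k |: D) = D by rewrite symd1 ?setU11 // setU1K.
  rewrite -E; apply: propto_mem (br_mono_propto eq_cliff o) _; apply: Nalg.2.
    by apply: deg_le2_mem => //; rewrite ?sub1set ?cards1.
  apply: mono4; first by rewrite subUset sub1set kM DM.
  by rewrite cardsU1 kD D3.
have f3 C : coor f C != 0 -> (C \subset M) && (#|C| <= 3)%N.
  by move=> fC; rewrite [_ \subset _](mspanP _ _ fM _ fC) leqNgt; move: (H C); rewrite fC.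
have gN : layer_proj 3 f \in N.
  by apply: layer_mem => // C /f3/andP[CM C3] Cn3; rewrite /deg_le2 /= CM -ltnS ltn_neqAle Cn3.
have gC : layer_proj 3 f \in mspan deg_eq3.
  apply/mspanP=> C; rewrite coor_layer_proj; case: ifP => [C3 /f3/andP[CM _]|].
    by rewrite /deg_eq3 /= CM C3.
  by rewrite eqxx.
have gW : layer_proj 3 f \notin W.
  apply: contra fL => gW; rewrite LE -[f](subrK (layer_proj 3 f)) memv_add //.
  apply/mspanP=> C; rewrite coorB coor_layer_proj; case: ifP => [|C3].
    by rewrite subrr eqxx.
  by rewrite subr0 => /f3/andP[CM C3']; rewrite /deg_le2 /= CM -ltnS ltn_neqAle C3.
move=> D DM D3.
suff: mono D \in (N :&: mspan deg_eq3)%VS by rewrite memv_cap => /andP[].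
apply: (stable_cubics eq_cliff card_eq (deg_eq3_swap_stable Ns) Ws) DM D3 => //.
- by rewrite subv_cap WN.
- by apply: contraNneq gW => <-; rewrite memv_cap gN.
- exact: capvSr.
Qed.

End Maximality.

(** * The trace conditions in terms of monomials *)

Section Spans.
Variables (F : fieldType) (I : finType).
Local Notation gl := (gl F I).

Lemma span_ind (X : seq gl) (P : gl -> Prop) : P 0 ->
    (forall a f g, P f -> P g -> P (a *: f + g)) -> {in X, forall x, P x} ->
  forall f, f \in <<X>>%VS -> P f.
Proof.
move=> P0 PD PX f fX; rewrite (coord_span (X := in_tuple X) fX).
elim/big_rec: _ => // i x _; apply: PD; apply: PX; exact: mem_nth.
Qed.

Lemma span_comp (X Y : seq gl) (U : {vspace gl}) :
    (forall x y, x \in X -> y \in Y -> x *c y \in U) ->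
  forall f g, f \in <<X>>%VS -> g \in <<Y>>%VS -> f *c g \in U.
Proof.
move=> XY f g fX gY; move: f fX; apply: span_ind => [|a f f' IH IH'|x xX].
- by rewrite comp_lfun0l mem0v.
- by rewrite comp_lfunDl -comp_lfunZl rpredD ?rpredZ.
move: g gY; apply: span_ind => [|a f f' IH IH'|y yY]; last exact: XY.
- by rewrite comp_lfun0r mem0v.
- by rewrite comp_lfunDr -comp_lfunZr rpredD ?rpredZ.
Qed.

End Spans.

Section Subspaces.
Variables (F : numFieldType) (I : finType) (par : pred I) (K : finType).
Local Notation gl := (gl F I).
Local Notation br := (br par).
Variables (e : K -> gl) (q : K -> F).
Local Notation mono := (monomial e).
Local Notation coor := (coor e).
Local Notation mspan := (mspan e).

Hypothesis eq_cliff : clifford_family par e q.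
Hypothesis card_eq : (2 ^ #|K| = #|I| * #|I|)%N.

Let coorK := coorK eq_cliff card_eq.
Let coor_mono := coor_mono eq_cliff card_eq.
Let mspanP := mspanP eq_cliff card_eq.

Section Low.
Variable M : {set K}.

Lemma deg_le2_id : \1%VF \in mspan (deg_le2 M).
Proof. by rewrite -(mono0 e); apply: mono_mspan; rewrite /deg_le2 /= sub0set cards0. Qed.

Lemma deg_le2_gen k : k \in M -> e k \in mspan (deg_le2 M).
Proof. by move=> kM; rewrite -(mono1 e); apply: mono_mspan; rewrite /deg_le2 /= sub1set kM cards1. Qed.

Lemma comp_gen_propto k l : k != l -> propto (e k *c e l) (mono [set k; l]).
Proof.
move=> kl; have := mono_comp eq_cliff [set k] [set l]; rewrite !mono1.
rewrite (_ : symd _ _ = [set k; l]) //; apply/setP=> x; rewrite !inE.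
by have [->|] := eqVneq x k; rewrite ?(negPf kl).
Qed.

Lemma deg_le2_comp k l : k \in M -> l \in M -> e k *c e l \in mspan (deg_le2 M).
Proof.
move=> kM lM; have [<-|kl] := eqVneq k l.
  by case: eq_cliff => _ _ -> _; rewrite rpredZ ?deg_le2_id.
have [s _ ->] := comp_gen_propto kl; rewrite rpredZ //; apply: mono_mspan.
by rewrite /deg_le2 /= subUset !sub1set kM lM cards2 kl.
Qed.

Lemma deg_le2_sub (U : {vspace gl}) : \1%VF \in U -> (forall k, k \in M -> e k \in U) ->
    (forall k l, k \in M -> l \in M -> e k *c e l \in U) -> (mspan (deg_le2 M) <= U)%VS.
Proof.
move=> U1 Ue Uee; apply: mspan_sub => A /andP[AM A2]; move: A2.
rewrite leq_eqVlt => /orP[/cards2P[k [l [kl AE]]]|].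
  rewrite AE; apply: propto_mem (comp_gen_propto kl) _; apply: Uee.
    by apply: (subsetP AM); rewrite AE !inE eqxx.
  by apply: (subsetP AM); rewrite AE !inE eqxx orbT.
rewrite ltnS leq_eqVlt => /orP[/cards1P[k AE]|].
  by rewrite AE mono1 Ue // (subsetP AM) // AE inE.
by rewrite ltnS leqn0 cards_eq0 => /eqP->; rewrite mono0.
Qed.

Definition gen_span : {vspace gl} := <<[seq e k | k <- enum M]>>%VS.

Lemma gen_span_deg_le2 f : f \in gen_span -> f \in mspan (deg_le2 M).
Proof.
by apply: subvP; apply/span_subvP=> g /mapP[k]; rewrite mem_enum => kM ->; apply: deg_le2_gen.
Qed.

Lemma gen_span_comp f g : f \in gen_span -> g \in gen_span -> f *c g \in mspan (deg_le2 M).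
Proof.
apply: span_comp => _ _ /mapP[k kM ->] /mapP[l lM ->].
by apply: deg_le2_comp; rewrite -mem_enum.
Qed.

(** A subspace that contains the products of at most two elements of some
    spanning set of the generators contains the products of any other spanning
    set, by bilinearity; this is how the basis of monomials is compared with
    the generators xi_i and their derivations. *)
Lemma deg_le2_eq (X : seq gl) (G : {vspace gl}) : <<X>>%VS = gen_span ->
    \1%VF \in G -> {subset X <= G} -> (forall x y, x \in X -> y \in X -> x *c y \in G) ->
    (G <= mspan (deg_le2 M))%VS ->
  G = mspan (deg_le2 M).
Proof.
move=> XM G1 GX GXX GL; apply/eqP; rewrite eqEsubv GL /=.
have eX k : k \in M -> e k \in <<X>>%VS.
  by move=> kM; rewrite XM memv_span // map_f // mem_enum.
apply: deg_le2_sub => // [k /eX|k l /eX kX /eX lX].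
  by apply: subvP; apply/span_subvP.
exact: span_comp GXX _ _ kX lX.
Qed.

End Low.

(** Some generator is missing in A, so the monomial is a multiple of a
    bracket. *)
Lemma supertrace_mono A : A != setT -> supertrace par (mono A) = 0.
Proof.
rewrite -subTset => /subsetPn[k _ kA].
have o : odd #|[set k] :&: (k |: A)| by rewrite (setIidPl _) ?cards1 // sub1set setU11.
have [s _] := propto_sym (br_mono_propto eq_cliff o).
rewrite symd1 ?setU11 // setU1K // => ->.
by rewrite linearZ /= supertrace_br scaler0.
Qed.

Lemma supertrace_coor f : supertrace par f = coor f setT * supertrace par (mono setT).
Proof.
rewrite -{1}[f]coorK linear_sum (bigD1 setT) //= big1 ?addr0 => [|A AT]; rewrite linearZ //=.
by rewrite supertrace_mono // scaler0.
Qed.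

(** Otherwise the supertrace would be 0, but it does not vanish on a diagonal
    matrix unit. *)
Lemma supertrace_top : supertrace par (mono setT) != 0.
Proof.
apply/eqP=> H; have I0 : (0 < #|I|)%N.
  by rewrite lt0n; apply: contra_eq_neq card_eq => ->; rewrite muln0 -lt0n expn_gt0.
case/card_gt0P: I0 => i _.
pose f : gl := op (fun j k => (j == i)%:R * (k == i)%:R).
have := supertrace_coor f; rewrite H mulr0 /supertrace (bigD1 i) //= big1 => [|j ji].
  rewrite entry_op eqxx !mulr1 addr0 => /eqP; rewrite expf_eq0 oppr_eq0 oner_eq0.
  by rewrite andbF.
by rewrite entry_op (negPf ji) mul0r mulr0.
Qed.

Lemma mspan_proper_sl : mspan (proper_in setT) = sl F par.
Proof.
apply/eqP; rewrite eqEsubv; apply/andP; split.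
  apply: mspan_sub => A /properP[_ [k _ kA]]; rewrite mem_sl supertrace_mono //.
  by apply: contraNneq kA => ->; rewrite inE.
apply/subvP=> f; rewrite mem_sl supertrace_coor mulf_eq0 (negPf supertrace_top) orbF => /eqP fT.
apply/mspanP=> A fA; rewrite /proper_in /= properT.
by apply: contraNneq fA => ->; rewrite fT.
Qed.

Section QueerPart.
Variable j : K.
Local Notation J := (e j).
Local Notation M := ([set~ j] : {set K}).

Definition lfun_trace (f : gl) := \sum_i entry f i i.

Lemma lfun_traceC f g : lfun_trace (f *c g) = lfun_trace (g *c f).
Proof.
rewrite /lfun_trace; under eq_bigr do rewrite entry_comp.
rewrite exchange_big /=; apply: eq_bigr => i _; rewrite entry_comp.
by apply: eq_bigr => k _; rewrite mulrC.
Qed.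

Lemma queertraceE f : queertrace par J f = - \sum_(i | ~~ par i) entry (f *c J) i i.
Proof.
rewrite /queertrace -sumrN; apply: eq_bigr => i _.
by rewrite /entry comp_lfunE linearN ffunE.
Qed.

(** The queer trace is minus the trace of the product with J on the even part.
    The trace on the whole space is 0, since this product is odd for even |A|,
    and J anticommutes with the monomial for odd |A|; hence the traces on the
    even and odd parts are opposite, and the supertrace is twice the first
    one. *)
Lemma queertrace_mono (A : {set K}) : A \subset M ->
  2%:R * queertrace par J (mono A) = - supertrace par (mono A *c J).
Proof.
move=> AM; have jA : j \notin A by apply/negP=> /(subsetP AM); rewrite !inE eqxx.
rewrite queertraceE mulrN; congr (- _).
have Jo : homog par true J by case: eq_cliff.
have AJ := homog_comp (mono_homog eq_cliff A) Jo.
have AJC : mono A *c J = (-1) ^+ #|A| *: (J *c mono A).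
  rewrite -[J]mono1 (mono_commute eq_cliff) cards1 muln1 (_ : _ :&: _ = set0) ?cards0 ?addn0 //.
  by apply/setP=> x; rewrite !inE; case: eqVneq => [->|]; rewrite ?andbF ?(negPf jA).
have [oA|eA] := boolP (odd #|A|); last first.
  rewrite (supertrace_homog AJ) ?(negPf eA) // big1 ?mulr0 // => i _.
  by move/homogP: AJ => -> //; rewrite addbb (negPf eA).
have t0 : lfun_trace (mono A *c J) = 0.
  have : lfun_trace (mono A *c J) = - lfun_trace (mono A *c J).
    rewrite {1}AJC -signr_odd oA scaleN1r [in RHS]lfun_traceC /lfun_trace -sumrN.
    by apply: eq_bigr => i _; rewrite entryN.
  by move/eqP; rewrite eq_sym eqNr => /eqP.
rewrite -[RHS]addr0 -[X in _ + X]t0 /supertrace /lfun_trace -big_split /=.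
rewrite big_mkcond mulr_sumr; apply: eq_bigr => i _; case: (par i) => /=.
  by rewrite mulr0 expr1 mulN1r addNr.
by rewrite expr0 mul1r mulr2n mulrDl mul1r.
Qed.

(** Multiplying by J adds the index j, and only the full monomial has a
    nonzero supertrace. *)
Lemma supertrace_queer (A : {set K}) : A \subset M ->
  (supertrace par (mono A *c J) == 0) = (A != M).
Proof.
move=> AM; have jA : j \notin A by apply/negP=> /(subsetP AM); rewrite !inE eqxx.
have [s s0] := mono_comp eq_cliff A [set j].
have -> : symd A [set j] = j |: A.
  by apply/setP=> x; rewrite !inE addbC; case: eqVneq => // ->; rewrite (negPf jA).
rewrite mono1 => ->; rewrite linearZ /= scaler_eq0 (negPf s0) /=.
have -> : (A != M) = (j |: A != setT).
  congr (~~ _); apply/eqP/eqP=> [->|jAT].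
    by apply/setP=> x; rewrite !inE orbN.
  by apply/setP=> x; move/setP/(_ x): jAT; rewrite !inE; case: eqVneq => [->|_] /=; rewrite ?(negPf jA).
have [->|/supertrace_mono->] := eqVneq (j |: A) setT; last by rewrite eqxx.
by rewrite (negPf supertrace_top).
Qed.

(** The bracket with J is a contraction, which is injective on the monomials
    whose index contains j. *)
Lemma queer_coor f : (br f J == 0) = (f \in mspan [pred A : {set K} | A \subset M]).
Proof.
have sub (A : {set K}) : (A \subset M) = (j \notin A).
  apply/idP/idP=> [/subsetP AM|jA]; first by apply/negP=> /AM; rewrite !inE eqxx.
  by apply/subsetP=> x; rewrite !inE; apply: contraTneq => ->.
have H (A : {set K}) : exists s : F, (s != 0) = (j \in A) /\
    br (mono A) J = s *: mono (symd [set j] A).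
  have E : #|A :&: [set j]| = (j \in A).
    rewrite setIC; have [jA|jA] := boolP (j \in A); first by rewrite (setIidPl _) ?cards1 ?sub1set.
    by apply/eqP; rewrite cards_eq0 setI_eq0 disjoints1.
  have := br_mono eq_cliff A [set j]; rewrite mono1 E oddb.
  case: (j \in A) E => E brA; last by exists 0; rewrite eqxx brA scale0r.
  have o : odd #|A :&: [set j]| by rewrite E.
  have [s s0] := br_mono_propto eq_cliff o.
  rewrite mono1 => ->; exists s; rewrite s0; split=> //; congr (_ *: mono _).
  by apply/setP=> x; rewrite !inE addbC.
have [s sP] := fin_all_exists H.
have fJ : br f J = \sum_A (coor f A * s A) *: mono (symd [set j] A).
  rewrite -{1}[f]coorK (br_suml _ _ _ (fun A => coor f A *: mono A)).
  by apply: eq_bigr => A _; rewrite brZl (sP A).2 scalerA.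
apply/eqP/mspanP=> [f0 A fA|fM].
  rewrite /= sub -(sP A).1 negbK.
  have := congr1 (fun g => coor g (symd [set j] A)) f0.
  rewrite fJ coor0 coor_bigsum (bigD1 A) //= big1 => [|B BA].
    rewrite coorZ coor_mono eqxx mulr1 addr0 => /eqP.
    by rewrite mulf_eq0 (negPf fA).
  by rewrite coorZ coor_mono (inj_eq (symd_inj (D:=[set j]))) eq_sym (negPf BA) mulr0.
rewrite fJ big1 // => A _; have [->|/fM] := eqVneq (coor f A) 0; first by rewrite mul0r scale0r.
by rewrite /= sub -(sP A).1 negbK => /eqP->; rewrite mulr0 scale0r.
Qed.

Lemma mspan_proper_sq : mspan (proper_in M) = sq par J.
Proof.
have two0 : 2%:R != 0 :> F by rewrite pnatr_eq0.
have qt (A : {set K}) : A \subset M -> (queertrace par J (mono A) == 0) = (A != M).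
  move=> AM; rewrite -(supertrace_queer AM) -[RHS]oppr_eq0.
  by have := queertrace_mono AM => <-; rewrite mulf_eq0 (negPf two0).
apply/eqP; rewrite eqEsubv; apply/andP; split.
  apply: mspan_sub => A; rewrite /proper_in /= properEneq => /andP[AM' AM].
  by rewrite mem_sq qt // AM' andbT queer_coor; apply: mono_mspan.
apply/subvP=> f; rewrite mem_sq queer_coor => /andP[fL /eqP q0].
have fM := mspanP _ _ fL; apply/mspanP=> A fA; rewrite /proper_in /= properEneq [_ \subset _](fM _ fA) andbT.
apply: contraNneq fA => ->; move: q0; rewrite -{1}[f]coorK linear_sum /=.
rewrite (bigD1 M) //= big1 => [|B BM].
  by rewrite addr0 linearZ => /eqP /=; rewrite scaler_eq0 qt // eqxx orbF.
rewrite linearZ /=; have [->|/fM BM'] := eqVneq (coor f B) 0; first by rewrite scale0r.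
by have := qt _ BM'; rewrite BM => /eqP->; rewrite scaler0.
Qed.

End QueerPart.
End Subspaces.

(** * The operators on the Grassmann algebra: even number of generators *)

Section GrassmannRelations.
Variables (F : fieldType) (n : nat).
Local Notation glL := (glL F n).
Local Notation xi := (xi F).
Local Notation pd := (pd F).

Lemma xi_homog (i : 'I_n) : homog (gpar n) true (xi i).
Proof.
apply/homogP=> S T ST; rewrite /entry xiE; case: ifPn => iT; first by rewrite ffunE.
rewrite !ffunE; have [SE|_] := eqVneq S (i |: T); last by rewrite scaler0.
by move: ST; rewrite SE /gpar cardsU1 iT /= addNb addbb.
Qed.

Lemma pd_homog (i : 'I_n) : homog (gpar n) true (pd i).
Proof.
apply/homogP=> S T ST; rewrite /entry pdE; case: ifPn => iT; last by rewrite ffunE.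
rewrite !ffunE; have [SE|_] := eqVneq S (T :\ i); last by rewrite scaler0.
by move: ST; rewrite SE /gpar (cardsD1 i T) iT /= addbN addbb.
Qed.

Lemma lfun_bvecP (f g : glL) : (forall A, f (bvec F A) = g (bvec F A)) -> f = g.
Proof.
move=> fg; apply/lfunP=> v; rewrite (svec_sum v) !linear_sum; apply: eq_bigr => A _ /=.
by rewrite !linearZ /= fg.
Qed.

Lemma xi_xi (i j : 'I_n) : xi i *c xi j + xi j *c xi i = 0.
Proof.
apply: lfun_bvecP => A; rewrite add_lfunE !comp_lfunE zero_lfunE !xiE.
have [<-|ij] := eqVneq i j.
  case: ifP => iA; first by rewrite linear0 addr0.
  by rewrite linearZ /= xiE setU11 scaler0 addr0.
have [iA|iA] := ifPn; have [jA|jA] := ifPn; rewrite ?linear0 ?addr0 ?add0r // !linearZ /= !xiE;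
  rewrite !in_setU1 ?iA ?jA ?orbT ?scaler0 ?addr0 //.
rewrite (negPf iA) (negPf jA) ?(eq_sym j i) (negPf ij) /= !scalerA !belowU // setUCA -!exprD.
rewrite -scalerDl -signr_odd -[X in _ + X]signr_odd !oddD !oddb.
have -> : (i < j)%N = ~~ (j < i)%N by rewrite ltn_neqAle ij -leqNgt.
by case: (j < i)%N; case: (odd _); case: (odd _);
  rewrite /= ?expr0 ?expr1 ?subrr ?addNr ?scale0r.
Qed.

Lemma pd_pd (i j : 'I_n) : pd i *c pd j + pd j *c pd i = 0.
Proof.
apply: lfun_bvecP => A; rewrite add_lfunE !comp_lfunE zero_lfunE !pdE.
have [<-|ij] := eqVneq i j.
  case: ifP => iA; last by rewrite linear0 addr0.
  by rewrite linearZ /= pdE !inE eqxx scaler0 addr0.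
have [jA|jA] := ifPn; have [iA|iA] := ifPn; rewrite ?linear0 ?addr0 ?add0r // !linearZ /= !pdE;
  rewrite !in_setD1 ?(negPf iA) ?(negPf jA) ?andbF ?scaler0 ?addr0 //.
rewrite iA jA ?(eq_sym j i) ij /= !scalerA.
have bi : below i A = ((j < i) + below i (A :\ j))%N.
  by rewrite -{1}(setD1K jA) belowU ?inE ?eqxx.
have bj : below j A = ((i < j) + below j (A :\ i))%N.
  by rewrite -{1}(setD1K iA) belowU ?inE ?eqxx.
have -> : (A :\ i) :\ j = (A :\ j) :\ i by apply/setP=> x; rewrite !inE andbCA.
rewrite bi bj -!exprD -scalerDl -signr_odd -[X in _ + X]signr_odd !oddD !oddb.
have -> : (i < j)%N = ~~ (j < i)%N by rewrite ltn_neqAle ij -leqNgt.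
by case: (j < i)%N; case: (odd _); case: (odd _);
  rewrite /= ?expr0 ?expr1 ?subrr ?addNr ?scale0r.
Qed.

End GrassmannRelations.

Section EvenCase.
Variables (F : numFieldType) (n : nat).
Local Notation glL := (glL F n).
Local Notation xi := (xi F).
Local Notation pd := (pd F).
Local Notation K := ('I_n + 'I_n)%type.

Definition gen_index (s : K) : 'I_n := match s with inl i | inr i => i end.
Definition gen_square (s : K) : F := if s is inl _ then 1 else -1.
(** The index inl i stands for xi_i + d_i, of square 1, and inr i for xi_i -
    d_i, of square -1. *)
Definition clifford_gen (s : K) : glL := xi (gen_index s) + gen_square s *: pd (gen_index s).

Definition anticomm (f g : glL) : glL := f *c g + g *c f.

Lemma anticommC f g : anticomm f g = anticomm g f.
Proof. exact: addrC. Qed.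

Lemma anticomm_linear a f g h : anticomm (g + a *: h) f = anticomm g f + a *: anticomm h f.
Proof.
by rewrite /anticomm comp_lfunDl comp_lfunDr -comp_lfunZl -comp_lfunZr scalerDr addrACA.
Qed.

Lemma clifford_gen_anticomm s t :
  anticomm (clifford_gen s) (clifford_gen t) =
  ((gen_index s == gen_index t)%:R * (gen_square s + gen_square t)) *: \1%VF.
Proof.
rewrite /clifford_gen anticomm_linear ![anticomm _ (_ + _)]anticommC !anticomm_linear.
rewrite /anticomm xi_xi [pd _ *c pd _ + _]pd_pd scaler0 addr0 add0r pd_xi.
rewrite [xi (gen_index t) *c _ + _]addrC pd_xi (eq_sym (gen_index t)) !scalerA -scalerDl.
by rewrite mulrDr addrC [_ * gen_square s]mulrC [_ * gen_square t]mulrC.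
Qed.

Lemma clifford_gen_family : clifford_family (gpar n) clifford_gen gen_square.
Proof.
have two0 : 2%:R != 0 :> F by rewrite pnatr_eq0.
split=> [[] i|s|s|s t st].
- exact: oner_neq0.
- by rewrite oppr_eq0 oner_eq0.
- by apply: homog_add (xi_homog _ _) (homogZ _ (pd_homog _ _)).
- apply: (scalerI two0); rewrite scaler_nat mulr2n; have := clifford_gen_anticomm s s.
  by rewrite /anticomm => ->; rewrite eqxx mul1r scalerA mulr_natl.
apply/eqP; rewrite -addr_eq0; have := clifford_gen_anticomm s t; rewrite /anticomm => ->.
case: s t st => i [] j /= ij; rewrite ?subrr ?addNr ?mulr0 ?scale0r //.
  by rewrite (_ : (i == j) = false) ?mul0r ?scale0r //; apply: contraNF ij => /eqP->.
by rewrite (_ : (i == j) = false) ?mul0r ?scale0r //; apply: contraNF ij => /eqP->.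
Qed.

Lemma clifford_gen_card : (2 ^ #|{: K}| = #|{set 'I_n}| * #|{set 'I_n}|)%N.
Proof. by rewrite card_sum card_ord expnD -cardsT -powersetT card_powerset cardsT card_ord. Qed.

Lemma xi_clifford_gen i : xi i = 2%:R^-1 *: (clifford_gen (inl i) + clifford_gen (inr i)).
Proof.
rewrite /clifford_gen /= scale1r scaleN1r addrACA subrr addr0 -mulr2n -scaler_nat scalerA.
by rewrite mulVf ?scale1r // pnatr_eq0.
Qed.

Lemma pd_clifford_gen i : pd i = 2%:R^-1 *: (clifford_gen (inl i) - clifford_gen (inr i)).
Proof.
rewrite /clifford_gen /= scale1r scaleN1r opprB [xi i + _]addrC addrACA subrr addr0.
rewrite -mulr2n -scaler_nat scalerA.
by rewrite mulVf ?scale1r // pnatr_eq0.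
Qed.

Lemma clgen_span : <<[seq clgen F s | s : K]>>%VS = gen_span clifford_gen [set: K].
Proof.
apply/eqP; rewrite eqEsubv; apply/andP; split; apply/span_subvP=> _ /mapP[s _ ->].
  have cl k : clifford_gen k \in gen_span clifford_gen [set: K].
    by rewrite memv_span // map_f // mem_enum inE.
  by case: s => i /=; rewrite ?xi_clifford_gen ?pd_clifford_gen; apply: rpredZ; [apply: rpredD|apply: rpredB].
have cg k : clgen F k \in <<[seq clgen F s | s : K]>>%VS.
  by rewrite memv_span // map_f // mem_enum.
by rewrite rpredD ?rpredZ //; [apply: (cg (inl _))|apply: (cg (inr _))].
Qed.

Lemma clgen_comp_deg_le2 s t : clgen F s *c clgen F t \in mspan clifford_gen (deg_le2 [set: K]).
Proof.
apply: (gen_span_comp clifford_gen_family); rewrite -clgen_span memv_span // map_f //.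
  by rewrite mem_enum.
by rewrite mem_enum.
Qed.

Lemma clgen_deg_le2 s : clgen F s \in mspan clifford_gen (deg_le2 [set: K]).
Proof. by apply: gen_span_deg_le2; rewrite -clgen_span memv_span // map_f // mem_enum. Qed.

Lemma hei_deg_le2 : (hei_even F n <= mspan clifford_gen (deg_le2 [set: K]))%VS.
Proof.
apply/span_subvP=> f; rewrite inE mem_cat => /or3P[/eqP->|/mapP[i _ ->]|/mapP[i _ ->]].
- exact: deg_le2_id.
- exact: (clgen_deg_le2 (inl _)).
- exact: (clgen_deg_le2 (inr _)).
Qed.

Lemma hei_id : \1%VF \in hei_even F n.
Proof. by rewrite memv_span // mem_head. Qed.

Lemma hei_clgen s : clgen F s \in hei_even F n.
Proof.
by case: s => i /=; rewrite memv_span // inE mem_cat map_f ?mem_enum ?orbT.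
Qed.

Lemma g_even_mspan : g_even F n = mspan clifford_gen (deg_le2 [set: K]).
Proof.
apply: (deg_le2_eq clifford_gen_family clgen_span).
- exact: (subvP (addvSl _ _)) hei_id.
- by move=> _ /mapP[s _ ->]; apply: (subvP (addvSl _ _)); apply: hei_clgen.
- move=> _ _ /mapP[s _ ->] /mapP[t _ ->].
  set X := [seq (xi i *c pd j) | i <- enum 'I_n, j <- enum 'I_n].
  set Y := [seq (pd i *c pd j) | i <- enum 'I_n, j <- enum 'I_n].
  set Z := [seq (xi i *c xi j) | i <- enum 'I_n, j <- enum 'I_n].
  have XYZ f : f \in X ++ Y ++ Z -> f \in g_even F n.
    by move=> fX; apply: (subvP (addvSr _ _)); apply: memv_span.
  case: s t => i [] j /=.
  + by apply: XYZ; rewrite !mem_cat; apply/or3P/Or33/allpairs_f; rewrite mem_enum.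
  + by apply: XYZ; rewrite !mem_cat; apply/or3P/Or31/allpairs_f; rewrite mem_enum.
  + have -> : pd i *c xi j = (i == j)%:R *: \1%VF - xi j *c pd i by rewrite -pd_xi addrK.
    rewrite rpredB ?rpredZ //; first exact: (subvP (addvSl _ _)) hei_id.
    by apply: XYZ; rewrite !mem_cat; apply/or3P/Or31/allpairs_f; rewrite mem_enum.
  + by apply: XYZ; rewrite !mem_cat; apply/or3P/Or32/allpairs_f; rewrite mem_enum.
rewrite subv_add hei_deg_le2; apply/span_subvP=> f; rewrite !mem_cat.
case/or3P=> /allpairsP[[i j] [_ _ ->]] /=.
- exact: (clgen_comp_deg_le2 (inl _) (inr _)).
- exact: (clgen_comp_deg_le2 (inr _) (inr _)).
- exact: (clgen_comp_deg_le2 (inl _) (inl _)).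
Qed.

Theorem g_even_maximal : (2 <= n)%N -> n <> 3%N ->
  maximal_subsuperalgebra (gpar n) (g_even F n) (sl F (gpar n)).
Proof.
move=> n2 n3; rewrite g_even_mspan -(mspan_proper_sl clifford_gen_family clifford_gen_card).
apply: (clifford_maximal clifford_gen_family clifford_gen_card); rewrite cardsT card_sum card_ord addnn.
  by rewrite (leq_double 2 n).
by rewrite -[6%N]/(3.*2) => /double_inj.
Qed.

End EvenCase.

(** * Odd number of generators *)

Section OddCase.
Variables (F : numFieldType) (n : nat).
Local Notation glL := (glL F n.+1).
Local Notation K := ('I_n.+1 + 'I_n.+1)%type.
Local Notation x i := (xi F (lift ord_max i)).
Local Notation d i := (pd F (lift ord_max i)).
Local Notation t := (theta F n + pd_theta F n).
Local Notation jJ := (inr ord_max : K).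
Local Notation M := ([set~ jJ] : {set K}).
Local Notation cgen := (@clifford_gen F n.+1).
Local Notation deg_le2M := (mspan cgen (deg_le2 M)).

Lemma mem_seqx i : x i \in [seq x i | i : 'I_n].
Proof. exact: (codom_f (fun i => x i)). Qed.

Lemma mem_seqd i : d i \in [seq d i | i : 'I_n].
Proof. exact: (codom_f (fun i => d i)). Qed.

Definition odd_gens : seq glL := [seq x i | i : 'I_n] ++ [seq d i | i : 'I_n] ++ [:: t].

Lemma clifford_gen_J : cgen jJ = J_theta F n.
Proof. by rewrite /cgen /= scaleN1r. Qed.

Lemma clifford_gen_t : cgen (inl ord_max) = t.
Proof. by rewrite /cgen /= scale1r. Qed.

Lemma odd_gens_span : <<odd_gens>>%VS = gen_span cgen M.
Proof.
apply/eqP; rewrite eqEsubv; apply/andP; split; apply/span_subvP=> f.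
  have cl k : k != jJ -> cgen k \in gen_span cgen M.
    by move=> kJ; rewrite memv_span // map_f // mem_enum !inE.
  have lx i : inl (lift ord_max i) != jJ by [].
  have ld i : inr (lift ord_max i) != jJ.
    by rewrite -[_ == _]/(lift ord_max i == ord_max) eq_sym neq_lift.
  rewrite !mem_cat => /or3P[/mapP[i _ ->]|/mapP[i _ ->]|].
  - by rewrite xi_clifford_gen; apply: rpredZ; apply: rpredD; apply: cl.
  - by rewrite pd_clifford_gen; apply: rpredZ; apply: rpredB; apply: cl.
  - by rewrite inE => /eqP->; rewrite -clifford_gen_t; apply: cl.
case/mapP=> k; rewrite mem_enum !inE => kJ ->.
have xX i : x i \in <<odd_gens>>%VS by rewrite memv_span // !mem_cat mem_seqx.
have dX i : d i \in <<odd_gens>>%VS.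
  by apply: memv_span; rewrite !mem_cat; rewrite mem_seqd orbT.
have clX s : gen_index s != ord_max -> cgen s \in <<odd_gens>>%VS.
  rewrite /clifford_gen; case: (unliftP ord_max (gen_index s)) => [i|] ->; last by rewrite eqxx.
  by move=> _; apply: rpredD; [apply: xX|apply: rpredZ; apply: dX].
case: k kJ => i kJ; case: (unliftP ord_max i) kJ => [i'|] -> kJ.
- by apply: clX; rewrite /= eq_sym neq_lift.
- by rewrite clifford_gen_t memv_span // !mem_cat inE eqxx !orbT.
- by apply: clX; rewrite /= eq_sym neq_lift.
- by rewrite eqxx in kJ.
Qed.

(** The generators xi_i, d_i and theta + d_theta span the same space as all
    the Clifford generators but J, and their products in the other order are
    reduced by the anticommutation relations. *)
Lemma g_odd_mspan : g_odd F n = deg_le2M.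
Proof.
have fam := clifford_gen_family F n.+1.
set X := [seq x i | i : 'I_n]; set Y := [seq d i | i : 'I_n].
set A := [seq (x i *c d j) | i <- enum 'I_n, j <- enum 'I_n].
set B := [seq (d i *c d j) | i <- enum 'I_n, j <- enum 'I_n].
set C := [seq (x i *c x j) | i <- enum 'I_n, j <- enum 'I_n].
set D := [seq (x i *c t) | i : 'I_n]; set E := [seq (d i *c t) | i : 'I_n].
have GE : g_odd F n = <<\1%VF :: X ++ Y ++ A ++ B ++ C ++ t :: D ++ E>>%VS by [].
have mG f : f \in [:: \1%VF] \/ f \in X \/ f \in Y \/ f \in A \/ f \in B \/ f \in C \/
    f \in [:: t] \/ f \in D \/ f \in E -> f \in g_odd F n.
  have catl (r s : seq glL) (P : Prop) : (P -> f \in s) -> f \in r \/ P -> f \in r ++ s.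
    by rewrite mem_cat => Ps [->//|/Ps->]; rewrite orbT.
  move=> fX; rewrite GE -cat1s -[t :: _]cat1s; apply: memv_span; move: fX.
  by do 8!apply: (@catl _ _ _).
have tE : t = cgen (inl ord_max) by rewrite clifford_gen_t.
have tt : t *c t = \1%VF by rewrite tE; case: fam => _ _ -> _; rewrite scale1r.
have tx i : t *c x i = - (x i *c t).
  apply/eqP; rewrite -addr_eq0 [X in X + _]comp_lfunDl comp_lfunDr addrACA xi_xi pd_xi.
  by rewrite (negPf (neq_lift _ _)) scale0r addr0.
have td i : t *c d i = - (d i *c t).
  apply/eqP; rewrite -addr_eq0 [X in X + _]comp_lfunDl comp_lfunDr addrACA pd_pd.
  by rewrite addr0 addrC pd_xi (eq_sym (lift _ _)) (negPf (neq_lift _ _)) scale0r.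
have id1 : \1%VF \in g_odd F n by apply: mG; left; rewrite inE.
apply: (deg_le2_eq fam odd_gens_span) => //.
- move=> f; rewrite mem_cat => /orP[fX|]; first by apply: mG; do 1!right; left.
  rewrite mem_cat => /orP[fY|ft]; apply: mG; first by do 2!right; left.
  by do 6!right; left.
- have xX := mem_seqx.
  have dY := mem_seqd.
  have pA i j : x i *c d j \in g_odd F n.
    by apply: mG; do 3!right; left; apply: (allpairs_f (fun i j => x i *c d j)); rewrite mem_enum.
  have pB i j : d i *c d j \in g_odd F n.
    by apply: mG; do 4!right; left; apply: (allpairs_f (fun i j => d i *c d j)); rewrite mem_enum.
  have pC i j : x i *c x j \in g_odd F n.
    by apply: mG; do 5!right; left; apply: (allpairs_f (fun i j => x i *c x j)); rewrite mem_enum.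
  have pD i : x i *c t \in g_odd F n by apply: mG; do 7!right; left; exact: (codom_f (fun i => x i *c t)).
  have pE i : d i *c t \in g_odd F n by apply: mG; do 8!right; exact: (codom_f (fun i => d i *c t)).
  have pF i j : d i *c x j \in g_odd F n.
    have -> : d i *c x j = (i == j)%:R *: \1%VF - x j *c d i.
      by rewrite -(inj_eq (@lift_inj _ ord_max)) -pd_xi addrK.
    by apply: rpredB; [apply: rpredZ|apply: pA].
  have pG i : t *c x i \in g_odd F n by rewrite tx rpredN; apply: pD.
  have pH i : t *c d i \in g_odd F n by rewrite td rpredN; apply: pE.
  have pI : t *c t \in g_odd F n by rewrite tt; apply: id1.
  have case3 (P : glL -> Prop) : (forall i, P (x i)) -> (forall i, P (d i)) -> P t ->
      forall f, f \in odd_gens -> P f.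
    move=> Px Pd Pt f; rewrite !mem_cat => /or3P[/mapP[i _ ->]|/mapP[i _ ->]|] //.
    by rewrite inE => /eqP->.
  move=> f g fX gX; move: f fX; apply: (@case3 _) => [i|i|]; move: g gX; apply: (@case3 _) => *; auto.
have lowp := gen_span_comp fam (M := M); rewrite -odd_gens_span in lowp.
have lowg f : f \in <<odd_gens>>%VS -> f \in deg_le2M.
  by rewrite odd_gens_span; apply: gen_span_deg_le2.
have xX i : x i \in <<odd_gens>>%VS by rewrite memv_span // !mem_cat mem_seqx.
have dX i : d i \in <<odd_gens>>%VS.
  by apply: memv_span; rewrite !mem_cat; rewrite mem_seqd orbT.
have tX : t \in <<odd_gens>>%VS by rewrite memv_span // !mem_cat inE eqxx !orbT.
rewrite GE; apply/span_subvP=> f.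
rewrite inE => /orP[/eqP->|]; first exact: deg_le2_id.
rewrite mem_cat => /orP[/mapP[i _ ->]|]; first exact: lowg.
rewrite mem_cat => /orP[/mapP[i _ ->]|]; first exact: lowg.
rewrite mem_cat => /orP[/allpairsP[[i j] [_ _ ->]]|]; first exact: lowp.
rewrite mem_cat => /orP[/allpairsP[[i j] [_ _ ->]]|]; first exact: lowp.
rewrite mem_cat => /orP[/allpairsP[[i j] [_ _ ->]]|]; first exact: lowp.
rewrite inE => /orP[/eqP->|]; first exact: lowg.
by rewrite mem_cat => /orP[/mapP[i _ ->]|/mapP[i _ ->]]; apply: lowp.
Qed.

Theorem g_odd_maximal : (2 < n.+1)%N ->
  maximal_subsuperalgebra (gpar n.+1) (g_odd F n) (sq (gpar n.+1) (J_theta F n)).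
Proof.
move=> n2; rewrite g_odd_mspan -clifford_gen_J -(mspan_proper_sq (clifford_gen_family F n.+1) (clifford_gen_card n.+1)).
(* The parity of |M| excludes the size 6. *)
have cM : #|M| = n.*2.+1.
  by rewrite cardsC1 card_sum card_ord addnn doubleS.
apply: (clifford_maximal (clifford_gen_family F n.+1) (clifford_gen_card n.+1)); rewrite cM.
  by rewrite ltnS (leq_trans (_ : 3 <= 4)%N) // (leq_double 2 n).
by move/(congr1 odd); rewrite /= odd_double.
Qed.

End OddCase.

(** * Antisymmetrized products *)

Section AnticommutingProducts.
Variables (F : fieldType) (I : finType).
Local Notation gl := (gl F I).
Local Notation comp := (@comp_lfun F (svec F I) (svec F I) (svec F I)).

(** Moving the factor of index j from the front to its place passes j factors. *)
Lemma anticomm_pull k (y : 'I_k.+1 -> gl) (j : 'I_k.+1) :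
    (forall i i', i != i' -> y i *c y i' = - (y i' *c y i)) ->
  y j *c \big[comp / \1%VF]_(i < k) y (lift j i) =
  (-1) ^+ j *: \big[comp / \1%VF]_(i < k.+1) y i.
Proof.
elim: k y j => [|k IHk] y j yC.
  by rewrite (ord1 j) big_ord0 comp_lfun1r big_ord_recl big_ord0 comp_lfun1r scale1r.
have [j0 jE|->] := unliftP ord0 j; last by rewrite expr0 scale1r [RHS]big_ord_recl.
rewrite big_ord_recl.
have -> : lift j ord0 = ord0 by rewrite jE; apply: val_inj.
rewrite comp_lfunA yC; last by rewrite jE eq_sym neq_lift.
have -> : \big[comp / \1%VF]_(i < k) y (lift j (lift ord0 i)) =
          \big[comp / \1%VF]_(i < k) y (lift ord0 (lift j0 i)).
  apply: eq_bigr => i _; congr y; rewrite jE; apply: val_inj => /=.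
  by rewrite /bump /= !add1n addnS ltnS.
rewrite comp_lfunNl -comp_lfunA [in y j]jE (IHk (fun i => y (lift ord0 i)) j0); last first.
  by move=> i i' ii'; apply: yC; rewrite (inj_eq lift_inj).
rewrite -comp_lfunZr [in RHS]big_ord_recl jE /= /bump /= add1n exprS mulN1r scaleNr.
by [].
Qed.

(** Induction on k: the factor of index s 0 is first moved to its place, and
    the remaining factors are permuted by the permutation u such that s is the
    lift of u, whose sign is that of s up to (-1)^(s 0). *)
Lemma anticomm_perm k (y : 'I_k -> gl) (s : 'S_k) :
    (forall i i', i != i' -> y i *c y i' = - (y i' *c y i)) ->
  \big[comp / \1%VF]_(i < k) y (s i) = (-1) ^+ s *: \big[comp / \1%VF]_(i < k) y i.
Proof.
elim: k y s => [|k IHk] y s yC.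
  by rewrite !big_ord0 (_ : s = 1%g) ?odd_perm1 ?scale1r //; apply/permP=> -[].
set j := s ord0.
have uj i : exists i', s (lift ord0 i) = lift j i'.
  have : j != s (lift ord0 i) by rewrite (inj_eq perm_inj) neq_lift.
  by case: (unliftP j (s (lift ord0 i))) => [i' ->|->]; [exists i'|rewrite eqxx].
have [u uP] := fin_all_exists uj.
have u_inj : injective u.
  move=> a b ab; have := uP a; rewrite ab -uP => /perm_inj/lift_inj //.
have sE : s = lift_perm ord0 j (perm u_inj).
  apply/permP=> i; case: (unliftP ord0 i) => [i' ->|->]; last by rewrite lift_perm_id.
  by rewrite lift_perm_lift permE uP.
rewrite big_ord_recl -/j.
have -> : \big[comp / \1%VF]_(i < k) y (s (lift ord0 i)) =
          \big[comp / \1%VF]_(i < k) y (lift j (perm u_inj i)).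
  by apply: eq_bigr => i _; rewrite uP permE.
rewrite (IHk (fun i => y (lift j i))); last first.
  by move=> i i' ii'; apply: yC; rewrite (inj_eq lift_inj).
rewrite -comp_lfunZr anticomm_pull // scalerA.
have -> : odd_perm s = odd j (+) odd_perm (perm u_inj) by rewrite {1}sE odd_lift_perm.
by rewrite signr_addb signr_odd mulrC.
Qed.

Lemma prodZ (J : Type) (r : seq J) (a : J -> F) (f : J -> gl) :
  \big[comp / \1%VF]_(j <- r) (a j *: f j) =
  (\prod_(j <- r) a j) *: \big[comp / \1%VF]_(j <- r) f j.
Proof.
elim: r => [|j r IHr]; first by rewrite !big_nil scale1r.
by rewrite !big_cons IHr -comp_lfunZl -comp_lfunZr scalerA.
Qed.

Lemma span_image_coords (S : finType) (h : S -> gl) f :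
    f \in <<[seq h s | s : S]>>%VS ->
  exists c : {ffun S -> F}, f = \sum_s c s *: h s.
Proof.
move: f; apply: span_ind => [|a f g [c ->] [c' ->]|_ /mapP[s _ ->]].
- by exists [ffun=> 0]; rewrite big1 // => s _; rewrite ffunE scale0r.
- exists [ffun s => a * c s + c' s]; rewrite scaler_sumr -big_split.
  by apply: eq_bigr => s _; rewrite ffunE scalerDl scalerA.
exists [ffun t => (t == s)%:R]; rewrite (bigD1 s) //= ffunE eqxx scale1r big1 ?addr0 // => t ts.
by rewrite ffunE (negPf ts) scale0r.
Qed.

End AnticommutingProducts.

Lemma eq_opp_eq0 (F : numFieldType) (V : lmodType F) (v : V) : v = - v -> v = 0.
Proof.
move/eqP; rewrite -addr_eq0 -mulr2n -scaler_nat scaler_eq0 pnatr_eq0 => /eqP.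
exact.
Qed.

Section AlternatingProducts.
Variables (F : numFieldType) (n : nat).
Local Notation glL := (glL F n).
Local Notation K := ('I_n + 'I_n)%type.
Local Notation comp := (@comp_lfun F (Lambda F n) (Lambda F n) (Lambda F n)).

(** Antisymmetrized products are multilinear, so a spanning set of values is
    enough to control all of them. *)
Lemma altprod_mem (S : finType) (h : S -> glL) k (U : {vspace glL}) :
    (forall t : {ffun 'I_k -> S}, altprod (fun i => h (t i)) \in U) ->
  forall x : 'I_k -> glL, (forall i, x i \in <<[seq h s | s : S]>>%VS) -> altprod x \in U.
Proof.
move=> hU x xh.
have [a aP] := fin_all_exists (fun i => span_image_coords (xh i)).
have -> : altprod x = \sum_(t : {ffun 'I_k -> S})
    (\prod_i a i (t i)) *: altprod (fun i => h (t i)); last first.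
  by apply: memv_suml => t _; rewrite rpredZ.
rewrite /altprod; under [RHS]eq_bigr do rewrite scaler_sumr.
rewrite exchange_big /=; apply: eq_bigr => s _.
under eq_bigr do rewrite aP.
rewrite prod_comp_distr scaler_sumr.
(* The expansion of the product permuted by s is reindexed along s, so that
   the coefficient no longer depends on s. *)
pose c (f : {ffun 'I_k -> S}) := [ffun i => f (s i)].
pose c' (f : {ffun 'I_k -> S}) := [ffun i => f ((s^-1)%g i)].
rewrite (reindex c); last first.
  exists c' => f _; apply/ffunP=> i; rewrite !ffunE; first by rewrite permKV.
  by rewrite permK.
apply: eq_bigr => t _; rewrite scalerA mulrC -scalerA; congr (_ *: _).
under eq_bigr do rewrite ffunE.
rewrite (prodZ _ (fun i => a (s i) (t (s i)))); congr (_ *: _).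
by rewrite [RHS](reindex_perm s).
Qed.

(** Composing the permutations with the transposition of a and b changes the
    signs but not the products. *)
Lemma altprod_alt k (x : 'I_k -> glL) a b : a != b -> x a = x b -> altprod x = 0.
Proof.
move=> ab xab; have E : altprod x = - altprod x.
  rewrite {1}/altprod (reindex_inj (mulIg (tperm a b))) /= /altprod -sumrN.
  apply: eq_bigr => s _; rewrite odd_permM odd_tperm ab signr_addb mulrN1 scaleNr.
  congr (- (_ *: _)); apply: eq_bigr => i _; rewrite permM.
  by case: tpermP => // ->.
exact: eq_opp_eq0 E.
Qed.

Lemma altprod_anticomm k (y : 'I_k -> glL) :
    (forall i i', i != i' -> y i *c y i' = - (y i' *c y i)) ->
  altprod y = k`!%:R *: \big[comp / \1%VF]_(i < k) y i.
Proof.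
move=> yC; rewrite /altprod.
under eq_bigr => s _ do rewrite anticomm_perm // scalerA -expr2 sqrr_sign scale1r.
by rewrite sumr_const card_Sn scaler_nat.
Qed.

Lemma prod_mono (r : seq K) : uniq r ->
  propto (\big[comp / \1%VF]_(k <- r) clifford_gen F k) (monomial (@clifford_gen F n) [set k in r]).
Proof.
elim: r => [_|k r IHr /= /andP[kr ur]].
  rewrite big_nil (_ : [set k in [::]] = set0) ?mono0; first exact: propto_refl.
  by apply/setP=> k; rewrite !inE.
rewrite big_cons; apply: propto_trans (propto_comp (propto_refl _) (IHr ur)) _.
apply: propto_trans (gen_mono (clifford_gen_family F n) _ _) _.
rewrite (_ : symd _ _ = [set x in k :: r]); first exact: propto_refl.
by apply/setP=> x; rewrite !inE; case: eqVneq => // ->; rewrite (negPf kr).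
Qed.

Lemma altprod_clifford_gen k (t : 'I_k -> K) : injective t ->
  propto (altprod (fun i => clifford_gen F (t i))) (monomial (@clifford_gen F n) [set t i | i : 'I_k]).
Proof.
move=> t_inj; case: (clifford_gen_family F n) => _ _ _ eC.
rewrite altprod_anticomm => [|i i' ii']; last by rewrite eC // (inj_eq t_inj).
apply: propto_trans (proptoZ _ _) _; first by rewrite pnatr_eq0 -lt0n fact_gt0.
have ur : uniq [seq t i | i : 'I_k] by rewrite map_inj_uniq ?enum_uniq.
have eE : index_enum 'I_k = enum 'I_k by rewrite [index_enum _]unlock enumT.
have := prod_mono ur; rewrite big_map -eE.
by rewrite (_ : [set k in _] = [set t i | i : 'I_k]) //; apply/setP=> x; rewrite ?eE;
  rewrite inE; apply/mapP/imsetP=> -[i _ ->]; exists i; rewrite ?mem_enum ?inE.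
Qed.

(** Both families of generators span the same space, and for the Clifford
    generators an antisymmetrized product of distinct factors is k! times
    their product. *)
Lemma altpow_mspan k :
  altpow F n k = mspan (@clifford_gen F n) [pred A : {set K} | #|A| == k].
Proof.
apply/eqP; rewrite eqEsubv; apply/andP; split.
  apply/span_subvP=> _ /mapP[t _ ->]; apply: (altprod_mem (h := @clifford_gen F n)).
    move=> u; have [/injectiveP u_inj|] := boolP (injectiveb u).
      have [s _ ->] := altprod_clifford_gen u_inj; rewrite rpredZ //; apply: mono_mspan.
      by rewrite /= card_imset // card_ord.
    move/injectivePn=> [a [b ab uab]]; rewrite (altprod_alt ab) ?mem0v //.
    by rewrite uab.
  move=> i; suff -> : <<[seq clifford_gen F s | s : K]>>%VS = <<[seq clgen F s | s : K]>>%VS.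
    by rewrite memv_span // map_f // mem_enum.
  by rewrite clgen_span; congr <<map _ _>>%VS; apply: eq_enum => s; rewrite !inE.
apply: mspan_sub => A /eqP Ak.
pose t (i : 'I_k) : K := enum_val (cast_ord (esym Ak) i).
have t_inj : injective t by move=> i j /enum_val_inj/cast_ord_inj.
have AE : A = [set t i | i : 'I_k].
  apply/eqP; rewrite eq_sym eqEcard; apply/andP; split.
    by apply/subsetP=> _ /imsetP[i _ ->]; apply: enum_valP.
  by rewrite card_imset // card_ord Ak.
rewrite AE; apply: propto_mem (altprod_clifford_gen t_inj) _.
apply: (altprod_mem (h := @clgen F n)) => [u|i].
  by rewrite memv_span // map_f // mem_enum.
rewrite clgen_span; apply: memv_span; apply: map_f; rewrite mem_enum inE //.
Qed.

End AlternatingProducts.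

(** * The central extension and its images *)

Lemma trmx_add (F : fieldType) m n (X Y : 'M[F]_(m, n)) : (X + Y)^T = X^T + Y^T.
Proof. exact: linearD. Qed.

Lemma trmx_opp (F : fieldType) m n (X : 'M[F]_(m, n)) : (- X)^T = - X^T.
Proof. exact: linearN. Qed.

Lemma mxtrace_opp (F : fieldType) n (X : 'M[F]_n) : \tr (- X) = - \tr X.
Proof. exact: linearN. Qed.

Section AsAlgebra.
Variable F : numFieldType.
Local Notation asT := ('M[F]_(4 + 4) * F^o)%type.
Local Notation mxbr := (sbracket (fun x y : 'M[F]_(4 + 4) => x *m y) (@mxhpart F)).
Implicit Types (A B C X Y D : 'M[F]_4).

Lemma mxbr_block A X Y D A' X' Y' D' :
  mxbr (block_mx A X Y D) (block_mx A' X' Y' D') =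
  block_mx (A *m A' - A' *m A + (X *m Y' + X' *m Y))
           (A *m X' - X' *m D + (X *m D' - A' *m X))
           (D *m Y' - Y' *m A + (Y *m A' - D' *m Y))
           (D *m D' - D' *m D + (Y *m X' + Y' *m X)).
Proof.
rewrite /sbracket !big_bool /mxhpart /= !expr0 expr1 !scale1r !scaleN1r !opprK.
rewrite !(block_mxKul, block_mxKur, block_mxKdl, block_mxKdr) !mulmx_block.
rewrite !(mul0mx, mulmx0, addr0, add0r) !opp_block_mx !add_block_mx !(oppr0, addr0, add0r).
by congr block_mx; rewrite ?(addrC (_ *m Y' + _)) // addrC // [X in X + _]addrC.
Qed.

Definition blk A B C : 'M[F]_(4 + 4) := block_mx A B C (- A^T).

Lemma as_br_blk A B C A' B' C' (d d' : F) : B^T = B -> B'^T = B' -> C^T = - C -> C'^T = - C' ->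
  as_br (blk A B C, d) (blk A' B' C', d') =
  (blk (A *m A' - A' *m A + (B *m C' + B' *m C))
       (A *m B' + B' *m A^T - (A' *m B + B *m A'^T))
       (C *m A' + A'^T *m C - (C' *m A + A^T *m C')),
   \tr (C *m hodge C')).
Proof.
move=> Bs Bs' Cs Cs'; rewrite /as_br /blk /= mxbr_block !block_mxKdl; congr (block_mx _ _ _ _, _).
- by rewrite !mulmxN !opprK opprD [X in _ + X]addrC.
- rewrite !mulNmx !opprK opprD addrC; congr (_ + _); by rewrite addrC.
- rewrite !(trmx_add, trmx_opp) !trmx_mul Bs Bs' Cs Cs' !mulNmx ?mulmxN !opprK.
  rewrite !opprD !opprK.
  by rewrite [LHS]addrC [RHS]addrC [C *m B' + _]addrC [A^T *m A'^T - _]addrC.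
Qed.

Lemma trace_sym_skew B C : B^T = B -> C^T = - C -> \tr (B *m C) = 0.
Proof.
move=> Bs Cs; have : \tr (B *m C) = - \tr (B *m C).
  by rewrite -{1}mxtrace_tr trmx_mul Bs Cs mulNmx mxtrace_opp mxtrace_mulC.
by move/eqP; rewrite eq_sym eqNr => /eqP.
Qed.

Lemma in_asP (a : asT) : in_as a <-> exists A B C d,
  [/\ \tr A = 0, B^T = B, C^T = - C & a = (blk A B C, d)].
Proof.
case: a => x d; split=> [[A [B [C [A0 Bs Cs /= ->]]]]|[A [B [C [d' [A0 Bs Cs [-> ->]]]]]]].
  by exists A, B, C, d.
by exists A, B, C.
Qed.

(** The upper left block has trace 0 because the trace of a symmetric matrix
    times a skew one is 0. *)
Lemma as_br_closed (a b : asT) : in_as a -> in_as b -> in_as (as_br a b).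
Proof.
move=> /in_asP[A [B [C [d [A0 Bs Cs ->]]]]] /in_asP[A' [B' [C' [d' [A0' Bs' Cs' ->]]]]].
rewrite as_br_blk //; apply/in_asP; do 4!eexists; split; last reflexivity.
- rewrite !(mxtraceD, mxtrace_opp) mxtrace_mulC subrr add0r.
  by rewrite !trace_sym_skew // addr0.
- rewrite !(trmx_add, trmx_opp) !trmx_mul !trmxK Bs Bs'.
  by rewrite [X in X + _]addrC [X in _ - X]addrC.
- rewrite !(trmx_add, trmx_opp) !trmx_mul !trmxK Cs Cs' !mulNmx !mulmxN ?opprD !opprK.
  by rewrite [X in X + _]addrC [X in _ + X]addrC.
Qed.

Lemma as_hpart_closed p (a : asT) : in_as a -> in_as (as_hpart p a).
Proof.
move=> /in_asP[A [B [C [d [A0 Bs Cs ->]]]]]; apply/in_asP; rewrite /as_hpart /mxhpart /blk /=.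
rewrite block_mxKul block_mxKur block_mxKdl block_mxKdr.
case: p; [exists 0, B, C, 0|exists A, 0, 0, d]; rewrite ?trmx0 ?oppr0 ?linear0; split=> //.
Qed.

Lemma as_decomp A B C (d : F) :
  (blk A B C, d) = as_A A + as_B B + as_C C + (d : F) *: as_z F :> asT.
Proof.
rewrite /as_A /as_B /as_C /as_z /blk; congr (_, _) => /=; last first.
  by rewrite !addr0 add0r /GRing.scale /= mulr1.
by rewrite scaler0 addr0 !add_block_mx !(addr0, add0r).
Qed.

Section Image.
Local Notation glL := (glL F 3).
Local Notation K := ('I_3 + 'I_3)%type.
Local Notation cgen := (@clifford_gen F 3).
Local Notation mspan := (mspan cgen).
Let fam := clifford_gen_family F 3.
Let card := clifford_gen_card 3.

(** The three pieces of as are identified with o(6), W and hei, and the first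
    and third make up all monomials of degree at most 2. *)
Lemma as_image_sum (L : {vspace glL}) : is_as_image L -> exists W : {vspace glL},
  [/\ is_subsuperalgebra (gpar 3) L, L = (mspan (deg_le2 [set: K]) + W)%VS & is_cubic_component W].
Proof.
case=> rho [W [[LP _ rhoh rhob _] [Wc o6P WP heiP]]]; exists W; split=> //.
  split=> [p f /LP[a aas ->]|f g /LP[a aas ->] /LP[b bas ->]]; apply/LP.
    by exists (as_hpart p a); [apply: as_hpart_closed|rewrite rhoh].
  by exists (as_br a b); [apply: as_br_closed|rewrite rhob].
have o6_low : (altpow F 3 2 <= mspan (deg_le2 [set: K]))%VS.
  rewrite altpow_mspan; apply: mspan_sub => A /eqP A2; apply: mono_mspan.
  by rewrite /deg_le2 /= subsetT A2.
apply/eqP; rewrite eqEsubv; apply/andP; split.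
  apply/subvP=> f /LP[a /in_asP[A [B [C [d [A0 Bs Cs ->]]]]] ->].
  rewrite as_decomp -addrA [as_A A + as_B B]addrC -addrA addrC linearD /=.
  apply: memv_add; last by apply/WP; exists B.
  rewrite linearD; apply: rpredD.
    by apply: (subvP o6_low); apply/o6P; exists A.
  by apply: (subvP (hei_deg_le2 F 3)); apply/heiP; exists C, d.
rewrite subv_add; apply/andP; split; last first.
  apply/subvP=> f /WP[B Bs ->]; apply/LP; exists (as_B B) => //.
  by apply/in_asP; exists 0, B, 0, 0; rewrite /blk !linear0 ?trmx0 ?oppr0; split.
have heiL : (hei_even F 3 <= L)%VS.
  apply/subvP=> f /heiP[C [d [Cs ->]]]; apply/LP; exists (as_C C + d *: as_z F) => //.
  apply/in_asP; exists 0, 0, C, d; rewrite trmx0 linear0; split=> //.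
  by rewrite as_decomp /as_A /as_B linear0 oppr0 block_mx0 !add0r.
have o6L : (altpow F 3 2 <= L)%VS.
  apply/subvP=> f /o6P[A A0 ->]; apply/LP; exists (as_A A) => //.
  by apply/in_asP; exists A, 0, 0, 0; rewrite ?linear0; split.
apply: mspan_sub => A /andP[_]; rewrite leq_eqVlt => /orP[A2|].
  by apply: (subvP o6L); rewrite altpow_mspan; apply: mono_mspan.
have heig k : cgen k \in hei_even F 3.
  rewrite /clifford_gen rpredD ?rpredZ //.
    exact: (hei_clgen F (inl _)).
  exact: (hei_clgen F (inr _)).
rewrite ltnS leq_eqVlt => /orP[/cards1P[k ->]|].
  by rewrite mono1; apply: (subvP heiL).
by rewrite ltnS leqn0 cards_eq0 => /eqP->; rewrite mono0; apply: (subvP heiL); apply: hei_id.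
Qed.

Lemma o6_stable_swap (U : {vspace glL}) :
    (forall f u, f \in altpow F 3 2 -> u \in U -> br (gpar 3) f u \in U) ->
  swap_stable (gpar 3) cgen [set: K] U.
Proof.
move=> Uo i j f _ _ ij fU; apply: Uo => //; rewrite altpow_mspan; apply: mono_mspan.
by rewrite /= cards2 ij.
Qed.

Lemma cubic_component_stable (W : {vspace glL}) : is_cubic_component W ->
  (W <= mspan (deg_eq3 [set: K]))%VS /\ swap_stable (gpar 3) cgen [set: K] W.
Proof.
case=> W3 _ Wo _; split; last exact: o6_stable_swap.
apply: subv_trans W3 _; rewrite altpow_mspan; apply: mspan_sub => A A3.
by apply: mono_mspan; rewrite /deg_eq3 /= subsetT.
Qed.

(** The subspace W has dimension 10, so it is nonzero, and its other
    properties are those that [clifford_maximal6] compares it by: it lies in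
    degree 3 and is stable under o(6). *)
Theorem as_image_maximal (L : {vspace glL}) : is_as_image L ->
  [/\ (g_even F 3 <= L)%VS, (L <= sl F (gpar 3))%VS
    & maximal_subsuperalgebra (gpar 3) L (sl F (gpar 3))].
Proof.
move=> /as_image_sum[W [Lalg LE Wc]]; have [W3 Ws] := cubic_component_stable Wc.
have Lmax : maximal_subsuperalgebra (gpar 3) L (sl F (gpar 3)).
  rewrite -(mspan_proper_sl fam card).
  apply: (clifford_maximal6 fam card _ Lalg LE) => //.
    by rewrite cardsT card_sum !card_ord.
  by case: Wc => _ Wd _ _; apply: contra_eqN Wd => /eqP->; rewrite dimv0.
split=> //; last by case: Lmax.
by rewrite g_even_mspan LE addvSl.
Qed.

End Image.
End AsAlgebra.

(** * Duality of skew matrices of size 4 *)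

Lemma ord4_ind (P : 'I_4 -> Prop) : P 0 -> P 1 -> P 2%:R -> P 3%:R -> forall i, P i.
Proof.
move=> P0 P1 P2 P3 i.
have: i \in [:: 0; 1; 2%:R; 3%:R] by case: i => [[|[|[|[|]]]]].
by rewrite !inE => /or4P[] /eqP->.
Qed.

Lemma sum4 (V : nmodType) (f : 'I_4 -> V) : \sum_k f k = f 0 + f 1 + f 2%:R + f 3%:R.
Proof.
rewrite !big_ord_recr big_ord0 /= add0r; congr (f _ + f _ + f _ + f _); exact: val_inj.
Qed.

Section Hodge.
Variable F : numFieldType.
Implicit Types A B C : 'M[F]_4.

(** The two values left to s at 2 and 3 can be arranged in two ways, and
    exactly one of them makes s even; so the sum that defines the dual has a
    single term. *)
Lemma hodge_even C (t : 'S_4) : ~~ odd_perm t ->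
  hodge C (t 0) (t 1) = C (t 2%:R) (t 3%:R).
Proof.
move=> et; rewrite mxE; apply: big_pred1 => s /=; apply/and3P/eqP=> [[es /eqP s0 /eqP s1]|->//].
pose u := (s * t^-1)%g.
have u0 : u 0 = 0 by rewrite permM s0 permK.
have u1 : u 1 = 1 by rewrite permM s1 permK.
have eu : ~~ odd_perm u by rewrite odd_permM odd_permV (negPf es) (negPf et).
have un i j : i != j -> u i != u j by rewrite (inj_eq perm_inj).
(* u fixes 0 and 1, so it is the identity or the odd transposition of 2 and 3. *)
have c2 : u 2%:R = 2%:R \/ u 2%:R = 3%:R.
  have := un 2%:R 0 isT; have := un 2%:R 1 isT; rewrite u0 u1.
  by elim/ord4_ind: (u 2%:R) => //; [left|right].
have c3 : u 3%:R = 2%:R \/ u 3%:R = 3%:R.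
  have := un 3%:R 0 isT; have := un 3%:R 1 isT; rewrite u0 u1.
  by elim/ord4_ind: (u 3%:R) => //; [left|right].
have := un 2%:R 3%:R isT; case: c2 c3 => u2 [] u3; rewrite u2 u3 ?eqxx // => _.
  suff u1' : u = 1%g by rewrite -[s](mulgKV t) -/u u1' mul1g.
  by apply/permP; apply: ord4_ind; rewrite perm1.
suff ut : u = tperm 2%:R 3%:R by move: eu; rewrite ut odd_tperm.
by apply/permP; apply: ord4_ind; rewrite ?u0 ?u1 ?u2 ?u3 permE.
Qed.

Lemma hodge_tr C i j : hodge C j i = hodge C^T i j.
Proof.
pose t : 'S_4 := (tperm 0%R 1%R * tperm 2%:R 3%:R)%g.
have t0 : t 0 = 1 by rewrite permM !permE.
have t1 : t 1 = 0 by rewrite permM !permE.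
have t2 : t 2%:R = 3%:R by rewrite permM !permE.
have t3 : t 3%:R = 2%:R by rewrite permM !permE.
have ot : odd_perm t = false by rewrite odd_permM !odd_tperm.
clearbody t; rewrite !mxE (reindex_inj (mulgI t)); apply: eq_big => [s|s _].
  by rewrite odd_permM ot !permM t0 t1 [X in _ && X]andbC.
by rewrite mxE !permM t2 t3.
Qed.

(** Each right-hand side comes from an even permutation written as a product
    of two transpositions. *)
Lemma hodge_entries C :
  ((hodge C 0 1 = C 2%:R 3%:R) * (hodge C 0 2%:R = C 3%:R 1) * (hodge C 0 3%:R = C 1 2%:R) *
   (hodge C 1 2%:R = C 0 3%:R) * (hodge C 1 3%:R = C 2%:R 0) * (hodge C 2%:R 3%:R = C 0 1))%type.
Proof.
have H (a b c d i0 i1 i2 i3 : 'I_4) : (a == b) = (c == d) ->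
    let t := (tperm a b * tperm c d)%g in
    t 0 = i0 -> t 1 = i1 -> t 2%:R = i2 -> t 3%:R = i3 ->
    hodge C i0 i1 = C i2 i3.
  move=> abcd t <- <- <- <-; apply: hodge_even.
  by rewrite odd_permM !odd_tperm abcd addbb.
do !split.
- by apply: (H 0 0 0 0) => //; rewrite permM !permE.
- by apply: (H 1 2%:R 1 3%:R) => //; rewrite permM !permE.
- by apply: (H 1 3%:R 1 2%:R) => //; rewrite permM !permE.
- by apply: (H 0 1 0 2%:R) => //; rewrite permM !permE.
- by apply: (H 0 1 0 3%:R) => //; rewrite permM !permE.
- by apply: (H 0 2%:R 1 3%:R) => //; rewrite permM !permE.
Qed.

Lemma skew_rules C : C^T = - C ->
  ((C 0 0 = 0) * (C 1 1 = 0) * (C 2%:R 2%:R = 0) * (C 3%:R 3%:R = 0) *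
   (C 1 0 = - C 0 1) * (C 2%:R 0 = - C 0 2%:R) * (C 3%:R 0 = - C 0 3%:R) *
   (C 2%:R 1 = - C 1 2%:R) * (C 3%:R 1 = - C 1 3%:R) * (C 3%:R 2%:R = - C 2%:R 3%:R))%type.
Proof.
move=> Cs; have sk i j : C i j = - C j i by have /matrixP/(_ j i) := Cs; rewrite !mxE.
have sk0 i : C i i = 0 by apply/eqP; move: (sk i i) => /eqP; rewrite eq_sym eqNr.
by do !split.
Qed.

Lemma hodge_skew C : C^T = - C -> (hodge C)^T = - hodge C.
Proof.
move=> Cs; apply/matrixP=> i j; rewrite mxE [RHS]mxE hodge_tr Cs.
by rewrite !mxE -sumrN; apply: eq_bigr => s _; rewrite mxE.
Qed.

(** Up to sign, the product of a skew matrix of size 4 with its dual is its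
    Pfaffian times the identity; this is the polarized form.  It is the
    Clifford relation of the spin representation. *)
Lemma hodge_polar C C' : C^T = - C -> C'^T = - C' ->
  2%:R *: (hodge C *m C' + hodge C' *m C) = (\tr (C *m hodge C'))%:M.
Proof.
move=> Cs Cs'; move: (hodge_entries C) (hodge_entries C').
move: (skew_rules (hodge_skew Cs)) (skew_rules (hodge_skew Cs')).
move: (hodge C) (hodge C') => H H' r1 r1' r2 r2'.
apply/matrixP; apply: ord4_ind; apply: ord4_ind;
  rewrite !mxE /mxtrace !sum4 !mxE !sum4 !r1 !r1' !r2 !r2';
  rewrite !(skew_rules Cs) !(skew_rules Cs') /= ?mulr1n ?mulr0n.
all: ring.
Qed.

(** Duality identifies skew forms with skew bivectors for matrices of
    determinant 1; infinitesimally, for those of trace 0. *)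
Lemma hodge_equivariant A C : \tr A = 0 -> C^T = - C ->
  hodge (A^T *m C + C *m A) = - (A *m hodge C + hodge C *m A^T).
Proof.
move=> A0 Cs; move: A0; rewrite /mxtrace sum4 => A0.
have {A0} A3 : A 3%:R 3%:R = - (A 0 0 + A 1 1 + A 2%:R 2%:R).
  by apply/eqP; rewrite -addr_eq0 addrC A0.
have Xs : (A^T *m C + C *m A)^T = - (A^T *m C + C *m A).
  by rewrite linearD /= !trmx_mul trmxK Cs mulNmx mulmxN opprD addrC.
move: (hodge_entries C) (hodge_entries (A^T *m C + C *m A)).
move: (skew_rules (hodge_skew Cs)) (skew_rules (hodge_skew Xs)).
move: (hodge C) (hodge (A^T *m C + C *m A)) => H H' r1 r1' r2 r2'.
apply/matrixP; apply: ord4_ind; apply: ord4_ind;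
  rewrite ?r1' ?r2' !mxE !sum4 ?mxE ?r1 ?r2 !(skew_rules Cs) ?A3.
all: ring.
Qed.

End Hodge.

(** * The spin representation by block matrices *)

Section SpinMatrices.
Variable F : numFieldType.
Local Notation asT := ('M[F]_(4 + 4) * F^o)%type.
Local Notation mxbr := (sbracket (fun x y : 'M[F]_(4 + 4) => x *m y) (@mxhpart F)).
Variable mu : F.
Implicit Types (A B C X Y D : 'M[F]_4).

Lemma hodge_linear a C C' : hodge (a *: C + C') = a *: hodge C + hodge C'.
Proof.
apply/matrixP=> i j; rewrite !mxE mulr_sumr -big_split; apply: eq_bigr => s _ /=.
by rewrite !mxE.
Qed.

Lemma hodge0 : hodge (0 : 'M[F]_4) = 0.
Proof. by have := hodge_linear (-1) 0 0; rewrite scaler0 addr0 scaleN1r addNr. Qed.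

Lemma hodgeD C C' : hodge (C + C') = hodge C + hodge C'.
Proof. by have := hodge_linear 1 C C'; rewrite !scale1r. Qed.

Lemma hodgeZ a C : hodge (a *: C) = a *: hodge C.
Proof. by have := hodge_linear a C 0; rewrite hodge0 !addr0. Qed.

(** The term with the dual of C is not in the standard representation of
    spe(4): it makes the bracket of two lower left blocks a scalar, hence
    realizes the central charge. *)
Definition spin_mx (a : asT) : 'M[F]_(4 + 4) :=
  block_mx (ulsubmx a.1 + (a.2 : F)%:M)
           (mu *: (ursubmx a.1 + 2%:R *: hodge (dlsubmx a.1)))
           (mu^-1 *: dlsubmx a.1) (drsubmx a.1 + (a.2 : F)%:M).

Lemma spin_mx_linear : linear spin_mx.
Proof.
move=> c [x d] [y d']; rewrite /spin_mx scale_block_mx add_block_mx /=.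
have -> : ulsubmx (c *: x + y) = c *: ulsubmx x + ulsubmx y by apply/matrixP=> i j; rewrite !mxE.
have -> : ursubmx (c *: x + y) = c *: ursubmx x + ursubmx y by apply/matrixP=> i j; rewrite !mxE.
have -> : dlsubmx (c *: x + y) = c *: dlsubmx x + dlsubmx y by apply/matrixP=> i j; rewrite !mxE.
have -> : drsubmx (c *: x + y) = c *: drsubmx x + drsubmx y by apply/matrixP=> i j; rewrite !mxE.
rewrite hodge_linear -[c *: d]/(c * d) raddfD /= -scale_scalar_mx; congr block_mx.
- by rewrite scalerDr addrACA.
- by rewrite !scalerDr !scalerA [c * mu]mulrC mulrAC [mu * c]mulrC addrACA.
- by rewrite scalerDr !scalerA mulrC.
- by rewrite scalerDr addrACA.
Qed.
HB.instance Definition _ := GRing.isLinear.Build F asT 'M[F]_(4 + 4) _ spin_mx spin_mx_linear.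

Lemma spin_mx_blk A B C (d : F) : spin_mx (blk A B C, d) =
  block_mx (A + d%:M) (mu *: (B + 2%:R *: hodge C)) (mu^-1 *: C) (- A^T + d%:M).
Proof. by rewrite /spin_mx /blk /= block_mxKul block_mxKur block_mxKdl block_mxKdr. Qed.

Lemma spin_mx_hpart p (a : asT) : spin_mx (as_hpart p a) = mxhpart p (spin_mx a).
Proof.
case: a => x d; rewrite /mxhpart /spin_mx /as_hpart /mxhpart /=.
rewrite !(block_mxKul, block_mxKur, block_mxKdl, block_mxKdr); case: p => /=;
  rewrite !(block_mxKul, block_mxKur, block_mxKdl, block_mxKdr) //.
  by rewrite raddf0 !addr0.
by rewrite hodge0 !(scaler0, addr0).
Qed.

Hypothesis mu0 : mu != 0.

Lemma spin_mx_br (a b : asT) : in_as a -> in_as b ->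
  spin_mx (as_br a b) = mxbr (spin_mx a) (spin_mx b).
Proof.
move=> /in_asP[A [B [C [d [A0 Bs Cs ->]]]]] /in_asP[A' [B' [C' [d' [A0' Bs' Cs' ->]]]]].
rewrite as_br_blk // !spin_mx_blk mxbr_block.
have P := hodge_polar Cs Cs'.
have P' : 2%:R *: (C *m hodge C' + C' *m hodge C) = (\tr (C *m hodge C'))%:M.
  rewrite -[RHS]tr_scalar_mx -P [RHS]linearZ [in RHS]linearD /= !trmx_mul !hodge_skew //.
  by rewrite Cs Cs' !mulNmx !mulmxN !opprK addrC.
have H := hodge_equivariant A0 Cs'; have H' := hodge_equivariant A0' Cs.
have muV : mu * mu^-1 = 1 by rewrite divff.
have hE : hodge (C *m A' + A'^T *m C - (C' *m A + A^T *m C')) =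
    A *m hodge C' + hodge C' *m A^T - (A' *m hodge C + hodge C *m A'^T).
  rewrite hodgeD -scaleN1r hodgeZ scaleN1r addrC [C' *m A + _]addrC [C *m A' + _]addrC H H'.
  by rewrite opprK.
have tE : (A *m A' - A' *m A + (B *m C' + B' *m C))^T =
    A'^T *m A^T - A^T *m A'^T - C' *m B - C *m B'.
  rewrite !(trmx_add, trmx_opp) !trmx_mul Bs Bs' Cs Cs' !mulNmx; by rewrite addrA.
rewrite hE tE.
congr block_mx.
- rewrite -P !(mulmxDl, mulmxDr, mul_scalar_mx, mul_mx_scalar) -!(scalemxAl, scalemxAr).
  rewrite !(mulmxDl, mulmxDr) -!(scalemxAl, scalemxAr).
  move: (A *m A') (A' *m A) (B *m C') (B' *m C) (hodge C *m C') (hodge C' *m C).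
  by move=> m1 m2 m3 m4 m5 m6; apply/matrixP=> i j; rewrite !mxE; field.
- rewrite !(mulmxDl, mulmxDr, mul_scalar_mx, mul_mx_scalar, mulmxN, mulNmx) -!(scalemxAl, scalemxAr).
  rewrite !(mulmxDl, mulmxDr) -!(scalemxAl, scalemxAr).
  move: (hodge C) (hodge C') => Z Z'.
  move: (A *m B') (B' *m A^T) (A' *m B) (B *m A'^T) (A *m Z') (Z' *m A^T) (A' *m Z) (Z *m A'^T).
  by move=> m1 m2 m3 m4 m5 m6 m7 m8; apply/matrixP=> i j; rewrite !mxE; ring.
- rewrite !(mulmxDl, mulmxDr, mul_scalar_mx, mul_mx_scalar, mulmxN, mulNmx) -!(scalemxAl, scalemxAr).
  move: (C *m A') (A'^T *m C) (C' *m A) (A^T *m C').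
  by move=> m1 m2 m3 m4; apply/matrixP=> i j; rewrite !mxE; ring.
rewrite -P' !(mulmxDl, mulmxDr, mul_scalar_mx, mul_mx_scalar, mulmxN, mulNmx) -!(scalemxAl, scalemxAr).
rewrite !(mulmxDl, mulmxDr) -!(scalemxAl, scalemxAr).
move: (A'^T *m A^T) (A^T *m A'^T) (C' *m B) (C *m B') (C *m hodge C') (C' *m hodge C).
by move=> m1 m2 m3 m4 m5 m6; apply/matrixP=> i j; rewrite !mxE; field.
Qed.

(** The trace of the upper left block is 4 d. *)
Lemma spin_mx_inj (a : asT) : in_as a -> spin_mx a = 0 -> a = 0.
Proof.
move=> /in_asP[A [B [C [d [A0 Bs Cs ->]]]]]; rewrite spin_mx_blk -block_mx0.
case/eq_block_mx=> A1 B1 C1 _.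
have C0 : C = 0.
  by move/eqP: C1; rewrite scaler_eq0 invr_eq0 (negPf mu0) => /eqP.
have B0 : B = 0.
  by move/eqP: B1; rewrite scaler_eq0 (negPf mu0) C0 hodge0 scaler0 addr0 => /eqP.
have d0 : d = 0.
  have := congr1 mxtrace A1; rewrite linearD /= A0 add0r mxtrace_scalar linear0 => /eqP.
  by rewrite mulrn_eq0 => /eqP.
move: A1; rewrite B0 C0 d0 raddf0 addr0 /blk => ->.
by rewrite trmx0 oppr0 block_mx0.
Qed.

Lemma spin_mx_z : spin_mx (as_z F) = 1%:M.
Proof.
rewrite /spin_mx /as_z /=;
have -> : ulsubmx (0 : 'M[F]_(4 + 4)) = 0 by apply/matrixP=> i j; rewrite !mxE.
have -> : ursubmx (0 : 'M[F]_(4 + 4)) = 0 by apply/matrixP=> i j; rewrite !mxE.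
have -> : dlsubmx (0 : 'M[F]_(4 + 4)) = 0 by apply/matrixP=> i j; rewrite !mxE.
have -> : drsubmx (0 : 'M[F]_(4 + 4)) = 0 by apply/matrixP=> i j; rewrite !mxE.
by rewrite hodge0 !scaler0 !add0r scaler0 -scalar_mx_block.
Qed.

End SpinMatrices.

(** * Block matrices as operators on three odd variables *)

(** For a = 0 this is the empty set, and for a = i + 1 the complement of {i};
    together these are the sets of even size, and their complements are those
    of odd size. *)
Definition vset (a : 'I_4) : {set 'I_3} := [set x : 'I_3 | (a != 0) && (x.+1 != a)].

(** The first four basis vectors are even and the last four odd, as in the
    block matrices. *)
Definition bas (p : 'I_(4 + 4)) : {set 'I_3} :=
  match split p with inl a => vset a | inr a => ~: vset a end.

Lemma ord3_ind (P : 'I_3 -> Prop) : P 0 -> P 1 -> P 2%:R -> forall i, P i.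
Proof.
move=> P0 P1 P2 i.
have: i \in [:: 0; 1; 2%:R] by case: i => [[|[|[|]]]].
by rewrite !inE => /or3P[] /eqP->.
Qed.

Lemma set3P (A B : {set 'I_3}) :
  (A == B) = [&& (0 \in A) == (0 \in B), (1 \in A) == (1 \in B) & (2%:R \in A) == (2%:R \in B)].
Proof.
apply/eqP/and3P=> [->//|[/eqP A0 /eqP A1 /eqP A2]].
by apply/setP; apply: ord3_ind.
Qed.

Lemma card3 (A : {set 'I_3}) : #|A| = ((0%R \in A) + (1%R \in A) + (2%:R%R \in A))%N.
Proof.
have E (k l : 'I_3) : val k = val l -> (if k \in A then 1%N else 0%N) = (l \in A).
  by move=> /val_inj->; case: (l \in A).
rewrite -sum1_card big_mkcond !big_ord_recr big_ord0 /= add0n.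
by congr (_ + _ + _)%N; apply: E.
Qed.

Lemma odd_vset a : odd #|vset a| = false.
Proof. by rewrite card3 !inE; elim/ord4_ind: a. Qed.

Lemma odd_vsetC a : odd #|~: vset a| = true.
Proof. by rewrite card3 !inE; elim/ord4_ind: a. Qed.

Lemma vset_inj : injective vset.
Proof.
by move=> a b /eqP; rewrite set3P !inE; elim/ord4_ind: a; elim/ord4_ind: b.
Qed.

Lemma bas_inj : injective bas.
Proof.
move=> p q; rewrite /bas -{2}(splitK p) -{2}(splitK q).
case: (split p) (split q) => a [] b; [move/vset_inj->|..|move/setC_inj/vset_inj->] => //.
  by move/(congr1 (fun A : {set 'I_3} => odd #|A|)); rewrite odd_vset odd_vsetC.
by move/(congr1 (fun A : {set 'I_3} => odd #|A|)); rewrite odd_vset odd_vsetC.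
Qed.

Definition bas_index (S : {set 'I_3}) : 'I_(4 + 4) := odflt (lshift 4 0) [pick p | bas p == S].

Lemma basK : cancel bas bas_index.
Proof.
move=> p; rewrite /bas_index; case: pickP => [r /eqP/bas_inj //|/(_ p)].
by rewrite eqxx.
Qed.

Lemma bas_indexK : cancel bas_index bas.
Proof.
have [g bg gb] : bijective bas.
  apply: inj_card_bij bas_inj _.
  by rewrite -cardsT -powersetT card_powerset cardsT !card_ord.
by move=> S; rewrite -[S]gb basK.
Qed.

Lemma sum_sets (V : nmodType) (f : {set 'I_3} -> V) : \sum_S f S = \sum_p f (bas p).
Proof. by rewrite (reindex bas) //; exists bas_index => ? _; [apply: basK|apply: bas_indexK]. Qed.

Section BlockOperators.
Variable F : numFieldType.
Local Notation glL := (glL F 3).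
Local Notation mx := 'M[F]_(4 + 4).
Local Notation mxbr := (sbracket (fun x y : mx => x *m y) (@mxhpart F)).

(** These signs turn the basis vectors into 1, xi_2 xi_3, xi_3 xi_1, xi_1 xi_2
    and - xi_1 xi_2 xi_3, xi_1, xi_2, xi_3, for which all xi_i have skew
    blocks. *)
Definition bsign (p : 'I_(4 + 4)) : F :=
  match split p with inl a => (-1) ^+ (a == 2%:R) | inr a => (-1) ^+ (a == 0) end.

Lemma bsign2 p : bsign p * bsign p = 1.
Proof. by rewrite /bsign; case: (split p) => a; rewrite -expr2 sqrr_sign. Qed.

Definition blockop (M : mx) : glL :=
  op (fun S T => bsign (bas_index S) * bsign (bas_index T) * M (bas_index S) (bas_index T)).

Lemma entry_blockop M p q : entry (blockop M) (bas p) (bas q) = bsign p * bsign q * M p q.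
Proof. by rewrite entry_op !basK. Qed.

Lemma basP (f g : glL) :
  (forall p q, entry f (bas p) (bas q) = entry g (bas p) (bas q)) -> f = g.
Proof. by move=> fg; apply/entryP=> S T; rewrite -(bas_indexK S) -(bas_indexK T). Qed.

Lemma blockop_linear : linear blockop.
Proof.
move=> a M N; apply: basP => p q; rewrite entry_linear !entry_blockop !mxE; ring.
Qed.
HB.instance Definition _ := GRing.isLinear.Build F mx glL _ blockop blockop_linear.

Lemma blockopM M N : blockop (M *m N) = blockop M *c blockop N.
Proof.
apply: basP => p q; rewrite entry_comp sum_sets entry_blockop mxE mulr_sumr.
apply: eq_bigr => r _; rewrite !entry_blockop; have := bsign2 r.
move: (bsign p) (bsign q) (bsign r) => a b c c2.
have -> : a * c * M p r * (c * b * N r q) = (c * c) * (a * b * (M p r * N r q)) by ring.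
by rewrite c2 mul1r.
Qed.

Lemma blockop1 : blockop 1%:M = \1%VF.
Proof.
apply: basP => p q; rewrite entry_blockop entry_id mxE (inj_eq bas_inj).
by case: eqVneq => [->|_]; rewrite ?mulr0 // mulr1 bsign2.
Qed.

Lemma blockop_inj : injective blockop.
Proof.
move=> M N MN; apply/matrixP=> p q.
have := congr1 (fun f => entry f (bas p) (bas q)) MN; rewrite !entry_blockop.
have b0 r : bsign r != 0.
  by have := oner_neq0 F; rewrite -(bsign2 r) mulf_eq0 orbb.
by apply: mulfI; rewrite mulf_neq0.
Qed.

Lemma gpar_bas p : gpar 3 (bas p) = ~~ (p < 4)%N.
Proof.
rewrite /gpar /bas -{2}(splitK p); case: (split p) => a; rewrite ?odd_vset ?odd_vsetC /= ?ltn_ord //.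
Qed.

Lemma blockop_hpart p M : blockop (mxhpart p M) = hpart (gpar 3) p (blockop M).
Proof.
apply: basP => i j; rewrite [RHS]entry_op !entry_blockop !gpar_bas /mxhpart.
rewrite -(splitK i) -(splitK j); case: (split i) (split j) => a [] b; case: p => /=;
  rewrite ?(block_mxEul, block_mxEur, block_mxEdl, block_mxEdr) ?mxE ?ltn_ord //=
    ?[(4 + _ < 4)%N]ltnNge ?leq_addr /= ?mulr0 //.
Qed.

Lemma blockop_br M N : blockop (mxbr M N) = br (gpar 3) (blockop M) (blockop N).
Proof.
rewrite /br /sbracket linear_sum; apply: eq_bigr => p _; rewrite linear_sum.
by apply: eq_bigr => q _; rewrite linearB linearZ /= !blockopM !blockop_hpart.
Qed.

End BlockOperators.

Section Generators.
Variable F : numFieldType.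

Lemma entry_xi n (i : 'I_n) S T :
  entry (xi F i) S T = if (i \notin T) && (S == i |: T) then (-1) ^+ below i T else 0.
Proof.
rewrite /entry xiE; case: (i \in T) => /=; first by rewrite ffunE.
by rewrite !ffunE /GRing.scale /=; case: (S == _); rewrite ?mulr1 ?mulr0.
Qed.

Lemma entry_pd n (i : 'I_n) S T : entry (pd F i) S T = entry (xi F i) T S.
Proof.
rewrite entry_xi entry_op.
have -> : (i \in T) && (S == T :\ i) = (i \notin S) && (T == i |: S).
  apply/andP/andP=> [[iT /eqP->]|[iS /eqP->]]; first by rewrite !inE eqxx setD1K.
  by rewrite setU11 setU1K.
case: ifP => // /andP[iS /eqP->]; by rewrite belowU // ltnn.
Qed.

(** The odd-even block of the multiplication by xi_i: it maps 1 to xi_i, and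
    the product of the two other variables to xi_1 xi_2 xi_3. *)
Definition cl_skew (i : 'I_3) : 'M[F]_4 :=
  delta_mx (lift ord0 i) 0 - delta_mx 0 (lift ord0 i).

Lemma cl_skew_skew i : (cl_skew i)^T = - cl_skew i.
Proof. by rewrite /cl_skew linearD linearN /= !trmx_delta opprB. Qed.

Lemma bas_lshift a : bas (lshift 4 a) = vset a.
Proof. by rewrite /bas (unsplitK (inl a)). Qed.

Lemma bas_rshift a : bas (rshift 4 a) = ~: vset a.
Proof. by rewrite /bas (unsplitK (inr a)). Qed.

Lemma bsign_lshift a : bsign F (lshift 4 a) = (-1) ^+ (a == 2%:R).
Proof. by rewrite /bsign (unsplitK (inl a)). Qed.

Lemma bsign_rshift a : bsign F (rshift 4 a) = (-1) ^+ (a == 0).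
Proof. by rewrite /bsign (unsplitK (inr a)). Qed.

Definition bas_rules := (bas_lshift, bas_rshift, bsign_lshift, bsign_rshift).

(** Both blocks are read off from the action of xi_i on monomials; the even-
    odd block is the Levi-Civita symbol, which is dual to the odd-even block. *)
Lemma xi_block i : xi F i = blockop (block_mx 0 (hodge (cl_skew i)) (cl_skew i) 0).
Proof.
have xo p q : gpar 3 (bas p) (+) gpar 3 (bas q) != true -> entry (xi F i) (bas p) (bas q) = 0.
  by have /homogP := xi_homog F i; apply.
apply: basP => p q; rewrite entry_blockop.
rewrite -(splitK p) -(splitK q); case: (split p) (split q) => a [] c /=.
- by rewrite block_mxEul mxE mulr0 xo // !bas_rules /gpar !odd_vset.
- have r := hodge_entries (cl_skew i); have r' := skew_rules (hodge_skew (cl_skew_skew i)).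
  rewrite block_mxEur entry_xi !bas_rules set3P /below card3 !inE.
  move: r r'; elim/ord3_ind: i {xo} => r r';
  elim/ord4_ind: a; elim/ord4_ind: c;
  rewrite ?r' ?r ?mxE /= ?expr0 ?expr1 ?expr2; ring.
- rewrite block_mxEdl entry_xi !bas_rules set3P /below card3 !inE.
  elim/ord3_ind: i {xo}; elim/ord4_ind: a; elim/ord4_ind: c; rewrite !mxE /= ?expr0 ?expr1; ring.
by rewrite block_mxEdr mxE mulr0 xo // !bas_rules /gpar !odd_vsetC.
Qed.

(** The derivation is the transpose of the multiplication in the basis of
    monomials, and the basis change is a diagonal matrix of signs. *)
Lemma pd_block i : pd F i = blockop (block_mx 0 (- cl_skew i) (- hodge (cl_skew i)) 0).
Proof.
apply: basP => p q; rewrite entry_pd xi_block !entry_blockop [bsign F q * _]mulrC; congr (_ * _).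
have -> : block_mx 0 (- cl_skew i) (- hodge (cl_skew i)) 0 =
    (block_mx 0 (hodge (cl_skew i)) (cl_skew i) 0)^T.
  by rewrite tr_block_mx !trmx0 hodge_skew ?cl_skew_skew.
by rewrite [RHS]mxE.
Qed.

End Generators.

(** * The action of the central extension on three odd variables *)

Lemma card_layer (T : finType) k : #|[pred A : {set T} | #|A| == k]| = 'C(#|T|, k).
Proof.
rewrite -cardsT -cards_draws -[LHS]cardsE; apply: eq_card => A.
by rewrite !inE /= subsetT.
Qed.

Section SpinRepresentation.
Variable F : numFieldType.
Local Notation asT := ('M[F]_(4 + 4) * F^o)%type.
Local Notation glL := (glL F 3).
Local Notation br := (br (gpar 3)).
Local Notation K := ('I_3 + 'I_3)%type.
Local Notation cgen := (@clifford_gen F 3).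
Local Notation mspan := (mspan cgen).
Implicit Types (A B C : 'M[F]_4).
Let fam := clifford_gen_family F 3.
Let card := clifford_gen_card 3.

Variable mu : F.
Hypothesis mu2 : 2%:R * mu ^+ 2 = 1.

Let mu0 : mu != 0.
Proof. by apply: contraTneq isT => m0; move/eqP: mu2; rewrite m0 expr0n mulr0 eq_sym oner_eq0. Qed.

Let two0 : 2%:R != 0 :> F. Proof. by rewrite pnatr_eq0. Qed.

(** With 2 mu^2 = 1 the image of a skew matrix is, up to scaling, of the form
    found in [xi_block], in which the two off-diagonal blocks are dual to each
    other. *)
Definition spin : {linear asT -> glL} := (@blockop F) \o spin_mx mu.

Lemma as_A_blk A : as_A A = (blk A 0 0, 0). Proof. by []. Qed.
Lemma as_B_blk B : as_B B = (blk 0 B 0, 0). Proof. by rewrite /blk trmx0 oppr0. Qed.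
Lemma as_C_blk C : as_C C = (blk 0 0 C, 0). Proof. by rewrite /blk trmx0 oppr0. Qed.

Lemma as_A_linear : linear (@as_A F).
Proof.
move=> a A A'; congr (_, _) => /=; last by rewrite scaler0 addr0.
by rewrite scale_block_mx add_block_mx linearP opprD scalerN !scaler0 !addr0.
Qed.
HB.instance Definition _ := GRing.isLinear.Build F 'M[F]_4 asT _ (@as_A F) as_A_linear.

Lemma as_B_linear : linear (@as_B F).
Proof.
move=> a B B'; congr (_, _) => /=; last by rewrite scaler0 addr0.
by rewrite scale_block_mx add_block_mx !scaler0 !addr0.
Qed.
HB.instance Definition _ := GRing.isLinear.Build F 'M[F]_4 asT _ (@as_B F) as_B_linear.

Lemma as_C_linear : linear (@as_C F).
Proof.
move=> a C C'; congr (_, _) => /=; last by rewrite scaler0 addr0.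
by rewrite scale_block_mx add_block_mx !scaler0 !addr0.
Qed.
HB.instance Definition _ := GRing.isLinear.Build F 'M[F]_4 asT _ (@as_C F) as_C_linear.

Lemma spin_A A : spin (as_A A) = blockop (block_mx A 0 0 (- A^T)).
Proof.
by rewrite /spin /= as_A_blk spin_mx_blk raddf0 hodge0 !(scaler0, addr0).
Qed.

Lemma spin_B B : spin (as_B B) = blockop (block_mx 0 (mu *: B) 0 0).
Proof.
by rewrite /spin /= as_B_blk spin_mx_blk raddf0 hodge0 trmx0 oppr0 !(scaler0, addr0).
Qed.

Lemma spin_C C : spin (as_C C) = blockop (block_mx 0 (mu *: (2%:R *: hodge C)) (mu^-1 *: C) 0).
Proof.
by rewrite /spin /= as_C_blk spin_mx_blk raddf0 trmx0 oppr0 !(scaler0, addr0, add0r).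
Qed.

Lemma spin_z : spin (as_z F) = \1%VF.
Proof. by rewrite /spin /= spin_mx_z blockop1. Qed.

Lemma hodgeK C : C^T = - C -> hodge (hodge C) = C.
Proof.
move=> Cs; have s := hodge_skew Cs.
have r := hodge_entries (hodge C); have r' := skew_rules (hodge_skew s).
have q := hodge_entries C; have q' := skew_rules s; have c := skew_rules Cs.
by apply/matrixP; apply: ord4_ind; apply: ord4_ind; rewrite ?r' ?r ?q' ?q ?c ?opprK ?oppr0.
Qed.

Lemma xi_spin i : xi F i = spin (as_C (mu *: cl_skew F i)).
Proof.
rewrite spin_C hodgeZ !scalerA mulVf // scale1r xi_block.
by rewrite -mulrA mulrCA -expr2 mu2 scale1r.
Qed.

Lemma pd_spin i : pd F i = spin (as_C (- mu *: hodge (cl_skew F i))).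
Proof.
rewrite spin_C hodgeZ hodgeK ?cl_skew_skew // !scalerA !mulrN mulVf // scaleN1r pd_block.
by rewrite -mulrA mulrCA -expr2 mu2 scaleN1r.
Qed.

Lemma skew_scale a C : C^T = - C -> (a *: C)^T = - (a *: C).
Proof. by move=> Cs; rewrite linearZ /= Cs scalerN. Qed.

Lemma skew_add C C' : C^T = - C -> C'^T = - C' -> (C + C')^T = - (C + C').
Proof. by move=> Cs Cs'; rewrite linearD /= Cs Cs' opprD. Qed.

Lemma clgen_spin s : exists2 C, C^T = - C & clgen F s = spin (as_C C).
Proof.
case: s => i /=.
  by exists (mu *: cl_skew F i); [apply/skew_scale/cl_skew_skew|apply: xi_spin].
exists (- mu *: hodge (cl_skew F i)); last exact: pd_spin.
exact/skew_scale/hodge_skew/cl_skew_skew.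
Qed.

Lemma clifford_gen_spin k : exists2 C, C^T = - C & cgen k = spin (as_C C).
Proof.
have [C Cs CE] := clgen_spin (inl (gen_index k)); have [C' Cs' CE'] := clgen_spin (inr (gen_index k)).
exists (C + gen_square F k *: C'); first exact: skew_add (skew_scale _ _).
by rewrite /clifford_gen (CE : xi F _ = _) (CE' : pd F _ = _) !(linearD, linearZ).
Qed.

(** The six skew matrices attached to the xi_i and to the derivations form a
    basis of the space of skew matrices. *)
Lemma skew_decomp C : C^T = - C ->
  C = \sum_i (C (lift ord0 i) 0 *: cl_skew F i + hodge C (lift ord0 i) 0 *: hodge (cl_skew F i)).
Proof.
move=> Cs; have c := skew_rules Cs; have q := hodge_entries C; have q' := skew_rules (hodge_skew Cs).
pose i1 : 'I_3 := 1; pose i2 : 'I_3 := 2%:R.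
have sum3 (V : nmodType) (f : 'I_3 -> V) : \sum_i f i = f 0 + f i1 + f i2.
  by rewrite !big_ord_recr big_ord0 /= add0r; congr (f _ + f _ + f _); apply: val_inj.
rewrite sum3.
have l0 : lift ord0 (0 : 'I_3) = 1 :> 'I_4 by apply: val_inj.
have l1 : lift ord0 i1 = 2%:R :> 'I_4 by apply: val_inj.
have l2 : lift ord0 i2 = 3%:R :> 'I_4 by apply: val_inj.
rewrite l0 l1 l2.
have e i := hodge_entries (cl_skew F i).
have e' i := skew_rules (hodge_skew (cl_skew_skew F i)).
move: (e 0) (e i1) (e i2) (e' 0) (e' i1) (e' i2) q q'.
move: (hodge (cl_skew F 0)) (hodge (cl_skew F i1)) (hodge (cl_skew F i2)) (hodge C).
move=> H0 H1 H2 H r0 r1 r2 s0 s1 s2 q q'.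
apply/matrixP; apply: ord4_ind; apply: ord4_ind;
  rewrite !mxE ?s0 ?s1 ?s2 ?r0 ?r1 ?r2 ?mxE /= ?q' ?q ?c; ring.
Qed.

Lemma hei_spin f : f \in hei_even F 3 <->
  exists C d, C^T = - C /\ f = spin (as_C C + d *: as_z F).
Proof.
split.
  move: f; apply: span_ind => [|a f g [C [d [Cs ->]]] [C' [d' [Cs' ->]]]|f].
  - by exists 0, 0; rewrite !linear0 ?oppr0 ?scale0r addr0 linear0.
  - exists (a *: C + C'), (a * d + d'); split; first exact: skew_add (skew_scale _ _) _.
    rewrite -linearP; congr (spin _); rewrite linearP scalerDr scalerDl scalerA.
    by rewrite addrACA.
  have gens s : exists C d, C^T = - C /\ clgen F s = spin (as_C C + d *: as_z F).
    by have [C Cs ->] := clgen_spin s; exists C, 0; rewrite scale0r addr0.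
  rewrite inE mem_cat => /or3P[/eqP->|/mapP[i _ ->]|/mapP[i _ ->]].
  - by exists 0, 1; rewrite !linear0 ?oppr0 ?scale1r add0r spin_z.
  - exact: gens (inl i).
  - exact: gens (inr i).
move=> [C [d [Cs ->]]]; pose g : {linear 'M[F]_4 -> glL} := spin \o @as_C F.
have -> : spin (as_C C + d *: as_z F) = g C + d *: \1%VF.
  by rewrite (linearD spin) (linearZZ spin) spin_z.
rewrite rpredD ?rpredZ ?hei_id //.
have gZ a M : g (a *: M) = a *: g M by exact: linearZ.
have gD M N : g (M + N) = g M + g N by exact: linearD.
have gY i : g (cl_skew F i) \in hei_even F 3.
  rewrite -[cl_skew F i]scale1r -(mulVf mu0) -scalerA gZ rpredZ //.
  by rewrite -[g _]xi_spin; apply: (hei_clgen F (inl i)).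
have gH i : g (hodge (cl_skew F i)) \in hei_even F 3.
  rewrite -[hodge _]scale1r -(mulVf mu0) -mulrNN -scalerA gZ rpredZ //.
  by rewrite -[g _]pd_spin; apply: (hei_clgen F (inr i)).
rewrite (skew_decomp Cs) (linear_sum g) rpred_sum // => i _.
by rewrite gD !gZ; apply: rpredD; apply: rpredZ; [apply: gY|apply: gH].
Qed.

Lemma spin_br a b : in_as a -> in_as b -> spin (as_br a b) = br (spin a) (spin b).
Proof.
move=> aas bas; apply: etrans (congr1 (@blockop F) (spin_mx_br mu0 aas bas)) _.
exact: blockop_br.
Qed.

Lemma spin_hpart p a : spin (as_hpart p a) = hpart (gpar 3) p (spin a).
Proof.
apply: etrans (congr1 (@blockop F) (spin_mx_hpart mu p a)) _.
exact: blockop_hpart.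
Qed.

Lemma spin_inj a : in_as a -> spin a = 0 -> a = 0.
Proof.
move=> aas a0; apply: (spin_mx_inj mu0 aas); apply: (@blockop_inj F).
have b0 : blockop (0 : 'M[F]_(4 + 4)) = 0 by exact: linear0.
rewrite b0.
exact: a0.
Qed.

(** The factors mu and 1 / mu cancel in products of two elements of hei. *)
Lemma comp_spin_C C C' : spin (as_C C) *c spin (as_C C') =
  blockop (block_mx (2%:R *: (hodge C *m C')) 0 0 (2%:R *: (C *m hodge C'))).
Proof.
rewrite !spin_C -blockopM mulmx_block !(mul0mx, mulmx0, addr0, add0r).
by rewrite -!(scalemxAl, scalemxAr) !scalerA mulrAC mulfV // mul1r mulrA mulVf // mul1r.
Qed.

Definition trF (A : 'M[F]_4) : F^o := \tr A.
Lemma trF_linear : linear trF. Proof. by move=> a A B; rewrite /trF linearP. Qed.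
HB.instance Definition _ := GRing.isLinear.Build F 'M[F]_4 F^o _ trF trF_linear.

Definition o6_image : {vspace glL} :=
  (linfun (spin \o @as_A F) @: lker (linfun trF))%VS.

Lemma o6_imageP f : f \in o6_image <-> exists2 A, \tr A = 0 & f = spin (as_A A).
Proof.
split=> [/memv_imgP[A + ->]|[A A0 ->]].
  by rewrite memv_ker lfunE /= => /eqP A0; exists A; rewrite ?lfunE.
apply/memv_imgP; exists A; last by rewrite lfunE.
by rewrite memv_ker lfunE /= /trF A0 eqxx.
Qed.

(** For anticommuting elements the Clifford relation says that the two
    diagonal blocks of the product are opposite transposes of each other and
    have trace 0. *)
Lemma o6_sub_image : (altpow F 3 2 <= o6_image)%VS.
Proof.
rewrite altpow_mspan; apply: mspan_sub => A /cards2P[k [l [kl ->]]].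
apply: propto_mem (comp_gen_propto fam kl) _.
case: fam => _ _ _ /(_ _ _ kl).
have [C Cs ->] := clifford_gen_spin k; have [C' Cs' ->] := clifford_gen_spin l.
rewrite !comp_spin_C -linearN => /blockop_inj; rewrite opp_block_mx !oppr0.
case/eq_block_mx=> e1 _ _ e2; apply/o6_imageP; exists (2%:R *: (hodge C *m C')).
  have P := hodge_polar Cs Cs'.
  have t0 : (\tr (C *m hodge C'))%:M = 0 :> 'M[F]_4.
    by rewrite -P scalerDr e1 addNr.
  have {t0} t0 : \tr (C *m hodge C') = 0.
    by have := congr1 (fun M : 'M[F]_4 => M 0 0) t0; rewrite !mxE eqxx mulr1n.
  have := congr1 (@mxtrace F 4) e1; rewrite linearN !linearZ /= [\tr (hodge C' *m C)]mxtrace_mulC t0.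
  by rewrite mulr0 oppr0.
rewrite spin_A; congr (blockop (block_mx _ _ _ _)).
rewrite linearZ /= trmx_mul hodge_skew // Cs' mulNmx mulmxN opprK e2; congr (- _).
Qed.

(** One inclusion is [o6_sub_image]; both spaces have dimension 15. *)
Lemma o6_spin f : f \in altpow F 3 2 <-> exists2 A, \tr A = 0 & f = spin (as_A A).
Proof.
rewrite -o6_imageP; suff -> : altpow F 3 2 = o6_image by [].
apply/eqP; rewrite eqEdim o6_sub_image altpow_mspan (dim_mspan fam card).
rewrite card_layer card_sum !card_ord -[binomial _ _]/15%N.
have e2 := limg_ker_dim (linfun (spin \o @as_A F)) (lker (linfun trF)).
have e1 := limg_ker_dim (linfun trF) fullv; rewrite capfv dimvf dim_matrix in e1.
(* The trace is a nonzero form, so its kernel has dimension 15. *)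
have i1 : (0 < \dim (limg (linfun trF)))%N.
  rewrite lt0n dimv_eq0; apply/eqP=> z.
  have : linfun trF 1%:M \in limg (linfun trF) by apply/memv_img/memvf.
  by rewrite z memv0 lfunE /= /trF mxtrace_scalar pnatr_eq0.
rewrite /o6_image; move: e1 e2 i1.
move: (\dim (_ @: lker _)) (\dim (_ :&: _)) (\dim (lker _)) (\dim (limg _)); lia.
Qed.

Definition antisym (B : 'M[F]_4) : 'M[F]_4 := B - B^T.
Lemma antisym_linear : linear antisym.
Proof. by move=> a B B'; rewrite /antisym linearP /= opprD scalerBr addrACA. Qed.
HB.instance Definition _ := GRing.isLinear.Build F 'M[F]_4 'M[F]_4 _ antisym antisym_linear.

Definition sym_space : {vspace 'M[F]_4} := lker (linfun antisym).

Lemma mem_sym B : (B \in sym_space) = (B^T == B).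
Proof. by rewrite memv_ker lfunE /= subr_eq0 eq_sym. Qed.

Definition sym_unit (i j : 'I_4) : 'M[F]_4 := delta_mx i j + delta_mx j i.

Lemma sym_unitT i j : (sym_unit i j)^T = sym_unit i j.
Proof. by rewrite /sym_unit linearD /= !trmx_delta addrC. Qed.

Lemma sym_unitC i j : sym_unit i j = sym_unit j i.
Proof. exact: addrC. Qed.

Lemma sym_decomp B : B^T = B -> B = 2%:R^-1 *: \sum_i \sum_j B i j *: sym_unit i j.
Proof.
move=> Bs; have E : \sum_i \sum_j B i j *: sym_unit i j = B + B^T.
  transitivity (\sum_i \sum_j B i j *: delta_mx i j + \sum_i \sum_j B i j *: delta_mx j i).
    rewrite -big_split; apply: eq_bigr => i _; rewrite -big_split.
    by apply: eq_bigr => j _; rewrite scalerDr.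
  rewrite -matrix_sum_delta; congr (_ + _); rewrite [in RHS](matrix_sum_delta B) linear_sum.
  apply: eq_bigr => i _; rewrite linear_sum; apply: eq_bigr => j _ /=.
  by rewrite linearZ /= trmx_delta.
by rewrite E Bs -mulr2n -scaler_nat scalerA mulVf ?scale1r.
Qed.

Definition sym_pairs : seq ('I_4 * 'I_4) :=
  [:: (0, 0); (0, 1); (0, 2%:R); (0, 3%:R); (1, 1); (1, 2%:R); (1, 3%:R);
      (2%:R, 2%:R); (2%:R, 3%:R); (3%:R, 3%:R)].

(** The symmetric matrices are spanned by 10 elements, and the skew ones, the
    image of B -> B - B^T, by 6; since the dimensions add up to 16, both
    bounds are sharp. *)
Lemma dim_sym : \dim sym_space = 10%N.
Proof.
apply/eqP; rewrite eqn_leq; apply/andP; split.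
  set X := [seq sym_unit p.1 p.2 | p <- sym_pairs].
  apply: leq_trans (dim_span X); apply: dimvS; apply/subvP=> B; rewrite mem_sym => /eqP Bs.
  rewrite (sym_decomp Bs) rpredZ // rpred_sum // => i _; rewrite rpred_sum // => j _.
  rewrite rpredZ //; have : ((i, j) \in sym_pairs) || ((j, i) \in sym_pairs).
    by elim/ord4_ind: i; elim/ord4_ind: j.
  case/orP=> ij; [|rewrite sym_unitC]; apply: memv_span.
    exact: (map_f (fun p => sym_unit p.1 p.2) ij).
  exact: (map_f (fun p => sym_unit p.1 p.2) ij).
have e := limg_ker_dim (linfun antisym) fullv; rewrite capfv dimvf dim_matrix in e.
set X := [seq cl_skew F i | i : 'I_3] ++ [seq hodge (cl_skew F i) | i : 'I_3].
have sX : size X = 6%N by rewrite size_cat !size_map -!enumT size_enum_ord.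
have skX : (limg (linfun antisym) <= <<X>>)%VS.
  apply/subvP=> _ /memv_imgP[B _ ->]; rewrite lfunE /=.
  have Cs : (antisym B)^T = - antisym B by rewrite /antisym linearB /= trmxK opprB.
  rewrite (skew_decomp Cs) rpred_sum // => i _; rewrite rpredD // rpredZ // memv_span // mem_cat.
    by rewrite (codom_f (fun i => cl_skew F i)).
  by rewrite orbC (codom_f (fun i => hodge (cl_skew F i))).
have := leq_trans (dimvS skX) (dim_span X); rewrite sX; move: e; rewrite /sym_space.
move: (\dim (limg _)) (\dim (lker _)); lia.
Qed.

Definition W_image : {vspace glL} := (linfun (spin \o @as_B F) @: sym_space)%VS.

Lemma W_imageP f : f \in W_image <-> exists2 B, B^T = B & f = spin (as_B B).
Proof.
split=> [/memv_imgP[B + ->]|[B Bs ->]].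
  by rewrite mem_sym => /eqP Bs; exists B; rewrite ?lfunE.
by apply/memv_imgP; exists B; rewrite ?lfunE // mem_sym Bs.
Qed.

Lemma as_B_in B : B^T = B -> in_as (as_B B).
Proof.
move=> Bs; apply/in_asP; exists 0, B, 0, 0; rewrite as_B_blk !linear0; split=> //.
Qed.

Lemma as_A_in A : \tr A = 0 -> in_as (as_A A).
Proof.
move=> A0; apply/in_asP; exists A, 0, 0, 0; rewrite as_A_blk !linear0; split=> //.
Qed.

Lemma dim_W : \dim W_image = 10%N.
Proof.
rewrite limg_dim_eq ?dim_sym //; apply/eqP; rewrite -subv0; apply/subvP=> B.
rewrite memv_cap mem_sym memv_ker lfunE memv0 => /andP[/eqP Bs /eqP /= s0].
have := spin_inj (as_B_in Bs) s0 => /(congr1 fst) /= /eqP.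
by rewrite -block_mx0 => /eqP/eq_block_mx[_ -> _ _].
Qed.

Lemma as_br_AB A B : B^T = B -> as_br (as_A A) (as_B B) = as_B (A *m B + B *m A^T).
Proof.
move=> Bs; rewrite as_A_blk !as_B_blk as_br_blk ?linear0 ?oppr0 //.
by rewrite !(mul0mx, mulmx0, addr0, subr0, linear0).
Qed.

Lemma altpow3_stable f g : f \in altpow F 3 2 -> g \in altpow F 3 3 -> br f g \in altpow F 3 3.
Proof.
rewrite !altpow_mspan => fL gL; apply: (br_mspan fam card fL gL) => A B /= /eqP A2 /eqP B3 o.
apply: mono_mspan => /=; have := card_symd A B; rewrite A2 B3.
have := subset_leq_card (subsetIl A B); rewrite A2.
by move: o; case: #|A :&: B| => [|[|[|?]]] //= _ _; rewrite addn2 => -[->].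
Qed.

Lemma pd3_altpow : \big[@comp_lfun F _ _ _ / \1%VF]_(i < 3) pd F i \in altpow F 3 3.
Proof.
have : altprod (fun i : 'I_3 => clgen F ([ffun i => inr i] i : K)) \in altpow F 3 3.
  by apply: memv_span; apply: (map_f (fun t : {ffun 'I_3 -> K} => altprod (fun i => clgen F (t i))));
    rewrite mem_enum.
have -> : altprod (fun i : 'I_3 => clgen F ([ffun i => inr i] i : K)) = altprod (fun i => pd F i).
  by apply: eq_bigr => s _; congr (_ *: _); apply: eq_bigr => i _; rewrite ffunE.
rewrite altprod_anticomm => [H|i i' _]; last by apply/eqP; rewrite -addr_eq0 pd_pd.
have f0 : (3`!)%:R != 0 :> F by rewrite pnatr_eq0.
by rewrite -[X in X \in _]scale1r -(mulVf f0) -scalerA rpredZ.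
Qed.

(** The product of the three derivations only sees the full monomial, which it
    sends to a multiple of 1; so it is, up to a scalar, the symmetric matrix
    unit of index (0, 0). *)
Lemma pd3E : propto (\big[@comp_lfun F _ _ _ / \1%VF]_(i < 3) pd F i)
  (blockop (block_mx 0 (delta_mx 0 0) 0 0)).
Proof.
rewrite !big_ord_recl big_ord0 comp_lfun1r.
set i0 : 'I_3 := ord0; set i1 : 'I_3 := lift _ _; set i2 : 'I_3 := lift _ _.
have [s s0 sE] : exists2 s : F, s != 0 & forall S : {set 'I_3},
    (pd F i0 *c (pd F i1 *c pd F i2)) (bvec F S) = if S == setT then s *: bvec F set0 else 0.
  exists ((-1) ^+ below i2 setT * (-1) ^+ below i1 (setT :\ i2) *
          (-1) ^+ below i0 (setT :\ i2 :\ i1)); first by rewrite !mulf_neq0 ?signr_eq0.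
  move=> S; rewrite !comp_lfunE pdE.
  have [A2|A2] := ifPn; last first.
    by rewrite !linear0; case: eqP => // E; rewrite E inE in A2.
  rewrite !linearZ /= pdE; have [|A1] := ifPn; last first.
    rewrite !linear0 ?scaler0; case: eqP => // E; move: A1; rewrite E !inE //.
  rewrite !inE => /andP[_ A1]; rewrite linearZ /= pdE; have [|A0] := ifPn; last first.
    rewrite !scaler0; case: eqP => // E; move: A0; rewrite E !inE //.
  rewrite !inE => /and3P[_ _ A0].
  have -> : S = setT.
    have e0 : (0 : 'I_3) = i0 by apply: val_inj.
    have e1 : (1 : 'I_3) = i1 by apply: val_inj.
    have e2 : (2%:R : 'I_3) = i2 by apply: val_inj.
    by apply/eqP; rewrite set3P !inE e2 e1 e0 A0 A1 A2.
  rewrite eqxx !scalerA; congr (_ *: bvec F _).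
  by apply/eqP; rewrite set3P !inE.
(* The scalar corrects the signs of the basis vectors 1 and xi_1 xi_2 xi_3. *)
exists (s * bsign F (lshift 4 0) * bsign F (rshift 4 0)).
  by rewrite !mulf_neq0 // !bas_rules signr_eq0.
apply: basP => p q; rewrite /entry [in LHS]sE scale_lfunE ffunE /GRing.scale /=.
rewrite -[blockop _ _ _]/(entry _ _ _) entry_blockop -(splitK p) -(splitK q).
case: (split p) (split q) => a [] c /=;
  rewrite ?(block_mxEul, block_mxEur, block_mxEdl, block_mxEdr) ?mxE !bas_rules set3P !inE;
  elim/ord4_ind: a; elim/ord4_ind: c; rewrite /= ?ffunE ?set3P ?inE /= ?expr0 ?expr1 /GRing.scale /=; ring.
Qed.

(** The matrix unit of index (0, 0) is the image of the product of the three
    derivations; acting with the matrix units of index (i, 0) and then (j, 0)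
    of sl(4) yields all symmetric matrix units. *)
Lemma sym_unit_altpow i j : spin (as_B (sym_unit i j)) \in altpow F 3 3.
Proof.
have [g gE] : exists g : {linear 'M[F]_4 -> glL}, forall B, g B = spin (as_B B).
  by exists (spin \o @as_B F).
have half B : g (2%:R *: B) \in altpow F 3 3 -> g B \in altpow F 3 3.
  by rewrite linearZ => H; rewrite -[g B]scale1r -(mulVf two0) -scalerA rpredZ.
have h00 : g (sym_unit 0 0) \in altpow F 3 3.
  have /propto_mem/(_ pd3_altpow) H := pd3E.
  have bE : g (delta_mx 0 0) = mu *: blockop (block_mx 0 (delta_mx 0 0) 0 0).
    rewrite gE spin_B -(linearZZ (@blockop F)); congr blockop.
    by rewrite scale_block_mx !scaler0.
  by rewrite /sym_unit linearD /= bE rpredD ?rpredZ.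
have step k l B : k != l -> B^T = B -> g B \in altpow F 3 3 ->
    g (delta_mx k l *m B + B *m delta_mx l k) \in altpow F 3 3.
  rewrite !gE => kl Bs BL; rewrite -[delta_mx l k]trmx_delta -as_br_AB //.
  have A0 : \tr (delta_mx k l : 'M[F]_4) = 0.
    rewrite /mxtrace big1 // => x _; rewrite mxE; case: eqVneq => //= ->.
    by rewrite (negPf kl).
  rewrite (spin_br (as_A_in A0) (as_B_in Bs)).
  by apply: altpow3_stable BL; apply/(o6_spin); exists (delta_mx k l).
have hi0 k : k != 0 -> g (sym_unit k 0) \in altpow F 3 3.
  move=> k0; have := step k 0 _ k0 (sym_unitT 0 0) h00.
  rewrite {1 2}/sym_unit mulmxDr mulmxDl !mul_delta_mx => H; apply: half.
  by rewrite scaler_nat mulr2n /sym_unit addrACA.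
rewrite -gE; have [->|i0] := eqVneq i 0.
  by have [->|j0] := eqVneq j 0; [exact: h00|rewrite sym_unitC; apply: hi0].
have [->|j0] := eqVneq j 0; first exact: hi0.
have := step j 0 _ j0 (sym_unitT i 0) (hi0 _ i0).
rewrite {1 2}/sym_unit mulmxDr mulmxDl !mul_delta_mx !mul_delta_mx_cond.
by rewrite eq_sym (negPf i0) !mulr0n add0r addr0 addrC.
Qed.

Lemma W_sub_altpow : (W_image <= altpow F 3 3)%VS.
Proof.
apply/subvP=> f /W_imageP[B Bs ->].
have [g gE] : exists g : {linear 'M[F]_4 -> glL}, forall B, g B = spin (as_B B).
  by exists (spin \o @as_B F).
rewrite -gE (sym_decomp Bs) linearZ rpredZ // linear_sum rpred_sum // => i _.
rewrite linear_sum rpred_sum // => j _.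
by rewrite linearZ rpredZ // gE; apply: sym_unit_altpow.
Qed.

Lemma W_stable f w : f \in altpow F 3 2 -> w \in W_image -> br f w \in W_image.
Proof.
move=> /(o6_spin)[A A0 ->] /W_imageP[B Bs ->]; apply/W_imageP.
exists (A *m B + B *m A^T); first by rewrite linearD /= !trmx_mul trmxK Bs addrC.
by rewrite -spin_br ?as_br_AB //; [apply: as_A_in|apply: as_B_in].
Qed.

(** If U were a stable subspace strictly between 0 and W, then by
    [stable_cubics] W would contain all monomials of degree 3, which span a
    space of dimension 20. *)
Lemma W_cubic_component : is_cubic_component W_image.
Proof.
split; [exact: W_sub_altpow|exact: dim_W|exact: W_stable|].
move=> U UW Uo; have [->|U0] := eqVneq U 0%VS; first by left.
have [->|WU] := eqVneq W_image U; first by right.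
have W3 : (W_image <= mspan (fun A : {set K} => (A \subset [set: K]) && (#|A| == 3%N)))%VS.
  apply: subv_trans W_sub_altpow _; rewrite altpow_mspan; apply: mspan_sub => A A3.
  by apply: mono_mspan; rewrite subsetT.
have H := stable_cubics fam card (o6_stable_swap W_stable) (o6_stable_swap Uo) UW U0 WU W3.
have : (mspan [pred A : {set K} | #|A| == 3%N] <= W_image)%VS.
  by apply: mspan_sub => A /eqP A3; apply: H; rewrite ?subsetT.
move/dimvS; rewrite dim_W (dim_mspan fam card) card_layer card_sum !card_ord.
by rewrite -[binomial _ _]/20%N.
Qed.

Theorem as_image_exists : exists L : {vspace glL}, is_as_image L.
Proof.
exists (altpow F 3 2 + W_image + hei_even F 3)%VS, spin, W_image; split; split.
- move=> f; split=> [/memv_addP[g /memv_addP[x xo [y yW ->]] [z zh ->]]|[a]].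
    have [A A0 ->] := (o6_spin x).1 xo; have [B Bs ->] := (W_imageP y).1 yW.
    have [C [d [Cs ->]]] := (hei_spin z).1 zh.
    exists (blk A B C, d); first by apply/in_asP; exists A, B, C, d.
    by rewrite as_decomp -[in RHS]addrA !(linearD spin).
  case/in_asP=> A [B [C [d [A0 Bs Cs ->]]]] ->.
  rewrite as_decomp -addrA !(linearD spin); apply: memv_add; last first.
    by rewrite -(linearD spin); apply/(hei_spin); exists C, d.
  apply: memv_add; first by apply/(o6_spin); exists A.
  by apply/W_imageP; exists B.
- exact: spin_inj.
- by move=> p a _; apply: spin_hpart.
- exact: spin_br.
- exact: spin_z.
- exact: W_cubic_component.
- exact: o6_spin.
- exact: W_imageP.
- exact: hei_spin.
Qed.

End SpinRepresentation.

From mathcomp Require Import reals complex.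

Theorem theorem3p1 (R : realType) :
  [/\ forall n : nat, (2 <= n)%N -> n <> 3%N ->
        maximal_subsuperalgebra (gpar n) (g_even R[i] n)
          (sl R[i] (gpar n)),
      (exists L : {vspace glL R[i] 3}, is_as_image L) /\
      (forall L : {vspace glL R[i] 3}, is_as_image L ->
        [/\ (g_even R[i] 3 <= L)%VS, (L <= sl R[i] (gpar 3))%VS &
            maximal_subsuperalgebra (gpar 3) L (sl R[i] (gpar 3))])
    & forall n : nat, (2 < n.+1)%N ->
        maximal_subsuperalgebra (gpar n.+1) (g_odd R[i] n)
          (sq (gpar n.+1) (J_theta R[i] n))].
Proof.
split; [exact: g_even_maximal| |exact: g_odd_maximal].
split; last exact: as_image_maximal.
(* The scalar mu of the spin representation satisfies 2 mu^2 = 1. *)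
apply: (@as_image_exists _ (sqrtC 2%:R)^-1).
by rewrite exprVn sqrtCK mulfV // pnatr_eq0.
Qed.
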